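(* Let $1<p<\infty$. There is a constant $C(p)>0$, depending only on $p$, such that the following holds. Let $\mu$ be a finite measure on $\mathbb{R}$ with compact support, and let $M_\mu$ be the operator on $L^p(\mu)$ given by $(M_\mu f)(t)=tf(t)$. Then for every $\epsilon>0$ there exist a compact operator $K$ on $L^p(\mu)$ with $\pi_1(K)<\epsilon$ and an operator $D$ on $L^p(\mu)$ that is diagonal with respect to a $C(p)$-unconditional basis $(u_n)_{n\ge1}$ for $L^p(\mu)$ such that \[M_\mu=D+K.\]
   Context: Measures are (positive) Borel measures; $L^p(\mu)$ is the complex $L^p$ space; operators are bounded and linear. For an operator $T:X_1\to X_2$ between Banach spaces, $\pi_1(T)$ denotes the 1-summing (absolutely summing) norm: the least $c\in[0,\infty]$ such that $\sum_{k=1}^m\|Tx_k\|\le c\,\sup\{\sum_{k=1}^m|x^*(x_k)|: x^*\in X_1^*,\ \|x^*\|\le1\}$ for all $m$ and $x_1,\dots,x_m\in X_1$. A basis $(u_n)_{n\ge1}$ for a Banach space $X$ is a $C$-unconditional basis if \[\frac1C\Big\|\sum_{n=1}^m |a_n|u_n\Big\|\le\Big\|\sum_{n=1}^m a_nu_n\Big\|\le C\Big\|\sum_{n=1}^m |a_n|u_n\Big\|\] for all $m\ge1$ and $a_1,\dots,a_m\in\mathbb{C}$. If $L^p(\mu)$ is finite dimensional, the basis is understood to be a finite sequence. An operator $D$ is diagonal with respect to $(u_n)$ if for each $n$ there is $\lambda_n\in\mathbb{C}$ with $Du_n=\lambda_nu_n$. *)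

(* Defs.v *)
From HB Require Import structures.
From mathcomp Require Import all_boot all_order all_algebra generic_quotient.
From mathcomp Require Import ring_quotient.
From mathcomp Require Import all_classical all_reals all_analysis.
From mathcomp Require Import measurable_realfun.
From mathcomp Require Import complex.

Set Implicit Arguments.
Unset Strict Implicit.
Unset Printing Implicit Defensive.
Import Order.TTheory GRing.Theory Num.Theory.
Import numFieldNormedType.Exports.

Local Open Scope classical_set_scope.
Local Open Scope ring_scope.
Local Open Scope quotient_scope.
Local Open Scope complex_scope.

(* Norms of normed spaces over R[i] take (nonnegative real) values in R[i];
   rnorm reads them in R. *)
Definition rnorm (R : realType) (V : normedZmodType R[i]) (v : V) : R :=
  complex.Re `|v|.

Section RealNorm.
Context {R : realType} {V : normedZmodType R[i]}.
Implicit Types v w : V.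

Lemma rnormE v : (rnorm v)%:C = `|v|.
Proof. exact/RRe_real/ger0_real/normr_ge0. Qed.

Lemma rnorm_ge0 v : 0 <= rnorm v.
Proof. by rewrite -lecR rnormE normr_ge0. Qed.

Lemma ler_rnormD v w : rnorm (v + w) <= rnorm v + rnorm w.
Proof. by rewrite -lecR rmorphD /= !rnormE ler_normD. Qed.

End RealNorm.

Lemma rnormM (R : realType) (a b : R[i]) : rnorm (a * b) = rnorm a * rnorm b.
Proof.
have inj : injective (fun x : R => x%:C) by move=> x y [].
by apply: inj; rewrite /= rmorphM /= !rnormE normrM.
Qed.

Section Operators.
Context {R : realType}.
Implicit Types X Y : normedModType R[i].

Definition unit_ball {X} : set X := [set x | `|x| <= 1].

Definition bounded_operator X Y (T : {linear X -> Y}) : Prop :=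
  [bounded T x | x in unit_ball].

Definition compact_operator X Y (T : {linear X -> Y}) : Prop :=
  precompact (T @` unit_ball).

(* {scalar X} is the type of linear forms; those of infinite dual_norm are the
   unbounded ones, so [set phi | dual_norm phi <= 1] is the dual unit ball. *)
Definition dual_norm X (phi : {scalar X}) : \bar R :=
  ereal_sup [set (rnorm (phi x))%:E | x in unit_ball].

Definition weak_l1_norm X m (x : 'I_m -> X) : \bar R :=
  ereal_sup [set (\sum_(k < m) rnorm (phi (x k)))%:E
            | phi in [set phi : {scalar X} | (dual_norm phi <= 1)%E]].

Definition one_summing_norm X Y (T : {linear X -> Y}) : \bar R :=
  ereal_inf [set c : \bar R | (0 <= c)%E /\
    forall m (x : 'I_m -> X),
      ((\sum_(k < m) rnorm (T (x k)))%:E <= c * weak_l1_norm x)%E].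

End Operators.

(* A sequence of length N in X is a function u : nat -> X of which only the
   terms u n with in_range N n count: N = Some k stands for the finite sequence
   u 0, ..., u (k - 1) and N = None for an infinite sequence. *)
Definition in_range (N : option nat) (n : nat) : bool :=
  if N is Some k then (n < k)%N else true.

Section Bases.
Context {R : realType} {X : normedModType R[i]}.
Implicit Types (N : option nat) (u : nat -> X).

Definition is_basis N u : Prop :=
  match N with
  | Some k => forall x : X,
      exists! a : 'I_k -> R[i], x = \sum_(i < k) a i *: u i
  | None => forall x : X,
      exists! a : nat -> R[i], series (fun n => a n *: u n) @ \oo --> x
  end.

Definition unconditional (C : R) N u : Prop :=
  forall (m : nat) (a : nat -> R[i]), (forall n, (n < m)%N -> in_range N n) ->
    C^-1 * rnorm (\sum_(n < m) `|a n| *: u n) <= rnorm (\sum_(n < m) a n *: u n)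
    /\
    rnorm (\sum_(n < m) a n *: u n) <= C * rnorm (\sum_(n < m) `|a n| *: u n).

Definition unconditional_basis (C : R) N u : Prop :=
  is_basis N u /\ unconditional C N u.

Definition diagonal_wrt N u (D : {linear X -> X}) : Prop :=
  forall n, in_range N n -> exists lambda : R[i], D (u n) = lambda *: u n.

End Bases.

Section LpFunctions.
Context d (T : measurableType d) (R : realType).
Variables (mu : {measure set T -> \bar R}) (p : R).

Definition cmeasurable (f : T -> R[i]) : Prop :=
  measurable_fun [set: T] (@complex.Re R \o f) /\
  measurable_fun [set: T] (@complex.Im R \o f).

Definition cLnorm (f : T -> R[i]) : \bar R :=
  Lnorm mu p%:E (EFin \o (fun t => rnorm (f t))).

Definition cLfun : {pred T -> R[i]} :=
  mem [set f | cmeasurable f /\ (cLnorm f < +oo)%E].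

Lemma cLfunP f : f \in cLfun <-> cmeasurable f /\ (cLnorm f < +oo)%E.
Proof. by rewrite inE. Qed.

Lemma rnorm_def (z : R[i]) :
  rnorm z = Num.sqrt (complex.Re z ^+ 2 + complex.Im z ^+ 2).
Proof. by rewrite /rnorm normc_def. Qed.

Lemma measurable_rnorm f : cmeasurable f ->
  measurable_fun [set: T] (fun t => rnorm (f t)).
Proof.
move=> [mr mi].
under eq_fun do rewrite rnorm_def.
apply: (@measurableT_comp _ _ _ _ _ _ (@Num.sqrt R)).
  apply: continuous_measurable_fun. apply: sqrt_continuous.
by apply: measurable_funD; exact: measurable_funX.
Qed.

Lemma cmeasurableD f g : cmeasurable f -> cmeasurable g -> cmeasurable (f + g).
Proof.
move=> [fr fi] [gr gi]; split.
- rewrite (_ : _ \o _ = (@complex.Re R \o f) \+ (@complex.Re R \o g)).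
    exact: measurable_funD.
  by apply/funext => t /=; rewrite fctE; case: (f t) (g t) => ? ? [].
- rewrite (_ : _ \o _ = (@complex.Im R \o f) \+ (@complex.Im R \o g)).
    exact: measurable_funD.
  by apply/funext => t /=; rewrite fctE; case: (f t) (g t) => ? ? [].
Qed.

Lemma cmeasurableM f g : cmeasurable f -> cmeasurable g ->
  cmeasurable (fun t => f t * g t).
Proof.
move=> [fr fi] [gr gi]; split.
- rewrite (_ : _ \o _ = (fun t => complex.Re (f t) * complex.Re (g t)
      - complex.Im (f t) * complex.Im (g t))).
    by apply: measurable_funB; exact: measurable_funM.
  by apply/funext => t /=; case: (f t) (g t) => ? ? [].
- rewrite (_ : _ \o _ = (fun t => complex.Re (f t) * complex.Im (g t)
      + complex.Im (f t) * complex.Re (g t))).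
    by apply: measurable_funD; exact: measurable_funM.
  by apply/funext => t /=; case: (f t) (g t) => ? ? [].
Qed.

Lemma cmeasurable_cst (c : R[i]) : cmeasurable (fun=> c).
Proof. by split; exact: measurable_cst. Qed.


Hypothesis p1 : 1 <= p.

Let p_gt0 : 0 < p.
Proof. exact: lt_le_trans ltr01 p1. Qed.

Lemma cLnormE f : cLnorm f =
  ((\int[mu]_t ((rnorm (f t)) `^ p)%:E) `^ p^-1)%E.
Proof.
rewrite /cLnorm unlock; congr (_ `^ _)%E; apply: eq_integral => t _ /=.
by rewrite ger0_norm ?rnorm_ge0.
Qed.

Lemma ler_cLnorm f g : cmeasurable f -> cmeasurable g ->
  (\forall t \ae mu, rnorm (f t) <= rnorm (g t)) ->
  (cLnorm f <= cLnorm g)%E.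
Proof.
move=> mf mg fg; rewrite !cLnormE.
have m h : cmeasurable h ->
    measurable_fun [set: T] (fun t => (rnorm (h t) `^ p)%:E).
  move=> mh; apply/measurable_EFinP.
  apply: (@measurableT_comp _ _ _ _ _ _ (@powR R ^~ p)) => //.
  exact: measurable_rnorm.
apply: gt0_ler_poweR; first by rewrite invr_ge0 ltW.
- by rewrite in_itv/= leey andbT integral_ge0// => t _; rewrite lee_fin powR_ge0.
- by rewrite in_itv/= leey andbT integral_ge0// => t _; rewrite lee_fin powR_ge0.
apply: ae_ge0_le_integral => //; [by move=> t _; rewrite lee_fin powR_ge0|
  exact: m|by move=> t _; rewrite lee_fin powR_ge0|exact: m|].
apply: filterS fg => t fg _.
by rewrite lee_fin ge0_ler_powR// ?nnegrE ?rnorm_ge0// ltW.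
Qed.

Lemma eq_ae_cLnorm f g : cmeasurable f -> cmeasurable g ->
  f = g %[ae mu] -> cLnorm f = cLnorm g.
Proof.
move=> mf mg fg; apply/eqP; rewrite eq_le; apply/andP; split;
  apply: ler_cLnorm => //; apply: filterS fg => t /(_ I) -> //.
Qed.

Lemma cLnormD f g : cmeasurable f -> cmeasurable g ->
  (cLnorm (f + g)%R <= cLnorm f + cLnorm g)%E.
Proof.
move=> mf mg; apply: le_trans (minkowski_EFin mu (measurable_rnorm mf)
  (measurable_rnorm mg) p1).
pose h t : R[i] := (rnorm (f t) + rnorm (g t))%:C.
have h_ge0 t : 0 <= rnorm (f t) + rnorm (g t) by rewrite addr_ge0 ?rnorm_ge0.
have rh t : rnorm (h t) = rnorm (f t) + rnorm (g t).
  by rewrite rnorm_def/= expr0n addr0 sqrtr_sqr ger0_norm.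
rewrite (_ : Lnorm _ _ _ = cLnorm h).
  apply: ler_cLnorm; first exact: cmeasurableD.
    split; last exact: measurable_cst.
    by apply: measurable_funD; exact: measurable_rnorm.
  by apply: aeW => t; rewrite rh ler_rnormD.
by rewrite /cLnorm; congr Lnorm; apply/funext => t /=; rewrite rh.
Qed.

Lemma cLnormZ (c : R[i]) f : cmeasurable f ->
  cLnorm (c *: f) = ((rnorm c)%:E * cLnorm f)%E.
Proof.
move=> mf; rewrite !cLnormE.
under eq_integral do rewrite rnormM powRM ?rnorm_ge0// EFinM.
rewrite ge0_integralZl_EFin ?powR_ge0//; last 2 first.
- by move=> t _; rewrite lee_fin powR_ge0.
- apply/measurable_EFinP.
  apply: (@measurableT_comp _ _ _ _ _ _ (@powR R ^~ p)) => //.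
  exact: measurable_rnorm.
rewrite poweRM ?lee_fin ?powR_ge0//; last first.
  by apply: integral_ge0 => t _; rewrite lee_fin powR_ge0.
by rewrite poweR_EFin -powRrM mulfV ?gt_eqF// powRr1 ?rnorm_ge0.
Qed.

Lemma cLnorm_ge0 f : (0 <= cLnorm f)%E.
Proof. exact: Lnorm_ge0. Qed.

Lemma cLnorm0 : cLnorm 0 = 0%E.
Proof.
have /(cLnormZ 0) : cmeasurable (0 : T -> R[i]) by exact: cmeasurable_cst.
by rewrite scale0r => ->; rewrite rnorm_def/= expr0n addr0 sqrtr0 mul0e.
Qed.

Lemma cLnorm_eq0 f : cmeasurable f -> cLnorm f = 0%E -> f = 0 %[ae mu].
Proof.
move=> mf /Lnorm_eq0_eq0.
have m : measurable_fun [set: T] (EFin \o (fun t => rnorm (f t))).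
  exact/measurable_EFinP/measurable_rnorm.
move=> /(_ m); rewrite lte_fin => /(_ p_gt0).
apply: filterS => t /(_ I) /= [ft0] _.
by apply/normr0_eq0; rewrite -rnormE ft0.
Qed.

Lemma cLfun_submod_closed : submod_closed cLfun.
Proof.
split; first by apply/cLfunP; rewrite cLnorm0; split=> //; exact: cmeasurable_cst.
move=> c f g /cLfunP[mf lf] /cLfunP[mg lg]; apply/cLfunP.
have mcf : cmeasurable (c *: f).
  by apply: cmeasurableM mf; exact: cmeasurable_cst.
split; first exact: cmeasurableD.
apply: le_lt_trans (cLnormD mcf mg) _.
by rewrite lte_add_pinfty// cLnormZ// lte_mul_pinfty// lee_fin rnorm_ge0.
Qed.

End LpFunctions.

(* The exponent's bound p1 is a parameter so that the module structure, which
   relies on Minkowski's inequality, can be inferred from the type. *)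
Record LpFun d (T : measurableType d) (R : realType)
    (mu : {measure set T -> \bar R}) (p : R) (p1 : 1 <= p) : Type := MkLpFun {
  lpfun :> T -> R[i] ;
  lpfunP : lpfun \in cLfun mu p
}.
Arguments LpFun {d T R} mu {p} p1.

Section LpSpace.
Context d (T : measurableType d) (R : realType).
Variables (mu : {measure set T -> \bar R}) (p : R) (p1 : 1 <= p).
Local Notation LpFun := (LpFun mu p1).

HB.instance Definition _ := GRing.isSubmodClosed.Build R[i] (T -> R[i])
  (cLfun mu p) (cLfun_submod_closed mu p1).
HB.instance Definition _ := [isSub for @lpfun d T R mu p p1].
HB.instance Definition _ := [Choice of LpFun by <:].
HB.instance Definition _ := [SubChoice_isSubLmodule of LpFun by <:].

Lemma lpfun_measurable (f : LpFun) : cmeasurable f.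
Proof. by have /cLfunP[] := lpfunP f. Qed.

Lemma cLnorm_lty (f : LpFun) : (cLnorm mu p f < +oo)%E.
Proof. by have /cLfunP[] := lpfunP f. Qed.

Definition null_fun : {pred LpFun} :=
  mem [set f : LpFun | (f : T -> R[i]) = 0 %[ae mu]].

Lemma null_funP (f : LpFun) :
  f \in null_fun <-> (f : T -> R[i]) = 0 %[ae mu].
Proof. by rewrite inE. Qed.

Lemma null_fun_submod_closed : submod_closed null_fun.
Proof.
split; first by apply/null_funP; exact: aeW.
move=> c f g /null_funP f0 /null_funP g0; apply/null_funP.
apply: filterS2 f0 g0 => t f0 g0 _.
rewrite [LHS]/(c * f t + g t) (f0 I) (g0 I).
by have : c * 0 + 0 = 0 by rewrite mulr0 addr0.
Qed.

HB.instance Definition _ := GRing.isSubmodClosed.Build R[i] LpFun null_fun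
  null_fun_submod_closed.

Definition Lp : Type := Quotient.quot null_fun.
HB.instance Definition _ := GRing.Zmodule.on Lp.
HB.instance Definition _ := EqQuotient.on Lp.

(* The class of a function modulo equality mu-a.e., and a representative. *)
Definition toLp (f : LpFun) : Lp := \pi_Lp f.
Definition ofLp (f : Lp) : LpFun := repr f.

Lemma toLpE (f g : LpFun) :
  toLp f = toLp g <-> (f : T -> R[i]) = g %[ae mu].
Proof.
split.
  move=> /eqmodP /=; rewrite /Quotient.equiv => /null_funP.
  apply: filterS => t /[apply] /= fg.
  by apply/eqP; rewrite -subr_eq0; apply/eqP.
move=> fg; apply/eqmodP; rewrite /= /Quotient.equiv; apply/null_funP.
apply: filterS fg => t /[apply] fg; have : f t - g t = 0 by rewrite fg subrr.
exact.
Qed.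

Lemma ofLpK (f : Lp) : toLp (ofLp f) = f.
Proof. exact: reprK. Qed.

Lemma toLpK (f : LpFun) : (ofLp (toLp f) : T -> R[i]) = f %[ae mu].
Proof. by apply/toLpE; rewrite ofLpK. Qed.

Lemma toLpD (f g : LpFun) : toLp (f + g) = toLp f + toLp g.
Proof. exact: Quotient.pi_add. Qed.

Lemma toLp0 : toLp 0 = 0.
Proof. by apply: (addrI (toLp 0)); rewrite -toLpD !addr0. Qed.

Definition Lp_scale (c : R[i]) (f : Lp) : Lp := toLp (c *: ofLp f).

Lemma toLpZ_subproof (c : R[i]) (f : LpFun) :
  Lp_scale c (toLp f) = toLp (c *: f).
Proof.
apply/toLpE; apply: filterS (toLpK f) => t /[apply] ft.
by rewrite [LHS]/(c * ofLp (toLp f) t) ft.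
Qed.

Let scalerA' a b f : Lp_scale a (Lp_scale b f) = Lp_scale (a * b) f.
Proof. by rewrite -[f]ofLpK !toLpZ_subproof scalerA. Qed.

Let scale1r' : left_id 1 Lp_scale.
Proof. by move=> f; rewrite -[f]ofLpK toLpZ_subproof scale1r. Qed.

Let scalerDr' : right_distributive Lp_scale +%R.
Proof.
move=> a f g; rewrite -[f]ofLpK -[g]ofLpK -toLpD !toLpZ_subproof -toLpD.
by rewrite scalerDr.
Qed.

Let scalerDl' f : {morph Lp_scale^~ f : a b / a + b}.
Proof.
by move=> a b; rewrite -[f]ofLpK !toLpZ_subproof -toLpD scalerDl.
Qed.

HB.instance Definition _ := GRing.Zmodule_isLmodule.Build R[i] Lp
  scalerA' scale1r' scalerDr' scalerDl'.

Lemma toLpZ (c : R[i]) (f : LpFun) : toLp (c *: f) = c *: toLp f.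
Proof. by rewrite -toLpZ_subproof. Qed.

Definition Lp_norm (f : Lp) : R[i] := (fine (cLnorm mu p (ofLp f)))%:C.

Lemma Lp_normE (f : LpFun) : Lp_norm (toLp f) = (fine (cLnorm mu p f))%:C.
Proof.
rewrite /Lp_norm (eq_ae_cLnorm p1 _ _ (toLpK f))//; exact: lpfun_measurable.
Qed.

Let fin (f : LpFun) : cLnorm mu p f \is a fin_num.
Proof. by rewrite ge0_fin_numE ?cLnorm_ge0// cLnorm_lty. Qed.

Let Lp_normD f g : Lp_norm (f + g) <= Lp_norm f + Lp_norm g.
Proof.
rewrite -[f]ofLpK -[g]ofLpK -toLpD !Lp_normE -rmorphD lecR -lee_fin EFinD.
by rewrite !fineK// cLnormD//; exact: lpfun_measurable.
Qed.

Let Lp_normZ (c : R[i]) f : Lp_norm (c *: f) = `|c| * Lp_norm f.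
Proof.
rewrite -[f]ofLpK -toLpZ !Lp_normE -rnormE -rmorphM; congr (_%:C).
by rewrite (cLnormZ _ p1) ?fineM// ?fin//; exact: lpfun_measurable.
Qed.

Let Lp_norm0_eq0 f : Lp_norm f = 0 -> f = 0.
Proof.
rewrite -[f]ofLpK Lp_normE => -[f0].
rewrite -toLp0; apply/toLpE; apply: (cLnorm_eq0 p1); first exact: lpfun_measurable.
by rewrite -[LHS]fineK// f0.
Qed.

HB.instance Definition _ := Lmodule_isNormed.Build R[i] Lp
  Lp_normD Lp_normZ Lp_norm0_eq0.

Lemma normr_toLp (f : LpFun) : `|toLp f| = (fine (cLnorm mu p f))%:C.
Proof. exact: Lp_normE. Qed.

End LpSpace.
Arguments Lp {d T R} mu {p} p1.

Definition measure_support (R : realType)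
    (mu : {measure set R -> \bar R}) : set R :=
  [set x | forall U : set R, open U -> U x -> (0 < mu U)%E].

Section MultiplicationOperator.
Context (R : realType).
Variables (mu : {measure set R -> \bar R}) (p : R) (p1 : 1 <= p).
Hypothesis supp_mu : compact (measure_support mu).
Local Notation Lp := (Lp mu p1).

Lemma ae_measure_support : \forall t \ae mu, measure_support mu t.
Proof.
pose J (q : rat * rat) : set R := `]ratr q.1, ratr q.2[%classic.
pose F k : set R :=
  if unpickle k is Some q then if mu (J q) == 0%E then J q else set0 else set0.
apply: (@negligibleS _ _ _ _ (\bigcup_k F k)); last first.
  apply: negligible_bigcup => k; rewrite /F.
  case: (unpickle k) => [q|]; last exact: negligible_set0.
  case: eqP => [Iq0|_]; last exact: negligible_set0.
  by apply/negligibleP; [exact: measurable_itv|].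
move=> x /existsNP[U /not_implyP[oU /not_implyP[Ux /negP]]].
rewrite -leNgt measure_le0 => /eqP U0.
have /nbhs_ballP[e /= e0 xeU] : nbhs x U by exact: open_nbhs_nbhs.
have [a] : exists a : rat, ratr a \in `]x - e, x[.
  by apply: rat_in_itvoo; rewrite ltrBlDr ltrDl.
have [b] : exists b : rat, ratr b \in `]x, x + e[.
  by apply: rat_in_itvoo; rewrite ltrDl.
rewrite !in_itv/= => /andP[xb bxe] /andP[xea ax].
exists (pickle (a, b)); first exact: I.
rewrite /F pickleK.
have -> : mu (J (a, b)) = 0%E.
  apply/eqP; rewrite -measure_le0 -U0; apply: le_measure; rewrite ?inE.
  - exact: measurable_itv.
  - exact: open_measurable.
  move=> y; rewrite /J /= in_itv/= => /andP[ay yb]; apply: xeU.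
  rewrite /ball/= ltr_distlC (lt_trans xea ay)/=; exact: lt_trans bxe.
by rewrite eqxx /J /= in_itv/= ax.
Qed.

Lemma mul_id_in (f : LpFun mu p1) : (fun t => t%:C * f t) \in cLfun mu p.
Proof.
have [M M0 suppM] := pinfty_ex_gt0 (compact_bounded supp_mu).
have mM : cmeasurable (M%:C *: (f : R -> R[i])).
  by apply: cmeasurableM; [exact: cmeasurable_cst|exact: lpfun_measurable].
have mi : cmeasurable (fun t : R => t%:C * f t).
  apply: cmeasurableM; last exact: lpfun_measurable.
  by split; [exact: measurable_id|exact: measurable_cst].
apply/cLfunP; split => //.
apply: (@le_lt_trans _ _ (cLnorm mu p (M%:C *: (f : R -> R[i])))).
  apply: ler_cLnorm => //; apply: filterS ae_measure_support => t supp_t.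
  rewrite !rnormM ler_wpM2r ?rnorm_ge0// !rnorm_def/= expr0n/= !addr0.
  by rewrite !sqrtr_sqr (ger0_norm (ltW M0)) suppM.
rewrite cLnormZ//; last exact: lpfun_measurable.
by rewrite lte_mul_pinfty ?lee_fin ?rnorm_ge0// cLnorm_lty.
Qed.

Definition mul_id (f : LpFun mu p1) : LpFun mu p1 := MkLpFun p1 (mul_id_in f).

Definition mul_op (f : Lp) : Lp := toLp (mul_id (ofLp f)).

Lemma mul_opE (f : LpFun mu p1) : mul_op (toLp f) = toLp (mul_id f).
Proof.
by apply/toLpE; apply: filterS (toLpK f) => t /[apply] /= ->.
Qed.

Lemma mul_opP (f : Lp) :
  (ofLp (mul_op f) : R -> R[i]) = (fun t => t%:C * ofLp f t) %[ae mu].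
Proof. exact: toLpK. Qed.

Lemma mul_op_is_linear : linear mul_op.
Proof.
move=> c f g; rewrite -[f]ofLpK -[g]ofLpK -toLpZ -toLpD !mul_opE -toLpZ -toLpD.
congr toLp; apply/val_inj/funext => t /=.
have : t%:C * (c * ofLp f t + ofLp g t) =
  c * (t%:C * ofLp f t) + t%:C * ofLp g t by rewrite mulrDr mulrCA.
exact.
Qed.

HB.instance Definition _ := GRing.isLinear.Build R[i] Lp Lp *:%R mul_op
  mul_op_is_linear.

End MultiplicationOperator.

(* Main.v *)
(* Fix p and split a dyadic tree of intervals of lengths L 2^-n over the support
   of mu.  The indicators of M disjoint intervals that cover the support and the
   Haar functions v_n of these intervals and of all their descendants span a
   dense subspace of L^p(mu), and they are unconditional with a
   constant that depends on p only (Burkholder's theorem): the function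
   (|x|^2 + |y|^2)^(p/2) - A (|x|^2 + beta |y|^2)^(p/2), with A large and beta
   small, is concave along every complex line (x + t b, y + t a), t real, with
   |a| <= |b|, so its mean does not increase when a leaf of the tree is split.

   Let D multiply v_n by the center of the interval of v_n, and K = M_mu - D.
   On the block of the 2^j M Haar functions of the j-th generation, K acts, up to the
   factor 4L/(2^j M), like the identity of l^p of dimension at most d = 2^j M.
   By Khintchine's inequality the 1-summing norm of that identity is
   O(d^(1 - theta)) with theta = min(1/2, 1/p), hence the block contributes
   O((2^j M)^(- theta)).  The sum over j is O(M^(- theta)), and M is free.

   The measure need not be doubling and may have atoms.  Haar functions that
   vanish mu-almost everywhere are therefore allowed, and they are discarded
   only at the end, by passing to the subsequence of the nonzero ones. *)

From HB Require Import structures.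
Require Import Defs.
From mathcomp Require Import all_boot all_order all_algebra.
From mathcomp Require Import all_classical all_reals all_analysis.
From mathcomp Require Import measurable_realfun complex ring lra zify.

Set Implicit Arguments.
Unset Strict Implicit.
Unset Printing Implicit Defensive.
Import Order.TTheory GRing.Theory Num.Theory.
Import numFieldNormedType.Exports.
Local Open Scope classical_set_scope.
Local Open Scope ring_scope.
Local Open Scope complex_scope.

(** * A Bellman function *)

(** The Bellman function reduces a martingale inequality to one split. Its weighted sum over the
    leaves starts nonpositive, no split increases it, and it always dominates a multiple of
    |transform|^p minus a multiple of |original|^p. The resulting constant sees neither the weights
    nor M, which is essential: M is chosen after eps, and mu distributes the weights arbitrarily.
    That p > 1 means p/2 > 1/2, which is what bounds the second derivative of a power of a quadratic
    from below.

    For the summing norm, a block is an l^p sum in coordinates scaled by the norms of the v_n. Its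
    norm is at most d^max(0, 1/p - 1/2), up to a constant, times the mean of |phi_s| over sign
    functionals phi_s. Each phi_s has norm O(d^(1 - 1/p)) and can be tested against the weak l^1
    norm. With the factor 1/d of K the exponent becomes max(0, 1/p - 1/2) - 1/p = - min(1/2, 1/p).

    K is built first, as the absolutely convergent sum of its blocks, and D is then defined as M_mu
    - K. Thus both operators exist on the whole space at once, and only the action on basis vectors
    remains to be identified. *)

Section Calculus.
Context {R : realType}.
Implicit Types (f : R -> R) (q : R).

(** Concavity is used as a bound by one tangent because [bellman_split] adds two such bounds with a
    common base point and slope. *)
Lemma tangent_upper_bound f (f1 f2 : R -> R) :
    (forall x : R, is_derive x 1 f (f1 x)) -> (forall x : R, is_derive x 1 f1 (f2 x)) ->
    (forall x, f2 x <= 0) ->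
  forall t, f t <= f 0 + f1 0 * t.
Proof.
move=> df df1 f2_le0 t.
have cont g (g' : R -> R) : (forall x : R, is_derive x 1 g (g' x)) ->
    forall a b, {within `[a, b], continuous g}.
  move=> dg a b; apply: derivable_within_continuous => x _.
  by have [] := dg x.
case: (ltgtP t 0) => [t0|t0|->]; last by rewrite mulr0 addr0.
- have [c] := MVT t0 (fun x _ => df x) (cont _ _ df _ _).
  rewrite in_itv/= => /andP[tc c0] fc.
  have [d _ f1c] := MVT c0 (fun x _ => df1 x) (cont _ _ df1 _ _).
  have : f1 0 <= f1 c by have := f2_le0 d; nra.
  nra.
- have [c] := MVT t0 (fun x _ => df x) (cont _ _ df _ _).
  rewrite in_itv/= => /andP[c0 ct] fc.
  have [d _ f1c] := MVT c0 (fun x _ => df1 x) (cont _ _ df1 _ _).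
  have : f1 c <= f1 0 by have := f2_le0 d; nra.
  nra.
Qed.

(** Squared moduli along a real line have this form. With the factor 2 a nonpositive discriminant
    reads b^2 <= a c, which is a Cauchy-Schwarz inequality in the application. *)
Definition quad (a b c t : R) : R := a + 2 * b * t + c * t ^+ 2.

Lemma is_derive_quad (a b c t : R) :
  is_derive t 1 (quad a b c) (2 * (b + c * t)).
Proof.
rewrite /quad; apply: is_derive_eq.
rewrite /GRing.scale/=; ring.
Qed.

Lemma is_derive_powR_quad (a b c q t : R) : 0 < quad a b c t ->
  is_derive t 1 (fun x => quad a b c x `^ q)
    (q * quad a b c t `^ (q - 1) * (2 * (b + c * t))).
Proof.
move=> Qt; have := is_derive_quad a b c t => dQ.
have := is_derive1_powR q Qt => dp.
by apply: (is_derive1_comp (f := fun x : R => x `^ q) (g := quad a b c)).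
Qed.

Lemma is_derive2_powR_quad (a b c q t : R) : 0 < quad a b c t ->
  is_derive t 1
    (fun x => q * quad a b c x `^ (q - 1) * (2 * (b + c * x)))
    (q * (2 * c * quad a b c t `^ (q - 1)
      + (q - 1) * (quad a b c t `^ (q - 1 - 1) * (2 * (b + c * t)) ^+ 2))).
Proof.
move=> Qt; have := is_derive_powR_quad (q - 1) Qt => dQ.
apply: is_derive_eq.
rewrite /GRing.scale/=; ring.
Qed.

Lemma quad_deriv_sqr_le (a b c t : R) : b ^+ 2 <= a * c ->
  (2 * (b + c * t)) ^+ 2 <= 4 * c * quad a b c t.
Proof.
rewrite /quad => bac.
rewrite (_ : 4 * c * _ = (2 * (b + c * t)) ^+ 2 + 4 * (a * c - b ^+ 2)); first by lra.
ring.
Qed.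

(** For Q = [quad a b c], (Q^q)'' = q Q^(q-1) (Q'' + (q-1) Q'^2 / Q), and 0 <= Q'^2 / Q <= 4 c = 2
    Q''. So the bracket lies between Q'' and (2q-1) Q'', in an order that depends on whether q <=
    1. *)
Lemma powR_quad_deriv2_bounds (a b c q t : R) : 0 < quad a b c t ->
    b ^+ 2 <= a * c -> 1 / 2 < q ->
  let Z := quad a b c t `^ (q - 1) in
  let D := q * (2 * c * Z
      + (q - 1) * (quad a b c t `^ (q - 1 - 1) * (2 * (b + c * t)) ^+ 2)) in
  q * (2 * c * Z) * Num.min 1 (2 * q - 1) <= D /\
  D <= q * (2 * c * Z) * Num.max 1 (2 * q - 1).
Proof.
move=> Qt bac q2 Z D.
set W := _ `^ (q - 1 - 1) * _ in D *.
have c0 : 0 <= c.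
  have := quad_deriv_sqr_le t bac; have := sqr_ge0 (2 * (b + c * t)); nra.
have Z0 : 0 < Z by rewrite powR_gt0.
have W0 : 0 <= W by rewrite mulr_ge0 ?powR_ge0 ?sqr_ge0.
have WZ : W <= 4 * c * Z.
  have -> : Z = quad a b c t `^ (q - 1 - 1) * quad a b c t.
    rewrite -[X in _ = _ * X]powRr1 ?ltW// -powRD; first by rewrite subrK.
    by apply/implyP => _; rewrite gt_eqF.
  rewrite mulrCA ler_wpM2l ?powR_ge0//; exact: quad_deriv_sqr_le.
have cZ : 0 <= c * Z by rewrite mulr_ge0// ltW.
case: (leP q 1) => q1.
  rewrite min_r ?max_l; [|lra|lra].
  have [e1 e2] : (q - 1) * (4 * c * Z) <= (q - 1) * W /\ (q - 1) * W <= 0 by nra.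
  rewrite /D; split; nra.
rewrite min_l ?max_r; [|lra|lra].
have [e1 e2] : (q - 1) * W <= (q - 1) * (4 * c * Z) /\ 0 <= (q - 1) * W by nra.
rewrite /D; split; nra.
Qed.


(** With S and T the two quadratics, the second derivative of S^q is at most 2 q c M S^(q-1), and
    that of T^q is at least 2 q c' m T^(q-1), where M and m are the maximum and minimum of 1 and
    2q-1. Since c <= 2 c' and T is comparable to S, the assumption on A makes S^q - A T^q
    concave. *)
Lemma powR_quad_diff_tangent (a b c a' b' c' q beta A : R) :
    1 / 2 < q -> 0 < beta <= 1 ->
    2 * Num.max 1 (2 * q - 1) <=
      A * Num.min 1 (2 * q - 1) * Num.min 1 (beta `^ (q - 1)) ->
    0 <= c <= 2 * c' -> b ^+ 2 <= a * c -> b' ^+ 2 <= a' * c' ->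
    (forall t, 0 < quad a b c t) ->
    (forall t, beta * quad a b c t <= quad a' b' c' t <= quad a b c t) ->
  exists l, forall t,
    quad a b c t `^ q - A * quad a' b' c' t `^ q <=
    quad a b c 0 `^ q - A * quad a' b' c' 0 `^ q + l * t.
Proof.
move=> q2 /andP[beta0 beta1] hA /andP[c0 cc'] hb hb' S0 hSR.
have R0 t : 0 < quad a' b' c' t.
  by have /andP[+ _] := hSR t; apply: lt_le_trans; rewrite mulr_gt0.
have m0 : 0 < Num.min 1 (2 * q - 1) by rewrite lt_min ltr01/=; lra.
have bq : 0 < Num.min 1 (beta `^ (q - 1)) by rewrite lt_min ltr01 powR_gt0.
have M0 : 0 < Num.max 1 (2 * q - 1) by rewrite lt_max ltr01.
have A0 : 0 <= A.
  have := mulr_gt0 m0 bq; nra.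
pose D (a b c t : R) := q * (2 * c * quad a b c t `^ (q - 1)
      + (q - 1) * (quad a b c t `^ (q - 1 - 1) * (2 * (b + c * t)) ^+ 2)).
pose d (a b c t : R) := q * quad a b c t `^ (q - 1) * (2 * (b + c * t)).
exists (d a b c 0 - A * d a' b' c' 0).
pose g t := d a b c t - A * d a' b' c' t.
apply: (@tangent_upper_bound _ g (fun t => D a b c t - A * D a' b' c' t)) => t.
- have := is_derive_powR_quad q (S0 t) => dS.
  have := is_derive_powR_quad q (R0 t) => dR.
  apply: is_derive_eq; rewrite /g /d /GRing.scale/=; ring.
- have := is_derive2_powR_quad q (S0 t) => dS.
  have := is_derive2_powR_quad q (R0 t) => dR.
  apply: is_derive_eq; rewrite /D /GRing.scale/=; ring.
have /andP[bSR RS] := hSR t.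
have [_ DS] := powR_quad_deriv2_bounds (S0 t) hb q2.
have [DR _] := powR_quad_deriv2_bounds (R0 t) hb' q2.
rewrite -/(D _ _ _ _) in DS DR.
(* The exponent q - 1 changes sign at q = 1: for q <= 1 the upper bound of the second quadratic by
   the first is used, for q > 1 the lower bound by [beta] times the first. *)
have SR : Num.min 1 (beta `^ (q - 1)) * quad a b c t `^ (q - 1) <=
    quad a' b' c' t `^ (q - 1).
  case: (leP q 1) => q1.
    apply: (@le_trans _ _ (quad a b c t `^ (q - 1))).
      by rewrite ler_piMl ?powR_ge0// ge_min lexx.
    rewrite -[q - 1]opprB !powRN lef_pV2 ?posrE ?powR_gt0//.
    apply: ge0_ler_powR => //; [lra | exact: ltW (R0 t) | exact: ltW (S0 t)].
  apply: (@le_trans _ _ (beta `^ (q - 1) * quad a b c t `^ (q - 1))).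
    by rewrite ler_wpM2r ?powR_ge0// ge_min lexx orbT.
  rewrite -powRM; [|exact: ltW beta0|exact: ltW (S0 t)].
  have bS : 0 < beta * quad a b c t by rewrite mulr_gt0.
  apply: ge0_ler_powR => //; [lra | exact: ltW bS | exact: ltW (R0 t)].
rewrite subr_le0; apply: (le_trans DS).
apply: le_trans (ler_wpM2l A0 DR).
set X := quad a b c t `^ (q - 1) in SR *.
set Y := quad a' b' c' t `^ (q - 1) in SR *.
set m := Num.min 1 (2 * q - 1) in hA m0 *.
set M := Num.max 1 (2 * q - 1) in hA M0 *.
set e := Num.min 1 _ in hA bq SR.
have X0 : 0 < X by rewrite powR_gt0.
have c'0 : 0 <= c' by lra.
apply: (@le_trans _ _ (2 * q * c' * (2 * M * X))).
  rewrite (_ : q * _ * M = 2 * q * c * (M * X)); last by ring.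
  rewrite (_ : 2 * q * c' * _ = 2 * q * (2 * c') * (M * X)); last by ring.
  rewrite ler_wpM2r//; first by rewrite mulr_ge0// ltW.
  rewrite ler_wpM2l//; lra.
rewrite (_ : A * _ = 2 * q * c' * (A * m * Y)); last by ring.
rewrite ler_wpM2l//; first by rewrite mulr_ge0//; lra.
apply: (@le_trans _ _ (A * m * e * X)); first by rewrite ler_wpM2r// ltW.
by rewrite -mulrA ler_wpM2l// mulr_ge0// ltW.
Qed.

End Calculus.

Section Bellman.
Context {R : realType}.
Implicit Types x y a b : R[i].

Lemma powR_cvg_right (s q : R) : 0 <= s -> 0 < q ->
  (s + e) `^ q @[e --> 0^'+] --> s `^ q.
Proof.
move=> s0 q0; move: s0; rewrite le_eqVlt => /predU1P[<-|s0].
  rewrite powR0 ?gt_eqF//; under eq_fun do rewrite add0r; exact: powR_cvg0.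
have : {for s, continuous (fun x : R => x `^ q)}.
  apply: differentiable_continuous; apply/derivable1_diffP.
  by have [] := is_derive1_powR q s0.
move=> cs; apply: (@continuous_cvg _ _ _ _ _ (fun e => s + e) (fun u : R => u `^ q) s) => //.
rewrite -[X in _ --> X]addr0; apply: cvgD; first exact: cvg_cst.
exact: cvg_at_right_filter cvg_id.
Qed.

Definition sqmod (x : R[i]) : R := complex.Re x ^+ 2 + complex.Im x ^+ 2.

Lemma sqmod_ge0 x : 0 <= sqmod x.
Proof. by rewrite addr_ge0// sqr_ge0. Qed.

Lemma rnorm_sqr x : rnorm x ^+ 2 = sqmod x.
Proof. by rewrite rnorm_def sqr_sqrtr// sqmod_ge0. Qed.

Lemma powR_sqmod x p : sqmod x `^ (p / 2) = rnorm x `^ p.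
Proof.
rewrite -rnorm_sqr -powR_mulrn ?rnorm_ge0// -powRrM; congr (_ `^ _).
by rewrite mulrC divfK.
Qed.

(** The real inner product Re (x conj y) of the plane; it is the mixed coefficient of [sqmod] along
    a line. *)
Definition redot x y : R :=
  complex.Re x * complex.Re y + complex.Im x * complex.Im y.

Lemma sqmod_line x b (t : R) : sqmod (x + t%:C * b) = quad (sqmod x) (redot x b) (sqmod b) t.
Proof. by case: x b => [x1 x2] [b1 b2]; rewrite /sqmod /redot /quad/=; ring. Qed.

(** Cauchy-Schwarz for a weighted inner product, proved by Lagrange's identity: the difference of
    the two sides is a sum of squares with nonnegative coefficients. It provides the discriminant
    condition on [quad]. *)
Lemma redot_weighted_cauchy (k : R) x y a b (e : R) : 0 <= k -> 0 <= e ->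
  (redot x b + k * redot y a) ^+ 2 <=
  (sqmod x + k * sqmod y + e) * (sqmod b + k * sqmod a).
Proof.
move=> k0 e0; rewrite /redot /sqmod.
set x1 := complex.Re x; set x2 := complex.Im x.
set y1 := complex.Re y; set y2 := complex.Im y.
set a1 := complex.Re a; set a2 := complex.Im a.
set b1 := complex.Re b; set b2 := complex.Im b.
rewrite [leRHS](_ : _ = (x1 * b1 + x2 * b2 + k * (y1 * a1 + y2 * a2)) ^+ 2 +
  ((x1 * b2 - x2 * b1) ^+ 2 + k * ((x1 * a1 - y1 * b1) ^+ 2 +
  (x1 * a2 - y2 * b1) ^+ 2 + (x2 * a1 - y1 * b2) ^+ 2 +
  (x2 * a2 - y2 * b2) ^+ 2) + (k * (y1 * a2 - y2 * a1)) ^+ 2 +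
  e * (b1 ^+ 2 + b2 ^+ 2 + k * (a1 ^+ 2 + a2 ^+ 2)))); last by ring.
rewrite lerDl.
by repeat first [exact: sqr_ge0 | exact: k0 | exact: e0 | apply: addr_ge0 | apply: mulr_ge0].
Qed.

(* The shift e > 0 removes the singularity at the origin. *)
Definition bellman (q A beta e : R) x y : R :=
  (sqmod x + sqmod y + e) `^ q - A * (sqmod x + beta * sqmod y + e) `^ q.

Section Split.
Variables (q A beta : R).
Hypothesis q2 : 1 / 2 < q.
Hypothesis beta01 : 0 < beta <= 1.
Hypothesis hA : 2 * Num.max 1 (2 * q - 1) <=
      A * Num.min 1 (2 * q - 1) * Num.min 1 (beta `^ (q - 1)).

(** The assumption |a| <= |b| enters only through |b|^2 + |a|^2 <= 2 (|b|^2 + beta |a|^2), the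
    comparison of leading coefficients in [powR_quad_diff_tangent]; e > 0 keeps both quadratics
    positive. *)
Lemma bellman_tangent (e : R) x y a b : 0 < e -> sqmod a <= sqmod b ->
  exists l, forall t : R,
    bellman q A beta e (x + t%:C * b) (y + t%:C * a) <=
    bellman q A beta e x y + l * t.
Proof.
move=> e0 ab; have /andP[beta0 beta1] := beta01.
pose S := quad (sqmod x + sqmod y + e) (redot x b + redot y a) (sqmod b + sqmod a).
pose T := quad (sqmod x + beta * sqmod y + e) (redot x b + beta * redot y a)
  (sqmod b + beta * sqmod a).
have SE t : S t = sqmod (x + t%:C * b) + sqmod (y + t%:C * a) + e.
  by rewrite !sqmod_line /S /quad; ring.
have TE t : T t = sqmod (x + t%:C * b) + beta * sqmod (y + t%:C * a) + e.
  by rewrite !sqmod_line /T /quad; ring.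
have [|||t|t|l] := @powR_quad_diff_tangent _ (sqmod x + sqmod y + e) (redot x b + redot y a)
  (sqmod b + sqmod a) (sqmod x + beta * sqmod y + e) (redot x b + beta * redot y a)
  (sqmod b + beta * sqmod a) q beta A q2 beta01 hA.
- have := sqmod_ge0 a; have := sqmod_ge0 b; move=> b0 a0.
  have := mulr_ge0 (ltW beta0) a0; lra.
- have := @redot_weighted_cauchy 1 x y a b e ler01 (ltW e0).
  by rewrite !mul1r.
- exact: redot_weighted_cauchy (ltW beta0) (ltW e0).
- by rewrite -/(S t) SE; have := sqmod_ge0 (x + t%:C * b);
    have := sqmod_ge0 (y + t%:C * a); lra.
- rewrite -/(S t) -/(T t) SE TE; have := sqmod_ge0 (x + t%:C * b);
    have := sqmod_ge0 (y + t%:C * a); nra.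
move=> h; exists l => t; have := h t.
rewrite -!/(S _) -!/(T _) !SE !TE /bellman.
have -> : (0 : R)%:C = 0 by [].
by rewrite !mul0r !addr0.
Qed.

(** The displacements have weighted mean zero, so the slope terms of the two tangent bounds cancel.
    This is done for e > 0, and then e tends to 0. *)
Lemma bellman_split x y a b (w1 w2 t1 t2 : R) : 0 <= w1 -> 0 <= w2 ->
    w1 * t1 + w2 * t2 = 0 -> sqmod a <= sqmod b ->
  w1 * bellman q A beta 0 (x + t1%:C * b) (y + t1%:C * a) +
  w2 * bellman q A beta 0 (x + t2%:C * b) (y + t2%:C * a) <=
  (w1 + w2) * bellman q A beta 0 x y.
Proof.
move=> w10 w20 wt ab.
have q0 : 0 < q by apply: lt_trans q2; rewrite divr_gt0.
have cB u v : bellman q A beta e u v @[e --> 0^'+] --> bellman q A beta 0 u v.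
  rewrite /bellman !addr0; have /andP[beta0 _] := beta01.
  apply: cvgB; first by apply: powR_cvg_right => //; rewrite addr_ge0 ?sqmod_ge0.
  apply: cvgMl_tmp; apply: powR_cvg_right => //.
  by rewrite addr_ge0 ?mulr_ge0 ?sqmod_ge0 1?ltW.
apply: (ler_cvg_to (a := 0^'+)
  (f := fun e => w1 * bellman q A beta e (x + t1%:C * b) (y + t1%:C * a) +
    w2 * bellman q A beta e (x + t2%:C * b) (y + t2%:C * a))
  (g := fun e => (w1 + w2) * bellman q A beta e x y)).
- by apply: cvgD; apply: cvgMl_tmp; exact: cB.
- by apply: cvgMl_tmp; exact: cB.
near=> e.
have e0 : 0 < e by near: e; exact: nbhs_right_gt.
have [l hl] := bellman_tangent x y e0 ab.
apply: le_trans (lerD (ler_wpM2l w10 (hl t1)) (ler_wpM2l w20 (hl t2))) _.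
rewrite [leLHS](_ : _ = (w1 + w2) * bellman q A beta e x y + l * (w1 * t1 + w2 * t2)); last by ring.
by rewrite wt mulr0 addr0.
Unshelve. all: by end_near. Qed.

End Split.
End Bellman.

Section BellmanConstants.
Context {R : realType}.

Lemma powR_add_le (x y q : R) : 0 <= x -> 0 <= y -> 0 <= q ->
  (x + y) `^ q <= (2 * x) `^ q + (2 * y) `^ q.
Proof.
move=> x0 y0 q0; have [xy|yx] := leP x y.
  apply: (@le_trans _ _ ((2 * y) `^ q)); last by rewrite lerDr powR_ge0.
  apply: ge0_ler_powR => //; rewrite ?nnegrE; lra.
apply: (@le_trans _ _ ((2 * x) `^ q)); last by rewrite lerDl powR_ge0.
apply: ge0_ler_powR => //; rewrite ?nnegrE; lra.
Qed.

(** The constraints are circular: A must grow like 1 / e with e = min(1, beta^(q-1)), while A (2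
    beta)^q must stay small. Taking A = k / e, the second condition concerns beta^q / e, which is
    beta^q or beta; both are at most [rho] by the choice of [beta]. *)
Lemma bellman_constants (q : R) : 1 / 2 < q ->
  exists A beta : R, [/\ 0 < beta <= 1,
    2 * Num.max 1 (2 * q - 1) <=
      A * Num.min 1 (2 * q - 1) * Num.min 1 (beta `^ (q - 1)),
    2 `^ q <= A & A * (2 * beta) `^ q <= 1 / 2].
Proof.
move=> q2; have q0 : 0 < q by lra.
set m := Num.min _ _; set M := Num.max _ _.
have m0 : 0 < m by rewrite lt_min ltr01/=; lra.
pose k := Num.max (2 * M / m) (2 `^ q).
have h1 : 2 * M / m <= k by rewrite le_max lexx.
have h2 : 2 `^ q <= k by rewrite le_max lexx orbT.
have p2 : 0 < (2 : R) `^ q by rewrite powR_gt0.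
have k0 : 0 < k by apply: lt_le_trans h2.
pose rho := (2 * (k * 2 `^ q))^-1.
have r0 : 0 < rho by rewrite invr_gt0 mulr_gt0// mulr_gt0.
have r1 : rho <= 1.
  rewrite invf_le1 ?mulr_gt0//.
  have : 1 <= (2 : R) `^ q by rewrite -[leLHS](powRr0 2) ler_powR ?ler1n// ltW.
  nra.
pose beta := Num.min rho (rho `^ q^-1).
have b0 : 0 < beta by rewrite lt_min r0 powR_gt0.
have br : beta <= rho by rewrite ge_min lexx.
have bqr : beta `^ q <= rho.
  have -> : rho = (rho `^ q^-1) `^ q.
    by rewrite -powRrM mulVf ?gt_eqF// powRr1// ltW.
  apply: ge0_ler_powR; rewrite ?nnegrE ?powR_ge0 ?(ltW b0) ?(ltW q0)//.
  by rewrite ge_min lexx orbT.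
set e := Num.min 1 (beta `^ (q - 1)).
have e0 : 0 < e by rewrite lt_min ltr01 powR_gt0.
have e1 : e <= 1 by rewrite ge_min lexx.
have kr : k * 2 `^ q * rho = 1 / 2.
  by rewrite /rho; field; rewrite !gt_eqF//.
exists (k / e), beta; split.
- by rewrite b0 (le_trans br).
- rewrite (_ : k / e * m * e = k * m); last by field; rewrite gt_eqF.
  by rewrite -ler_pdivrMr.
- by rewrite (le_trans h2)// ler_pdivlMr// ler_piMr// ltW.
- rewrite powRM//; last exact: ltW.
  rewrite [leLHS](_ : _ = k * 2 `^ q * (beta `^ q / e)); last by field; rewrite gt_eqF.
  rewrite -kr ler_wpM2l//; first by rewrite ltW// mulr_gt0.
  rewrite ler_pdivrMr// /e; case: (leP 1 (beta `^ (q - 1))) => _; first by rewrite mulr1.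
  have -> : beta `^ q = beta * beta `^ (q - 1) by rewrite mulr_powRB1// ltW.
  by rewrite ler_wpM2r// powR_ge0.
Qed.

End BellmanConstants.

Section BellmanBounds.
Context {R : realType} (q A beta : R).
Hypothesis q0 : 0 < q.
Hypothesis beta01 : 0 < beta <= 1.
Hypothesis hA : 2 `^ q <= A.
Hypothesis hAb : A * (2 * beta) `^ q <= 1 / 2.

Let A0 : 0 <= A. Proof. exact: le_trans (powR_ge0 _ _) hA. Qed.
Let beta0 : 0 <= beta. Proof. by have /andP[/ltW] := beta01. Qed.

Lemma bellman_le0 (x y : R[i]) : sqmod y <= sqmod x ->
  bellman q A beta 0 x y <= 0.
Proof.
move=> yx; rewrite /bellman !addr0 subr_le0.
have x0 := sqmod_ge0 x; have y0 := sqmod_ge0 y.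
apply: (@le_trans _ _ ((2 * sqmod x) `^ q)).
  apply: ge0_ler_powR; rewrite ?nnegrE ?(ltW q0)//; lra.
rewrite powRM// ler_pM ?powR_ge0//.
have by0 : 0 <= beta * sqmod y by rewrite mulr_ge0.
apply: ge0_ler_powR; rewrite ?nnegrE ?(ltW q0)//; first exact: addr_ge0.
by rewrite lerDl mulr_ge0.
Qed.

(** By [powR_add_le] the subtracted power splits into an x part and a y part, and [hAb] lets the y
    part cost at most half of the first term. *)
Lemma bellman_ge (x y : R[i]) :
  1 / 2 * sqmod y `^ q - A * 2 `^ q * sqmod x `^ q <= bellman q A beta 0 x y.
Proof.
rewrite /bellman !addr0.
have x0 := sqmod_ge0 x; have y0 := sqmod_ge0 y.
have h1 : sqmod y `^ q <= (sqmod x + sqmod y) `^ q.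
  apply: ge0_ler_powR; rewrite ?nnegrE ?(ltW q0)//; lra.
have := powR_add_le x0 (mulr_ge0 beta0 y0) (ltW q0).
rewrite mulrA !(@powRM _ _ (sqmod _)) ?mulr_ge0// => /(ler_wpM2l A0) h2.
have := ler_wpM2r (powR_ge0 (sqmod y) q) hAb.
lra.
Qed.

End BellmanBounds.

(** * Haar partial sums *)

(** Splitting the leaf [m] of a heap: it leaves the sum, and its two children enter. *)
Lemma big_leaves_split (V : zmodType) (F : nat -> V) m : (0 < m)%N ->
  \sum_(m.+1 <= l < m.+1.*2) F l =
  \sum_(m <= l < m.*2) F l - F m + F m.*2 + F m.*2.+1.
Proof.
move=> m0; rewrite doubleS !big_nat_recr/=; [|lia|lia].
by rewrite [in RHS]big_ltn; [rewrite (addrC (F m)) addrK|lia].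
Qed.

Lemma eq_big_leaves_split (V : zmodType) (F G : nat -> V) m : (0 < m)%N ->
  (forall l, l != m.*2 -> l != m.*2.+1 -> G l = F l) ->
  \sum_(m.+1 <= l < m.+1.*2) G l =
  \sum_(m <= l < m.*2) F l - F m + G m.*2 + G m.*2.+1.
Proof.
move=> m0 GF; rewrite big_leaves_split//.
suff -> : \sum_(m <= l < m.*2) G l - G m = \sum_(m <= l < m.*2) F l - F m by [].
congr (_ - _); last by apply: GF; lia.
by apply: eq_big_nat => l /andP[ml lm]; apply: GF; lia.
Qed.

Section HaarTransform.
Context {R : realType} (w : nat -> R) (M : nat).
Hypothesis M0 : (0 < M)%N.
Hypothesis w_ge0 : forall n, 0 <= w n.
Hypothesis w_split : forall n, (0 < n)%N -> w n = w n.*2 + w n.*2.+1.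
Implicit Types a b : nat -> R[i].

(* Nodes of the infinite binary tree are numbered as in a heap: the children of
   n are 2n and 2n+1.  Splitting M, M+1, ..., M+k-1 in this order turns the
   leaves [M, 2M) into [M+k, 2(M+k)); haar_val b k is the value on each leaf of
   the partial sum of length M+k of the Haar series with coefficients b. *)
Fixpoint haar_val b (k : nat) : nat -> R[i] :=
  if k is k'.+1 then
    let m := (M + k')%N in
    fun l => if l == m.*2 then haar_val b k' m + (w m.*2.+1)%:C * b m
      else if l == m.*2.+1 then haar_val b k' m + (- w m.*2)%:C * b m
      else haar_val b k' l
  else fun l => b (l - M)%N.

(** At the start the leaf values are the coefficients themselves, so [bellman_le0] applies leaf by
    leaf. A split changes one leaf only, by displacements w(2m+1) and -w(2m) with weights w(2m) and
    w(2m+1), which have weighted mean zero. *)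
Lemma haar_bellman (q A beta : R) a b k : 1 / 2 < q -> 0 < beta <= 1 ->
    2 * Num.max 1 (2 * q - 1) <=
      A * Num.min 1 (2 * q - 1) * Num.min 1 (beta `^ (q - 1)) ->
    2 `^ q <= A -> (forall n, sqmod (a n) <= sqmod (b n)) ->
  \sum_(M + k <= l < (M + k).*2)
    w l * bellman q A beta 0 (haar_val b k l) (haar_val a k l) <= 0.
Proof.
move=> q2 beta01 hA hA2 ab.
have q0 : 0 < q by apply: lt_trans q2; rewrite divr_gt0.
elim: k => [|k IH].
  rewrite big_nat; apply: sumr_le0 => l _.
  by apply: mulr_ge0_le0 => //=; apply: (bellman_le0 q0 beta01 hA2); exact: ab.
rewrite addnS; set m := (M + k)%N in IH *.
rewrite (@eq_big_leaves_split _ (fun l =>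
    w l * bellman q A beta 0 (haar_val b k l) (haar_val a k l)));
  [|rewrite /m; lia|]; last first.
  by move=> l /negbTE l1 /negbTE l2; rewrite /= -/m l1 l2.
rewrite /= -/m !eqxx (_ : (m.*2.+1 == m.*2) = false); last by lia.
have m0 : (0 < m)%N by rewrite /m; lia.
have /= := bellman_split q2 beta01 hA (haar_val b k m) (haar_val a k m)
  (w_ge0 m.*2) (w_ge0 m.*2.+1) (t1 := w m.*2.+1) (t2 := - w m.*2) (_ : _ = 0) (ab m).
rewrite mulrN mulrC subrr -w_split// => /(_ erefl).
set S := \sum_(_ <= _ < _) _ in IH *.
set F := w m * _; set G1 := w m.*2 * _; set G2 := w m.*2.+1 * _.
move=> GF; apply: le_trans IH; clearbody S F G1 G2; lra.
Qed.

Lemma haar_transform_bound (p A beta : R) a b k : 1 < p -> 0 < beta <= 1 ->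
    2 * Num.max 1 (2 * (p / 2) - 1) <=
      A * Num.min 1 (2 * (p / 2) - 1) * Num.min 1 (beta `^ (p / 2 - 1)) ->
    2 `^ (p / 2) <= A -> A * (2 * beta) `^ (p / 2) <= 1 / 2 ->
    (forall n, rnorm (a n) <= rnorm (b n)) ->
  \sum_(M + k <= l < (M + k).*2) w l * rnorm (haar_val a k l) `^ p <=
  2 * A * 2 `^ (p / 2) *
  \sum_(M + k <= l < (M + k).*2) w l * rnorm (haar_val b k l) `^ p.
Proof.
move=> p1 beta01 hA hA2 hAb ab.
have q2 : 1 / 2 < p / 2 by rewrite ltr_pM2r// invr_gt0.
have q0 : 0 < p / 2 by apply: lt_trans q2; rewrite divr_gt0.
have ab' n : sqmod (a n) <= sqmod (b n).
  by rewrite -!rnorm_sqr ler_pXn2r ?nnegrE ?rnorm_ge0.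
have := haar_bellman k q2 beta01 hA hA2 ab'.
set U := \sum_(_ <= _ < _) _; set V := \sum_(_ <= _ < _) _.
set W := \sum_(_ <= _ < _) _ => U0.
suff : 1 / 2 * V - A * 2 `^ (p / 2) * W <= U by clearbody U V W; lra.
rewrite /U /V /W !big_distrr/= -sumrB; apply: ler_sum => l _.
have := ler_wpM2l (w_ge0 l)
  (bellman_ge q0 beta01 hA2 hAb (haar_val b k l) (haar_val a k l)).
rewrite !powR_sqmod; apply: le_trans.
by rewrite le_eqVlt; apply/orP; left; apply/eqP; ring.
Qed.

End HaarTransform.

(** The constant is produced before [w] and [M], hence depends on p only. *)
Lemma haar_transform {R : realType} (p : R) : 1 < p -> exists2 C : R, 0 < C &
  forall (w : nat -> R) (M : nat), (0 < M)%N -> (forall n, 0 <= w n) ->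
    (forall n, (0 < n)%N -> w n = w n.*2 + w n.*2.+1) ->
  forall a b k, (forall n, rnorm (a n) <= rnorm (b n)) ->
  \sum_(M + k <= l < (M + k).*2) w l * rnorm (haar_val w M a k l) `^ p <=
  C * \sum_(M + k <= l < (M + k).*2) w l * rnorm (haar_val w M b k l) `^ p.
Proof.
move=> p1; have q2 : 1 / 2 < p / 2 by rewrite ltr_pM2r// invr_gt0.
have [A [beta [beta01 hA hA2 hAb]]] := bellman_constants q2.
have A0 : 0 < A by apply: lt_le_trans hA2; rewrite powR_gt0.
exists (2 * A * 2 `^ (p / 2)); first by rewrite !mulr_gt0// powR_gt0.
move=> w M M0 w0 ws a b k ab; exact: (haar_transform_bound M0 w0 ws k p1 beta01).
Qed.

(** * Haar systems in a normed space whose leaves span weighted l^p spaces *)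

Section HaarSystem.
Context {R : realType} {X : normedModType R[i]}.
Variables (chi : nat -> X) (w : nat -> R) (M : nat) (p : R).
Hypothesis M0 : (0 < M)%N.
Hypothesis p0 : 0 < p.
Hypothesis w_ge0 : forall n, 0 <= w n.
Hypothesis w_split : forall n, (0 < n)%N -> w n = w n.*2 + w n.*2.+1.
Hypothesis chi_split : forall n, (0 < n)%N -> chi n = chi n.*2 + chi n.*2.+1.
Hypothesis norm_leaves : forall (z : nat -> R[i]) m, (0 < m)%N ->
  rnorm (\sum_(m <= l < m.*2) z l *: chi l) `^ p =
  \sum_(m <= l < m.*2) w l * rnorm (z l) `^ p.

(** Unnormalised Haar functions: the two weights make the mean vanish without any division, so null
    nodes need no separate case. If one child of n is null, then [haar n] is zero. *)
Definition haar (n : nat) : X :=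
  if (n < M)%N then chi (M + n)
  else (w n.*2.+1)%:C *: chi n.*2 - (w n.*2)%:C *: chi n.*2.+1.

Lemma haar_sumE (b : nat -> R[i]) k : \sum_(n < M + k) b n *: haar n =
  \sum_(M + k <= l < (M + k).*2) haar_val w M b k l *: chi l.
Proof.
elim: k => [|k IH].
  rewrite addn0 -(big_mkord xpredT (fun n => b n *: haar n)).
  rewrite [RHS](_ : _ = \sum_(0 + M <= l < M.*2) b (l - M)%N *: chi l) //.
  rewrite big_addn -addnn addnK; apply: eq_big_nat => l /= lM.
  by rewrite addnK /haar lM addnC.
rewrite addnS big_ord_recr/= IH; set m := (M + k)%N.
have m0 : (0 < m)%N by rewrite /m; lia.
rewrite (@eq_big_leaves_split _ (fun l => haar_val w M b k l *: chi l))//;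
  last first.
  by move=> l /negbTE l1 /negbTE l2; rewrite /= -/m l1 l2.
rewrite -/m !eqxx (_ : (m.*2.+1 == m.*2) = false); last by lia.
rewrite /haar (_ : (m < M)%N = false); last by rewrite /m; lia.
set S := \sum_(_ <= _ < _) _; set x := haar_val w M b k m.
rewrite (chi_split m0) scalerBr scalerDr !scalerDl rmorphN mulNr scaleNr !scalerA.
rewrite (mulrC (b m) (w m.*2)%:C) (mulrC (b m) (w m.*2.+1)%:C).
by rewrite -[RHS]addrA [X in _ = _ + X]addrACA [RHS]addrA subrK.
Qed.

Let chi_norm m : (0 < m)%N -> rnorm (chi m) `^ p = w m.
Proof.
move=> m0; have := norm_leaves (fun l => (l == m)%:R) m0.
rewrite big_ltn; last lia.
rewrite big_nat big1 => [|l /andP[ml _]]; last first.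
  by rewrite (_ : (l == m) = false) ?scale0r//; lia.
rewrite eqxx scale1r addr0 => ->.
rewrite big_ltn; last lia.
rewrite big_nat big1 => [|l /andP[ml _]]; last first.
  rewrite (_ : (l == m) = false); last by lia.
  by rewrite rnorm_def/= expr0n/= addr0 sqrtr0 powR0 ?mulr0// gt_eqF.
by rewrite eqxx addr0 rnorm_def/= expr1n expr0n/= addr0 sqrtr1 powR1 mulr1.
Qed.

Lemma chi_eq0 m : (0 < m)%N -> w m = 0 -> chi m = 0.
Proof.
move=> m0 wm; have := chi_norm m0; rewrite wm => /powR_eq0_eq0 cm.
by apply/normr0_eq0; rewrite -rnormE cm.
Qed.

Lemma haar_unconditional (C : R) : 0 < C ->
    (forall (a b : nat -> R[i]) k, (forall n, rnorm (a n) <= rnorm (b n)) ->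
      \sum_(M + k <= l < (M + k).*2) w l * rnorm (haar_val w M a k l) `^ p <=
      C * \sum_(M + k <= l < (M + k).*2) w l * rnorm (haar_val w M b k l) `^ p) ->
  forall (a b : nat -> R[i]) m,
    (forall n, (n < m)%N -> rnorm (a n) <= rnorm (b n)) ->
  rnorm (\sum_(n < m) a n *: haar n) <=
  C `^ p^-1 * rnorm (\sum_(n < m) b n *: haar n).
Proof.
move=> C0 hC a b m ab.
(* [haar_sumE] computes only sums of length M + k, so the coefficients are padded with zeros. *)
pose cut (c : nat -> R[i]) n : R[i] := if (n < m)%N then c n else 0.
have cutE (c : nat -> R[i]) : \sum_(n < m) c n *: haar n = \sum_(n < M + m) cut c n *: haar n.
  rewrite (big_ord_widen (M + m) (fun n => c n *: haar n)); last by lia.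
  rewrite big_mkcond; apply: eq_bigr => n _; rewrite /cut.
  by case: ifP => //; rewrite scale0r.
rewrite !cutE !haar_sumE.
have Mm : (0 < M + m)%N by lia.
set f := \sum_(_ <= _ < _) _; set g := \sum_(_ <= _ < _) _.
have fg : rnorm f `^ p <= C * rnorm g `^ p.
  rewrite !norm_leaves//; apply: hC => n; rewrite /cut.
  by case: ifP => // /ab.
have rootK (x : R) : 0 <= x -> (x `^ p) `^ p^-1 = x.
  by move=> x0; rewrite -powRrM mulfV ?gt_eqF// powRr1.
have pV : 0 <= p^-1 by rewrite invr_ge0 ltW.
have C0' := ltW C0.
rewrite -(rootK (rnorm f)) ?rnorm_ge0// -[in leRHS](rootK (rnorm g)) ?rnorm_ge0//.
rewrite -powRM ?powR_ge0//.
by apply: ge0_ler_powR; rewrite ?nnegrE ?mulr_ge0 ?powR_ge0.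
Qed.

Definition haar_span : set X :=
  [set x | exists m (a : nat -> R[i]), x = \sum_(n < m) a n *: haar n].

Lemma haar_span_lin (c : R[i]) x y :
  haar_span x -> haar_span y -> haar_span (c *: x + y).
Proof.
move=> [m [a ->]] [n [b ->]].
pose cut m (c : nat -> R[i]) n : R[i] := if (n < m)%N then c n else 0.
have cutE k l (e : nat -> R[i]) : (k <= l)%N ->
    \sum_(n < k) e n *: haar n = \sum_(n < l) cut k e n *: haar n.
  move=> kl; rewrite (big_ord_widen l (fun n => e n *: haar n))//.
  rewrite big_mkcond; apply: eq_bigr => i _; rewrite /cut.
  by case: ifP => //; rewrite scale0r.
exists (m + n)%N, (fun i => c * cut m a i + cut n b i).
rewrite (cutE m (m + n)%N) ?leq_addr// (cutE n (m + n)%N) ?leq_addl//.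
rewrite scaler_sumr -big_split/=; apply: eq_bigr => i _.
by rewrite scalerDl scalerA.
Qed.

Lemma haar_span0 : haar_span 0.
Proof. by exists 0, (fun=> 0); rewrite big_ord0. Qed.

Lemma haar_span_haar n : haar_span (haar n).
Proof.
exists n.+1, (fun i => (i == n)%:R); rewrite big_ord_recr/= eqxx scale1r.
by rewrite big1 ?add0r// => i _; rewrite ltn_eqF// scale0r.
Qed.

(** The indicators of the children of n are recovered from that of n and from [haar n] after
    division by w n. If w n = 0, the children are null and their indicators vanish. *)
Lemma haar_span_chi m : (M <= m)%N -> haar_span (chi m).
Proof.
elim/ltn_ind: m => m IH Mm.
have [mM|mM] := ltnP m M.*2.
  have -> : chi m = haar (m - M).
    by rewrite /haar (_ : (m - M < M)%N); [congr chi; lia|lia].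
  exact: haar_span_haar.
have [n [n0 Mn nm m_cases]] : exists n,
    [/\ (0 < n)%N, (M <= n)%N, (n < m)%N & m = n.*2 \/ m = n.*2.+1].
  by exists m./2; split; lia.
have Sn : haar_span (chi n) by exact: IH.
have haarn : haar n = (w n.*2.+1)%:C *: chi n.*2 - (w n.*2)%:C *: chi n.*2.+1.
  by rewrite /haar ltnNge Mn.
have [wn|wn] := eqVneq (w n) 0.
  suff -> : chi m = 0 by exact: haar_span0.
  apply: chi_eq0; first by lia.
  have := w_split n0; rewrite wn; have := w_ge0 n.*2; have := w_ge0 n.*2.+1.
  by case: m_cases => ->; lra.
have wnC : (w n)%:C != 0 :> R[i] by rewrite eq_complex/= negb_and wn.
have h1 : (w n)%:C *: chi n.*2 = (w n.*2)%:C *: chi n + haar n.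
  rewrite haarn (chi_split n0) (w_split n0) scalerDr rmorphD scalerDl.
  by rewrite addrACA subrr addr0.
have h2 : (w n)%:C *: chi n.*2.+1 = (w n.*2.+1)%:C *: chi n - haar n.
  rewrite haarn (chi_split n0) (w_split n0) scalerDr rmorphD scalerDl opprB.
  by rewrite [X in _ = _ + X]addrC addrACA subrr add0r addrC.
have hs (c : R[i]) x : haar_span x -> haar_span (c *: x).
  by move=> /(haar_span_lin c) /(_ haar_span0); rewrite addr0.
case: m_cases => mE; rewrite mE.
  rewrite -[chi _](scalerK wnC) h1; apply: hs; apply: haar_span_lin => //.
  exact: haar_span_haar.
rewrite -[chi _](scalerK wnC) h2; apply: (hs); apply: haar_span_lin => //.
by rewrite -scaleN1r; apply: (hs); exact: haar_span_haar.
Qed.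

End HaarSystem.

(** * Bases in normed spaces over the complex numbers *)

Section RealNormConvergence.
Context {R : realType}.

Lemma cvg_rnormP {X : normedModType R[i]} (u : nat -> X) (l : X) :
  (u @ \oo --> l) <->
  (forall e : R, 0 < e -> exists N, forall n, (N <= n)%N -> rnorm (l - u n) < e).
Proof.
split.
- move=> /cvgrPdist_lt ul e e0.
  have [|N _ hN] := ul e%:C; first by rewrite ltcR.
  by exists N => n Nn; have := hN n Nn; rewrite /= -rnormE ltcR.
- move=> ul; apply/cvgrPdist_lt => e e0.
  have eR : e = (complex.Re e)%:C by rewrite RRe_real// gtr0_real.
  rewrite eR ltcR in e0.
  have [N hN] := ul _ e0.
  by exists N => // n Nn /=; rewrite -rnormE eR ltcR; exact: hN.
Qed.

Lemma rnorm0 {X : normedZmodType R[i]} : rnorm (0 : X) = 0.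
Proof. by rewrite /rnorm normr0. Qed.

Lemma rnormN {X : normedZmodType R[i]} (x : X) : rnorm (- x) = rnorm x.
Proof. by rewrite /rnorm normrN. Qed.

Lemma rnormZ {X : normedModType R[i]} (c : R[i]) (x : X) :
  rnorm (c *: x) = rnorm c * rnorm x.
Proof.
have inj : injective (fun x : R => x%:C) by move=> ? ? [].
by apply: inj; rewrite rmorphM /= !rnormE normrZ.
Qed.

Lemma rnorm_eq0 {X : normedZmodType R[i]} (x : X) : rnorm x = 0 -> x = 0.
Proof. by move=> x0; apply/normr0_eq0; rewrite -rnormE x0. Qed.

Lemma rnormB {X : normedZmodType R[i]} (x y : X) : rnorm (x - y) = rnorm (y - x).
Proof. by rewrite -rnormN opprB. Qed.

Lemma ler_rnorm_sum {X : normedZmodType R[i]} (I : Type) (r : seq I) (P : pred I)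
  (F : I -> X) : rnorm (\sum_(i <- r | P i) F i) <= \sum_(i <- r | P i) rnorm (F i).
Proof.
elim/big_rec2: _ => [|i y x _ h]; first by rewrite rnorm0.
by apply: le_trans (ler_rnormD _ _) _; rewrite lerD2l.
Qed.

Lemma rnorm_real (x : R) : rnorm (x%:C) = `|x|.
Proof. by rewrite rnorm_def/= expr0n addr0 sqrtr_sqr. Qed.

Lemma normr_Re_le (z : R[i]) : `|complex.Re z| <= rnorm z.
Proof.
rewrite rnorm_def -sqrtr_sqr ler_wsqrtr// lerDl; exact: sqr_ge0.
Qed.

Lemma normr_Im_le (z : R[i]) : `|complex.Im z| <= rnorm z.
Proof.
rewrite rnorm_def -sqrtr_sqr ler_wsqrtr// lerDr; exact: sqr_ge0.
Qed.

Lemma rnorm_le_ReIm (z : R[i]) : rnorm z <= `|complex.Re z| + `|complex.Im z|.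
Proof.
rewrite {1}(complexE z); apply: le_trans (ler_rnormD _ _) _.
rewrite rnormM !rnorm_real lerD2l [rnorm _]rnorm_def/=.
by rewrite expr0n expr1n add0r sqrtr1 mul1r.
Qed.

Lemma complex_cauchy_cvg (z : nat -> R[i]) :
  (forall e : R, 0 < e -> exists N, forall j k, (N <= j)%N -> (N <= k)%N ->
    rnorm (z j - z k) < e) ->
  exists l : R[i], forall e : R, 0 < e ->
    exists N, forall k, (N <= k)%N -> rnorm (l - z k) < e.
Proof.
move=> cz.
have real_lim (f : R[i] -> R) : (forall z, `|f z| <= rnorm z) ->
    (forall z w, f (z - w) = f z - f w) ->
    exists l : R, forall e : R, 0 < e ->
      exists N, forall k, (N <= k)%N -> `|l - f (z k)| < e.
  move=> fz fB; have /cvg_ex[l fl] : cvgn (fun k => f (z k)).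
    apply/cauchy_cvgP/cauchy_exP => e e0.
    have [N hN] := cz e e0.
    exists (f (z N)), N => // k Nk.
    by rewrite /= /ball/= -fB; apply: le_lt_trans (fz _) _; exact: hN.
  exists l => e e0; have /cvgrPdist_lt /(_ e e0) [N _ hN] := fl.
  by exists N => k Nk; exact: hN.
have [a ha] := real_lim _ normr_Re_le (fun z w => raddfB (@complex.Re R) z w).
have [b hb] := real_lim _ normr_Im_le (fun z w => raddfB (@complex.Im R) z w).
exists (a +i* b) => e e0.
have e20 : 0 < e / 2 by rewrite divr_gt0.
have [N1 h1] := ha _ e20; have [N2 h2] := hb _ e20.
exists (maxn N1 N2) => k; rewrite geq_max => /andP[k1 k2].
apply: le_lt_trans (rnorm_le_ReIm _) _.
have -> : e = e / 2 + e / 2 by field.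
rewrite !raddfB/=; apply: ltrD; [exact: h1|exact: h2].
Qed.

End RealNormConvergence.

Section Coefficients.
Context {R : realType} {X : normedModType R[i]}.
Variables (v : nat -> X) (C : R).
Implicit Types a b : nat -> R[i].

Definition psum a m : X := \sum_(n < m) a n *: v n.

Hypothesis C0 : 0 < C.
Hypothesis uncond : forall a b m,
  (forall n, (n < m)%N -> rnorm (a n) <= rnorm (b n)) ->
  rnorm (psum a m) <= C * rnorm (psum b m).
Hypothesis dense : forall x (e : R), 0 < e ->
  exists m a, rnorm (x - psum a m) < e.

Lemma psumB a b m : psum (fun n => a n - b n) m = psum a m - psum b m.
Proof.
by rewrite /psum -sumrB; apply: eq_bigr => n _; rewrite scalerBl.
Qed.

Lemma psum_lin (c : R[i]) a b m :
  psum (fun n => c * a n + b n) m = c *: psum a m + psum b m.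
Proof.
rewrite /psum scaler_sumr -big_split/=; apply: eq_bigr => n _.
by rewrite scalerDl scalerA.
Qed.

Lemma psum_cut a m k : (m <= k)%N ->
  psum (fun n => if (n < m)%N then a n else 0) k = psum a m.
Proof.
move=> mk; rewrite /psum (big_ord_widen k (fun n => a n *: v n))//.
rewrite [RHS]big_mkcond; apply: eq_bigr => i _.
by case: ifP => //; rewrite scale0r.
Qed.

Lemma psum_single a n m : (n < m)%N ->
  psum (fun i => if i == n then a i else 0) m = a n *: v n.
Proof.
move=> nm; rewrite /psum (bigD1 (Ordinal nm))//= eqxx big1 ?addr0// => i.
rewrite -val_eqE/= => /negbTE ->; exact: scale0r.
Qed.

Lemma psum_le_psum a m k : (m <= k)%N -> rnorm (psum a m) <= C * rnorm (psum a k).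
Proof.
move=> mk; rewrite -(psum_cut _ mk); apply: uncond => n _.
by case: ifP => // _; rewrite rnorm0 rnorm_ge0.
Qed.

Lemma coef_le_psum a n m : (n < m)%N ->
  rnorm (a n) * rnorm (v n) <= C * rnorm (psum a m).
Proof.
move=> nm; rewrite -rnormZ -(psum_single _ nm); apply: uncond => i _.
by case: ifP => // _; rewrite rnorm0 rnorm_ge0.
Qed.

(** A coefficient of a zero vector would be arbitrary; fixing it to 0 makes the expansion unique and
    its coefficients linear in x. *)
Definition expansion (x : X) a :=
  (forall n, v n = 0 -> a n = 0) /\ psum a @ \oo --> x.

Lemma dense_normalized (x : X) (e : R) : 0 < e ->
  exists m a, [/\ forall n, v n = 0 -> a n = 0,
    forall k, (m <= k)%N -> psum a k = psum a m & rnorm (x - psum a m) < e].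
Proof.
move=> e0; have [m [a xa]] := dense x e0.
exists m, (fun n => if (n < m)%N && (v n != 0) then a n else 0).
have E k : (m <= k)%N ->
    psum (fun n => if (n < m)%N && (v n != 0) then a n else 0) k = psum a m.
  move=> mk; rewrite -(psum_cut a mk); apply: eq_bigr => i _.
  case: (ltnP i m) => //= _; case: eqVneq => [->|//].
  by rewrite !scaler0.
split.
- by move=> n ->; rewrite eqxx andbF.
- by move=> k mk; rewrite !E.
- by rewrite E.
Qed.

(** Take finite combinations [b k] that tend to x. By unconditionality the partial sums of b j - b k
    are small uniformly in their length, so each coefficient is Cauchy, and the uniformity carries
    over to the limit coefficients. Completeness of X is not assumed, since the limit x is given. *)
Lemma expansion_exists (x : X) : exists a, expansion x a.
Proof.
have /choice[f hf] : forall k : nat, exists ma : nat * (nat -> R[i]),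
    [/\ forall n, v n = 0 -> ma.2 n = 0,
    forall j, (ma.1 <= j)%N -> psum ma.2 j = psum ma.2 ma.1 &
    rnorm (x - psum ma.2 ma.1) < k.+1%:R^-1].
  move=> k; have [|m [a ha]] := @dense_normalized x k.+1%:R^-1.
    by rewrite invr_gt0.
  by exists (m, a).
pose m k := (f k).1; pose b k := (f k).2.
have b0 k n : v n = 0 -> b k n = 0 by have [+ _ _] := hf k; apply.
have bx k j : (m k <= j)%N -> rnorm (x - psum (b k) j) < k.+1%:R^-1.
  by have [_ + ?] := hf k => /(_ j) E mj; rewrite /b E.
have diff j k i : rnorm (psum (fun n => b j n - b k n) i) <=
    C * (j.+1%:R^-1 + k.+1%:R^-1).
  pose l := maxn i (maxn (m j) (m k)).
  have il : (i <= l)%N by rewrite /l; lia.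
  apply: (le_trans (psum_le_psum _ il)); rewrite ler_wpM2l ?(ltW C0)//.
  rewrite psumB -(subrKA x); apply: (le_trans (ler_rnormD _ _)).
  apply: lerD; apply/ltW; first by rewrite rnormB; apply: bx; rewrite /l; lia.
  by apply: bx; rewrite /l; lia.
have eps_small (e : R) : 0 < e -> exists N, forall k, (N <= k)%N -> k.+1%:R^-1 < e.
  move=> e0; exists (Num.truncn e^-1) => k Nk.
  rewrite invf_plt ?posrE//.
  by apply: lt_le_trans (truncnS_gt _) _; rewrite ler_nat.
have /choice[a ha] : forall n, exists l : R[i], (v n = 0 -> l = 0) /\
    forall e : R, 0 < e -> exists N, forall k, (N <= k)%N -> rnorm (l - b k n) < e.
  move=> n; have [vn|vn] := eqVneq (v n) 0.
    exists 0; split=> // e e0; exists 0 => k _.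
    by rewrite b0// subr0 rnorm0.
  have vn0 : 0 < rnorm (v n).
    rewrite lt_neqAle rnorm_ge0 andbT eq_sym; apply/negP => /eqP /rnorm_eq0.
    exact/eqP.
  have [e e0|l hl] := @complex_cauchy_cvg _ (fun k => b k n); last first.
    by exists l; split => // vn'; rewrite vn' eqxx in vn.
  (* One factor C is lost in [coef_le_psum] and one in [diff]; the 2 shares the error between j and
     k. *)
  have [|N hN] := eps_small (e * rnorm (v n) / C / C / 2).
    by rewrite !divr_gt0// mulr_gt0.
  exists N => j k Nj Nk.
  rewrite -(ltr_pM2r vn0).
  apply: (le_lt_trans (@coef_le_psum (fun i => b j i - b k i) n n.+1 (ltnSn n))).
  apply: (@le_lt_trans _ _ (C * (C * (j.+1%:R^-1 + k.+1%:R^-1)))).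
    by rewrite ler_wpM2l// ltW.
  have := hN _ Nj; have := hN _ Nk.
  set y := e * _; rewrite !ltr_pdivlMr// => h1 h2.
  move: (j.+1%:R^-1) (k.+1%:R^-1) h1 h2 => A B h1 h2.
  rewrite [ltLHS](_ : _ = (B * 2 * C * C + A * 2 * C * C) / 2); last by field.
  by rewrite ltr_pdivrMr//; lra.
exists a; split; first by move=> n; have [+ _] := ha n; apply.
apply/cvg_rnormP => e e0.
have C3 : 0 < 1 + 3 * C by rewrite addr_gt0// mulr_gt0.
have [|k hk] := eps_small (e / (1 + 3 * C)); first by rewrite divr_gt0.
have := hk k (leqnn k); set d : R := k.+1%:R^-1 => dk.
have d0 : 0 < d by rewrite invr_gt0.
exists (m k) => i mi.
have ab : rnorm (psum (fun n => a n - b k n) i) <= 3 * C * d.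
  (* Here j may depend on the length i: only i coefficients have to be close to their limits, and
     the resulting bound does not involve i. *)
  have [j kj hj] : exists2 j, (k <= j)%N & rnorm (psum (fun n => a n - b j n) i) <= C * d.
    pose V := \sum_(n < i) rnorm (v n).
    have V0 : 0 <= V by apply: sumr_ge0 => n _; exact: rnorm_ge0.
    have V1 : 0 < V + 1 by lra.
    have CdV : 0 < C * d / (V + 1) by rewrite divr_gt0// mulr_gt0.
    have /choice[N hN] : forall n, exists N, forall j, (N <= j)%N ->
        rnorm (a n - b j n) < C * d / (V + 1).
      by move=> n; have [_ h] := ha n; exact: h.
    pose J := maxn k (\max_(n < i) N n).
    exists J; first exact: leq_maxl.
    apply: (le_trans (ler_rnorm_sum _ _ _)).
    apply: (@le_trans _ _ (\sum_(n < i) C * d / (V + 1) * rnorm (v n))).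
      apply: ler_sum => n _; rewrite rnormZ ler_wpM2r ?rnorm_ge0//.
      apply/ltW/hN; rewrite /J leq_max; apply/orP; right.
      exact: (leq_bigmax_cond (F := fun n : 'I_i => N n)).
    rewrite -mulr_sumr -/V -mulrA ler_piMr ?mulr_ge0 ?(ltW C0) ?(ltW d0)//.
    by rewrite mulrC ler_pdivrMr// mul1r lerDl.
  have jd : j.+1%:R^-1 <= d by rewrite /d lef_pV2 ?posrE// ler_nat ltnS.
  have -> : psum (fun n => a n - b k n) i =
      psum (fun n => a n - b j n) i + psum (fun n => b j n - b k n) i.
    by rewrite !psumB addrA subrK.
  apply: (le_trans (ler_rnormD _ _)).
  rewrite (_ : 3 * C * d = C * d + C * (d + d)); last by ring.
  apply: lerD => //; apply: (le_trans (diff j k i)).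
  by rewrite ler_wpM2l ?(ltW C0)// lerD2r.
have -> : x - psum a i = (x - psum (b k) i) - (psum (fun n => a n - b k n) i).
  by rewrite psumB opprB addrA subrK.
apply: (le_lt_trans (ler_rnormD _ _)); rewrite rnormN.
rewrite ltr_pdivlMr// in dk; apply: le_lt_trans dk.
rewrite (_ : d * (1 + 3 * C) = d + 3 * C * d); last by ring.
by apply: lerD => //; apply/ltW/bx.
Qed.

Lemma expansion_lin (c : R[i]) x y a b :
  expansion x a -> expansion y b -> expansion (c *: x + y) (fun n => c * a n + b n).
Proof.
move=> [a0 ax] [b0 bx]; split.
  by move=> n vn; rewrite a0// b0// mulr0 addr0.
rewrite (_ : psum _ = fun m => c *: psum a m + psum b m); last first.
  by apply/funext => m; exact: psum_lin.
by apply: cvgD => //; apply: cvgZl_tmp.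
Qed.

(** An arbitrary set of coordinates is allowed because both the block projections and the single
    coefficients are needed. *)
Lemma expansion_bound x a (P : pred nat) m : expansion x a ->
  rnorm (\sum_(n < m | P n) a n *: v n) <= C * rnorm x.
Proof.
move=> [_ /cvg_rnormP ax]; apply/ler_addgt0Pr => e e0.
have [|N hN] := ax (e / C); first by rewrite divr_gt0.
have Nm : (N <= maxn N m)%N by exact: leq_maxl.
rewrite (_ : \sum_(n < m | P n) a n *: v n =
    psum (fun n => if (n < m)%N then if P n then a n else 0 else 0) (maxn N m));
  last first.
  rewrite psum_cut ?leq_maxr// big_mkcond; apply: eq_bigr => n _.
  by case: ifP => //; rewrite scale0r.
apply: (@le_trans _ _ (C * rnorm (psum a (maxn N m)))).
  by apply: uncond => n _; case: ifP => // _; [case: ifP => // _|];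
    rewrite rnorm0 rnorm_ge0.
have -> : C * rnorm x + e = C * (rnorm x + e / C) by field; rewrite gt_eqF.
rewrite ler_wpM2l ?(ltW C0)//.
rewrite -[psum a _](subrK x); apply: (le_trans (ler_rnormD _ _)).
by rewrite addrC lerD2l rnormB; exact/ltW/hN.
Qed.

Lemma expansion_uniq x a b : expansion x a -> expansion x b -> a = b.
Proof.
move=> xa xb; have := expansion_lin (- 1) xa xb.
rewrite scaleN1r addNr => ab0; apply/funext => n.
have [vn|vn] := eqVneq (v n) 0.
  by have [-> //] := xa; have [-> //] := xb.
have := @expansion_bound _ _ (pred1 n) n.+1 ab0.
rewrite rnorm0 mulr0 big_mkcond big_ord_recr/= eqxx big1 ?add0r => [h|i _]; last first.
  by rewrite ltn_eqF.
have /rnorm_eq0/eqP : rnorm ((- 1 * a n + b n) *: v n) = 0.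
  by apply/eqP; rewrite eq_le h rnorm_ge0.
rewrite scaler_eq0 (negbTE vn) orbF mulN1r addrC subr_eq0 => /eqP ->.
by [].
Qed.

Lemma coef_exists : exists coef : X -> nat -> R[i], [/\
  forall x, psum (coef x) @ \oo --> x,
  forall x n, v n = 0 -> coef x n = 0,
  forall n (c : R[i]) x y, coef (c *: x + y) n = c * coef x n + coef y n,
  forall x (P : pred nat) m,
    rnorm (\sum_(n < m | P n) coef x n *: v n) <= C * rnorm x &
  forall i n, v i != 0 -> coef (v i) n = (n == i)%:R] /\
  forall x a, expansion x a -> a = coef x.
Proof.
have /choice[coef hcoef] := expansion_exists.
exists coef; split; last by move=> x a xa; exact: expansion_uniq xa (hcoef x).
split.
- by move=> x; have [] := hcoef x.
- by move=> x n; have [+ _] := hcoef x; apply.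
- move=> n c x y.
  have /(expansion_uniq (hcoef (c *: x + y))) -> // :=
    expansion_lin c (hcoef x) (hcoef y).
- by move=> x P m; exact: expansion_bound.
- move=> i n vi.
  have /(expansion_uniq (hcoef (v i))) -> // :
      expansion (v i) (fun n => (n == i)%:R).
  split; first by move=> k; case: eqVneq => // ->; move/eqP: vi.
  apply/cvg_rnormP => e e0; exists i.+1 => k ik.
  have := @psum_single (fun=> 1) i k ik; rewrite scale1r => E.
  rewrite [psum _ _](_ : _ = v i) ?subrr ?rnorm0//.
  by rewrite -[RHS]E; apply: eq_bigr => j _; congr (_ *: _); case: eqP.
Qed.

End Coefficients.

(** * Passing to the subsequence of the nonzero vectors *)

Section NonzeroSubsequence.
Context {R : realType} {X : normedModType R[i]}.
Variables (v : nat -> X) (C : R) (coef : X -> nat -> R[i]).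
Hypothesis C0 : 0 < C.
Hypothesis uncond : forall (a b : nat -> R[i]) m,
  (forall n, (n < m)%N -> rnorm (a n) <= rnorm (b n)) ->
  rnorm (psum v a m) <= C * rnorm (psum v b m).
Hypothesis coef_cvg : forall x, psum v (coef x) @ \oo --> x.
Hypothesis coef_uniq : forall x a, expansion v x a -> a = coef x.

(** For v n nonzero, [rank n] is the position of v n in the subsequence; partial sums of length m
    become partial sums of length [rank m]. *)
Definition rank m : nat := \sum_(n < m) (v n != 0%R).

Lemma rankS m : rank m.+1 = (rank m + (v m != 0%R))%N.
Proof. by rewrite /rank big_ord_recr. Qed.

Lemma rank_le m n : (m <= n)%N -> (rank m <= rank n)%N.
Proof.
move=> /subnKC <-; elim: (n - m)%N => [|k IH]; first by rewrite addn0.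
by rewrite addnS rankS; apply: leq_trans IH (leq_addr _ _).
Qed.

Lemma rank_inj m n : v m != 0 -> v n != 0 -> rank m = rank n -> m = n.
Proof.
move=> vm vn mn.
have lt_rank i j : v i != 0 -> (i < j)%N -> (rank i < rank j)%N.
  by move=> vi /rank_le; rewrite rankS vi addn1.
have [/(lt_rank _ _ vm)|/(lt_rank _ _ vn)|//] := ltngtP m n; rewrite mn ltnn//.
Qed.

Lemma rank_surj k m : (k < rank m)%N -> exists n, v n != 0 /\ rank n = k.
Proof.
elim: m => [|m IH]; first by rewrite /rank big_ord0.
rewrite rankS; have [/IH//|mk] := ltnP k (rank m).
by case vm : (v m != 0) => km; [exists m; rewrite vm; split => //; lia|lia].
Qed.

Lemma rank_onto k m : (k <= rank m)%N -> exists n, rank n = k.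
Proof.
rewrite leq_eqVlt => /predU1P[->|]; first by exists m.
by move=> /rank_surj[n [_ nk]]; exists n.
Qed.

Lemma unrank_exists : exists e : nat -> nat, forall n, v n != 0 -> e (rank n) = n.
Proof.
have /choice[e he] : forall k, exists n, forall i, v i != 0 -> rank i = k -> i = n.
  move=> k; have [[n [vn nk]]|nk] := pselect (exists n, v n != 0 /\ rank n = k).
    by exists n => i vi ik; apply: rank_inj => //; rewrite ik.
  (* A default value, for positions beyond the end of a finite subsequence. *)
  by exists 0%N => i vi ik; exfalso; apply: nk; exists i.
by exists e => n vn; apply/esym/he.
Qed.

Section Unrank.
Variable e : nat -> nat.
Hypothesis e_rank : forall n, v n != 0 -> e (rank n) = n.
Local Notation u := (fun i => v (e i)).

Definition spread (a : nat -> R[i]) n : R[i] := if v n != 0 then a (rank n) else 0.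

Lemma psum_unrank b m : psum v b m = \sum_(i < rank m) b (e i) *: u i.
Proof.
elim: m => [|m IH]; first by rewrite /psum /rank !big_ord0.
rewrite /psum big_ord_recr/= -/(psum v b m) IH rankS.
case: eqVneq => [->|vm]; first by rewrite scaler0 addr0 addn0.
by rewrite addn1 big_ord_recr/= e_rank.
Qed.

Lemma rank_unrank k m : (k < rank m)%N -> rank (e k) = k /\ v (e k) != 0.
Proof. by move=> /rank_surj[n [vn <-]]; rewrite e_rank. Qed.

Lemma psum_spread a m : psum v (spread a) m = \sum_(i < rank m) a i *: u i.
Proof.
rewrite psum_unrank; apply: eq_bigr => i _; rewrite /spread.
by have [-> ->] := rank_unrank (ltn_ord i).
Qed.

Lemma unrank_unconditional (a b : nat -> R[i]) m :
    (forall n, rnorm (a n) <= rnorm (b n)) ->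
  rnorm (\sum_(i < rank m) a i *: u i) <= C * rnorm (\sum_(i < rank m) b i *: u i).
Proof.
move=> ab; rewrite -!psum_spread; apply: uncond => n _; rewrite /spread.
by case: ifP.
Qed.

Lemma unconditional_unrank N :
    (forall m, (forall n, (n < m)%N -> in_range N n) -> exists k, rank k = m) ->
  unconditional C N u.
Proof.
move=> hN m a /hN[k <-].
have abs n : rnorm (`|a n|) = rnorm (a n) by rewrite /rnorm normr_id.
split; last first.
  by apply: (@unrank_unconditional a (fun n => `|a n|)) => n; rewrite abs.
rewrite mulrC ler_pdivrMr// mulrC.
by apply: (@unrank_unconditional (fun n => `|a n|) a) => n; rewrite abs.
Qed.

Lemma spread0 a n : v n = 0 -> spread a n = 0.
Proof. by rewrite /spread => ->; rewrite eqxx. Qed.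

Lemma unrank_basis_infinite : (forall k, exists m, (k < rank m)%N) ->
  unconditional_basis C None u.
Proof.
move=> rk; split; last first.
  by apply: unconditional_unrank => m _; have [n /ltnW/rank_onto] := rk m.
move=> x; exists (fun i => coef x (e i)); split.
  apply/cvg_rnormP => eps eps0.
  have /cvg_rnormP /(_ _ eps0) [m0 hm] := @coef_cvg x.
  exists (rank m0).+1 => k mk.
  have [m [mE]] : exists m, rank m = k.
    by have [n /ltnW/rank_onto] := rk k.
  have mm0 : (m0 <= m)%N.
    by rewrite leqNgt; apply/negP => /ltnW/rank_le; lia.
  by rewrite seriesEord/= -mE -psum_unrank; exact: hm.
move=> a /cvg_rnormP ax; have /coef_uniq <- : expansion v x (spread a).
  split; first exact: spread0.
  apply/cvg_rnormP => eps eps0; have [k0 hk] := ax _ eps0.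
  have [m0 km0] := rk k0; exists m0 => m m0m.
  have := hk (rank m); rewrite seriesEord/= psum_spread; apply.
  by apply: leq_trans (ltnW km0) (rank_le m0m).
apply/funext => i; have [m im] := rk i.
by have [ri vi] := rank_unrank im; rewrite /spread vi ri.
Qed.

Lemma unrank_basis_finite m0 : (forall m, (rank m <= rank m0)%N) ->
  unconditional_basis C (Some (rank m0)) u.
Proof.
move=> rm0; split; last first.
  apply: unconditional_unrank => -[_|m hm]; first by exists 0%N; rewrite /rank big_ord0.
  by apply: rank_onto (hm m (ltnSn m)).
have rE m : (m0 <= m)%N -> rank m = rank m0.
  by move=> mm; apply/eqP; rewrite eqn_leq rm0 rank_le.
move=> x; exists (fun i : 'I_(rank m0) => coef x (e i)); split.
  (* From [m0] on all vectors vanish, so the partial sums are constant and the limit x is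
     attained. *)
  rewrite -psum_unrank; apply/eqP; rewrite -subr_eq0; apply/eqP/rnorm_eq0/eqP.
  rewrite eq_le rnorm_ge0 andbT; apply/ler_addgt0Pr => eps eps0.
  have /cvg_rnormP /(_ _ eps0) [m1 hm] := @coef_cvg x.
  have := hm (maxn m0 m1) (leq_maxr _ _).
  rewrite !psum_unrank rE ?leq_maxl// add0r; exact: ltW.
move=> a xa; pose a' i : R[i] := if insub i is Some j then a j else 0.
have a'E (i : 'I_(rank m0)) : a' i = a i by rewrite /a' valK.
have /coef_uniq <- : expansion v x (spread a').
  split; first exact: spread0.
  apply/cvg_rnormP => eps eps0; exists m0 => m /rE mE.
  rewrite psum_spread mE (eq_bigr (fun i : 'I_(rank m0) => a i *: u i)).
    by rewrite -xa subrr rnorm0.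
  by move=> i _; rewrite a'E.
apply/funext => i; have [ri vi] := rank_unrank (ltn_ord i).
by rewrite /spread vi ri a'E.
Qed.

End Unrank.

Lemma nonzero_subsequence_basis : exists (N : option nat) (u : nat -> X),
  unconditional_basis C N u /\
  forall n, in_range N n -> exists2 i, v i != 0 & u n = v i.
Proof.
have [e e_rank] := unrank_exists.
have [rk|] := pselect (forall k, exists m, (k < rank m)%N).
  exists None, (fun i => v (e i)); split; first exact: unrank_basis_infinite.
  by move=> n _; have [m /(rank_unrank e_rank)[_ vn]] := rk n; exists (e n).
move=> /existsNP[k /forallNP rk].
(* Finitely many nonzero vectors, the finite dimensional case: the bounded set of ranks has a
   maximum, which is the length of the basis. *)
have [m0 hm0] : exists m0, forall m, (rank m <= rank m0)%N.
  have rk' m : (rank m <= k)%N by rewrite leqNgt; apply/negP/rk.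
  have ex : exists i, `[< exists m, rank m = i >].
    by exists (rank 0%N); apply/asboolP; exists 0%N.
  have ub i : `[< exists m, rank m = i >] -> (i <= k)%N.
    by move=> /asboolP[m <-].
  case: (ex_maxnP ex ub) => i /asboolP[m0 <-] hmax; exists m0 => m.
  by apply: hmax; apply/asboolP; exists m.
exists (Some (rank m0)), (fun i => v (e i)); split; first exact: unrank_basis_finite.
by move=> n /= /(rank_unrank e_rank)[_ vn]; exists (e n).
Qed.

End NonzeroSubsequence.

(** * Power means and Khintchine's inequality *)

Section PowerMeans.
Context {R : realType}.
Implicit Types (z : nat -> R) (s t : R).

Lemma powRD_gt0 (x r s : R) : 0 < x -> x `^ (r + s) = x `^ r * x `^ s.
Proof. by move=> x0; apply: powRD; rewrite (gt_eqF x0) implybT. Qed.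

Lemma powR2N_lt1 (q : R) : 0 < q -> 2 `^ (- q) < 1 :> R.
Proof.
move=> q0; rewrite powRN invf_lt1 ?powR_gt0// -[ltLHS](powRr0 2).
by rewrite /powR pnatr_eq0/= ltr_expR ltr_pM2r ?ln_gt0// ltr1n.
Qed.

(** Splitting at a threshold replaces Hoelder's inequality in [power_mean], at the price of a factor
    2. *)
Lemma powR_cut (s t x theta : R) : 0 < s -> s <= t -> 0 <= x -> 0 < theta ->
  x `^ s <= theta `^ s + theta `^ (s - t) * x `^ t.
Proof.
move=> s0 st x0 th0; have [xth|thx] := leP x theta.
  apply: (@le_trans _ _ (theta `^ s)); last by rewrite lerDl mulr_ge0 ?powR_ge0.
  by apply: ge0_ler_powR; rewrite ?nnegrE ?(ltW s0) ?(ltW th0).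
apply: (@le_trans _ _ (theta `^ (s - t) * x `^ t)); last by rewrite lerDr powR_ge0.
have xp : 0 < x by apply: lt_trans thx.
rewrite -[in leLHS](subrK t s) [leLHS]powRD_gt0//.
rewrite ler_wpM2r ?powR_ge0// -opprB !powRN lef_pV2 ?posrE ?powR_gt0//.
apply: ge0_ler_powR; rewrite ?nnegrE ?(ltW xp) ?(ltW th0) ?(ltW thx)//.
by rewrite subr_ge0.
Qed.

Lemma power_mean z N (s t d : R) : 1 <= s -> s <= t -> N%:R <= d -> 0 < d ->
    (forall n, 0 <= z n) ->
  (\sum_(n < N) z n `^ s) `^ s^-1 <=
  2 * d `^ (s^-1 - t^-1) * (\sum_(n < N) z n `^ t) `^ t^-1.
Proof.
move=> s1 st Nd d0 z0.
have s0 : 0 < s by apply: lt_le_trans s1.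
have t0 : 0 < t by apply: lt_le_trans st.
have ss : s^-1 != 0 by rewrite invr_eq0 gt_eqF.
set B := \sum_(n < N) z n `^ t.
have B0 : 0 <= B by apply: sumr_ge0 => n _; exact: powR_ge0.
have [B00|Bn0] := eqVneq B 0.
  rewrite (_ : \sum_(n < N) _ = 0); first by rewrite powR0// !mulr_ge0 ?powR_ge0.
  apply: big1 => n _.
  have /eqP := B00; rewrite /B psumr_eq0; last by move=> i _; exact: powR_ge0.
  move=> /allP /(_ n (mem_index_enum _)) /= /eqP /powR_eq0_eq0 ->.
  by rewrite powR0// gt_eqF.
have Bp : 0 < B by rewrite lt_neqAle eq_sym Bn0.
pose A := B `^ t^-1.
have A0 : 0 < A by rewrite powR_gt0.
have BE : B = A `^ t by rewrite /A -powRrM mulVf ?gt_eqF// powRr1.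
have AE : B `^ t^-1 = A by [].
(* The threshold that balances the two terms of [powR_cut]: summed over at most d indices, each is
   bounded by A^s d^(1 - s/t). *)
clearbody A; pose th := A * d `^ (- t^-1).
have th0 : 0 < th by rewrite mulr_gt0// powR_gt0.
have thE q : th `^ q = A `^ q * d `^ (- (q / t)).
  rewrite /th powRM ?powR_ge0 ?(ltW A0)// -powRrM; congr (_ * _ `^ _).
  by rewrite mulNr mulrC.
have h : \sum_(n < N) z n `^ s <= 2 * A `^ s * d `^ (1 - s / t).
  apply: (@le_trans _ _ (\sum_(n < N) (th `^ s + th `^ (s - t) * z n `^ t))).
    by apply: ler_sum => n _; exact: powR_cut.
  rewrite big_split/= sumr_const card_ord -mulr_sumr -/B BE -[_ *+ N]mulr_natl.
  rewrite [leRHS](_ : _ = A `^ s * d `^ (1 - s / t) + A `^ s * d `^ (1 - s / t));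
    last by ring.
  apply: lerD.
    apply: (@le_trans _ _ (d * th `^ s)); first by rewrite ler_wpM2r ?powR_ge0.
    rewrite thE mulrCA ler_wpM2l ?powR_ge0// powRD_gt0//.
    by rewrite powRr1// ltW.
  rewrite thE mulrAC -powRD_gt0//.
  rewrite subrK ler_wpM2l ?powR_ge0//.
  by rewrite (_ : - ((s - t) / t) = 1 - s / t)//; field; rewrite gt_eqF.
apply: (@le_trans _ _ ((2 * A `^ s * d `^ (1 - s / t)) `^ s^-1)).
  apply: ge0_ler_powR; rewrite ?nnegrE ?invr_ge0 ?(ltW s0) ?mulr_ge0 ?powR_ge0//.
  by apply: sumr_ge0 => n _; exact: powR_ge0.
rewrite powRM ?mulr_ge0 ?powR_ge0// powRM ?powR_ge0// -!powRrM.
rewrite mulfV ?gt_eqF// powRr1 ?(ltW A0)//.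
rewrite (_ : (1 - s / t) / s = s^-1 - t^-1); last by field; rewrite !gt_eqF.
rewrite AE mulrAC ler_wpM2r ?(ltW A0)// ler_wpM2r ?powR_ge0//.
rewrite -[leRHS](@powRr1 _ 2)// ler_powR ?ler1n// invf_le1//.
Qed.

(** Each z n is at most the l^2 norm A, hence z^p <= A^(p-2) z^2. *)
Lemma lp_le_l2 z N (p : R) : 2 <= p -> (forall n, 0 <= z n) ->
  (\sum_(n < N) z n `^ p) `^ p^-1 <= (\sum_(n < N) z n `^ 2) `^ 2^-1.
Proof.
move=> p2 z0; have p0 : 0 < p by apply: lt_le_trans p2.
set B := \sum_(n < N) z n `^ 2.
have B0 : 0 <= B by apply: sumr_ge0 => n _; exact: powR_ge0.
pose A := B `^ 2^-1.
have A0 : 0 <= A by exact: powR_ge0.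
have BE : B = A `^ 2 by rewrite /A -powRrM mulVf// powRr1.
have AE : B `^ 2^-1 = A by [].
clearbody A; have zA n : (n < N)%N -> z n <= A.
  move=> nN; have -> : z n = (z n `^ 2) `^ 2^-1 by rewrite -powRrM mulfV// powRr1.
  rewrite -AE; apply: ge0_ler_powR; rewrite ?nnegrE ?powR_ge0//.
  rewrite /B (bigD1 (Ordinal nN))//= lerDl; apply: sumr_ge0 => i _; exact: powR_ge0.
have h : \sum_(n < N) z n `^ p <= A `^ p.
  have [A00|An0] := eqVneq A 0.
    rewrite big1 ?powR_ge0// => n _.
    have /eqP -> : z n == 0 by rewrite eq_le z0 andbT -A00 zA.
    by rewrite powR0// gt_eqF.
  have Ap : 0 < A by rewrite lt_neqAle eq_sym An0.
  apply: (@le_trans _ _ (\sum_(n < N) A `^ (p - 2) * z n `^ 2)).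
    apply: ler_sum => n _; have [->|zn] := eqVneq (z n) 0.
      by rewrite !powR0 ?mulr0// gt_eqF.
    rewrite -[X in _ `^ X <= _](subrK 2) [leLHS]powRD_gt0; last by rewrite lt_neqAle eq_sym zn z0.
    rewrite ler_wpM2r ?powR_ge0//; apply: ge0_ler_powR; rewrite ?nnegrE//.
      by rewrite subr_ge0.
    by apply: zA.
  rewrite -mulr_sumr -/B BE -powRD_gt0//.
  by rewrite subrK.
rewrite AE; have -> : A = (A `^ p) `^ p^-1 by rewrite -powRrM mulfV ?gt_eqF// powRr1.
apply: ge0_ler_powR; rewrite ?nnegrE ?invr_ge0 ?(ltW p0) ?powR_ge0//.
by apply: sumr_ge0 => n _; exact: powR_ge0.
Qed.

End PowerMeans.

Section Khintchine.
Context {R : realType}.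

Definition set_sign (s : nat -> bool) N b : nat -> bool :=
  fun n => if n == N then b else s n.

(** The mean over the 2^N sign patterns, taken one sign at a time so that moments can be computed by
    induction on N. *)
Fixpoint sign_avg N (F : (nat -> bool) -> R) : R :=
  if N is N'.+1 then
    (sign_avg N' (fun s => F (set_sign s N' false)) +
     sign_avg N' (fun s => F (set_sign s N' true))) / 2
  else F xpred0.

Lemma ler_sign_avg N F G : (forall s, F s <= G s) -> sign_avg N F <= sign_avg N G.
Proof.
elim: N F G => [|N IH] F G FG //=.
by rewrite ler_pM2r// lerD// IH.
Qed.

Lemma sign_avg_lin N (c : R) F G :
  sign_avg N (fun s => c * F s + G s) = c * sign_avg N F + sign_avg N G.
Proof. by elim: N F G => [|N IH] F G //=; rewrite !IH; field. Qed.

Lemma sign_avg_cst N (c : R) : sign_avg N (fun=> c) = c.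
Proof. by elim: N => [|N IH] //=; rewrite IH; field. Qed.

Lemma sign_avg_sum N m (F : nat -> (nat -> bool) -> R) :
  sign_avg N (fun s => \sum_(k < m) F k s) = \sum_(k < m) sign_avg N (F k).
Proof.
elim: m => [|m IH].
  rewrite big_ord0 -[RHS](sign_avg_cst N 0); congr sign_avg.
  by apply/funext => s; rewrite big_ord0.
rewrite big_ord_recr/= -IH -[X in X + _]mul1r -sign_avg_lin; congr sign_avg.
by apply/funext => s; rewrite big_ord_recr/= mul1r.
Qed.

Definition signed_sum {T : pzRingType} (z : nat -> T) N (s : nat -> bool) : T :=
  \sum_(n < N) (-1) ^+ s n * z n.

Lemma signed_sum_recr {T : pzRingType} (z : nat -> T) N s b :
  signed_sum z N.+1 (set_sign s N b) = signed_sum z N s + (-1) ^+ b * z N.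
Proof.
rewrite /signed_sum big_ord_recr/= {2}/set_sign eqxx; congr (_ + _).
by apply: eq_bigr => n _; rewrite /set_sign ltn_eqF.
Qed.

Lemma sign_avg_sqr (z : nat -> R) N :
  sign_avg N (fun s => signed_sum z N s ^+ 2) = \sum_(n < N) z n ^+ 2.
Proof.
elim: N => [|N IH] /=; first by rewrite /signed_sum !big_ord0 expr0n.
rewrite [RHS]big_ord_recr/= -IH.
rewrite -[X in X + _]mul1r -sign_avg_lin.
rewrite (_ : (fun s => _) = (fun s => 2 * signed_sum z N s ^+ 2 + 2 * z N ^+ 2)).
  by rewrite sign_avg_lin sign_avg_cst; field.
by apply/funext => s; rewrite !signed_sum_recr/= expr0 expr1; ring.
Qed.

(** Adding a term y, the mean over its sign of (X + y)^4 and (X - y)^4 is X^4 + 6 y^2 X^2 + y^4. By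
    the exact second moment this is matched by 3 (S + y^2)^2 = 3 S^2 + 6 y^2 S + 3 y^4. *)
Lemma sign_avg_quartic (z : nat -> R) N :
  sign_avg N (fun s => signed_sum z N s ^+ 4) <= 3 * (\sum_(n < N) z n ^+ 2) ^+ 2.
Proof.
elim: N => [|N IH] /=; first by rewrite /signed_sum !big_ord0 !expr0n/= mulr0.
rewrite big_ord_recr/= -[X in (X + _) / 2]mul1r -sign_avg_lin.
rewrite (_ : (fun s => _) = (fun s => 2 * signed_sum z N s ^+ 4 +
    (12 * z N ^+ 2 * signed_sum z N s ^+ 2 + 2 * z N ^+ 4))).
  rewrite !sign_avg_lin sign_avg_cst sign_avg_sqr.
  set S := \sum_(n < N) _ in IH *.
  have : 0 <= z N ^+ 4 by rewrite (exprM _ 2 2) sqr_ge0.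
  set A := sign_avg _ _ in IH *; move: (z N) => y.
  rewrite [X in _ -> _ <= X](_ : _ = 3 * S ^+ 2 + 6 * y ^+ 2 * S + 3 * y ^+ 4); last by ring.
  by rewrite [X in _ -> X <= _](_ : _ = A + 6 * y ^+ 2 * S + y ^+ 4); [lra|field].
by apply/funext => s; rewrite !signed_sum_recr/= expr0 expr1; ring.
Qed.

(* The quadratic and quartic moments control the first one through the
   inequality [y >= 2 (y^2 - y^4)] at [y = |X| / (3 sigma)]. *)
Lemma khintchine_real (z : nat -> R) N :
  (\sum_(n < N) z n ^+ 2) `^ 2^-1 <=
  9 / 4 * sign_avg N (fun s => `|signed_sum z N s|).
Proof.
set S := \sum_(n < N) _.
have S0 : 0 <= S by apply: sumr_ge0 => n _; exact: sqr_ge0.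
rewrite powR12_sqrt//.
have [->|Sn0] := eqVneq S 0.
  rewrite sqrtr0 mulr_ge0// -[X in X <= _](sign_avg_cst N).
  exact: ler_sign_avg.
have Sp : 0 < S by rewrite lt_neqAle eq_sym Sn0.
set t := Num.sqrt S; have t0 : 0 < t by rewrite sqrtr_gt0.
have St : S = t ^+ 2 by rewrite sqr_sqrtr.
have key s : - (2 / (3 * t) ^+ 3) * signed_sum z N s ^+ 4 +
    (2 / (3 * t) * signed_sum z N s ^+ 2 + 0) <= `|signed_sum z N s|.
  move: (signed_sum z N s) => x; rewrite [x ^+ 4](exprM _ 2 2) -(real_normK (num_real x)).
  move: `|x| (normr_ge0 x) => y y0.
  pose u := y / (3 * t); have -> : y = u * (3 * t) by rewrite /u; field; rewrite gt_eqF.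
  have u0 : 0 <= u by rewrite divr_ge0// mulr_ge0// ltW.
  rewrite [leLHS](_ : _ = 2 * (u ^+ 2 - u ^+ 4) * (3 * t)); last by field; rewrite gt_eqF.
  rewrite ler_wpM2r ?mulr_ge0 ?(ltW t0)//.
  have : 0 <= u * (1 - 2 * u + 2 * u ^+ 3).
    rewrite mulr_ge0//.
    (* The cubic 1 - 2u + 2u^3 is smallest on u >= 0 at 1/sqrt 3, near 3/5. This cubic with a double
       root at 3/5 lies below it for u >= 0: the difference is 17/125 + 4u/25. *)
    have : 0 <= 2 * (u + 6 / 5) * (u - 3 / 5) ^+ 2.
      by apply: mulr_ge0; [lra|exact: sqr_ge0].
    nra.
  nra.
have := ler_sign_avg N key; rewrite !sign_avg_lin sign_avg_cst sign_avg_sqr -/S.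
have := sign_avg_quartic z N; rewrite -/S.
set Q := sign_avg _ _; set E := sign_avg _ _ => hQ h.
have h2 : 2 / (3 * t) ^+ 3 * Q <= 2 / (3 * t) ^+ 3 * (3 * S ^+ 2).
  by rewrite ler_wpM2l// divr_ge0// exprn_ge0// mulr_ge0// ltW.
have h3 : - (2 / (3 * t) ^+ 3) * (3 * S ^+ 2) + 2 / (3 * t) * S <= E by lra.
rewrite St [X in X <= _](_ : _ = 4 / 9 * t) in h3; last by field; rewrite gt_eqF.
lra.
Qed.

(** Real and imaginary parts are treated separately, which doubles the real constant 9/4. *)
Lemma khintchine (z : nat -> R[i]) N :
  (\sum_(n < N) rnorm (z n) `^ 2) `^ 2^-1 <=
  9 / 2 * sign_avg N (fun s => rnorm (signed_sum z N s)).
Proof.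
have Re_sum s : complex.Re (signed_sum z N s) = signed_sum (@complex.Re R \o z) N s.
  rewrite /signed_sum raddf_sum; apply: eq_bigr => n _ /=.
  by case: (s n); rewrite ?expr0 ?expr1 ?mul1r// !mulN1r raddfN.
have Im_sum s : complex.Im (signed_sum z N s) = signed_sum (@complex.Im R \o z) N s.
  rewrite /signed_sum raddf_sum; apply: eq_bigr => n _ /=.
  by case: (s n); rewrite ?expr0 ?expr1 ?mul1r// !mulN1r raddfN.
have hRe := khintchine_real (@complex.Re R \o z) N.
have hIm := khintchine_real (@complex.Im R \o z) N.
set E := sign_avg _ _.
have h1 : sign_avg N (fun s => `|signed_sum (@complex.Re R \o z) N s|) <= E.
  by apply: ler_sign_avg => s; rewrite -Re_sum normr_Re_le.
have h2 : sign_avg N (fun s => `|signed_sum (@complex.Im R \o z) N s|) <= E.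
  by apply: ler_sign_avg => s; rewrite -Im_sum normr_Im_le.
have -> : \sum_(n < N) rnorm (z n) `^ 2 =
    \sum_(n < N) (@complex.Re R \o z) n ^+ 2 + \sum_(n < N) (@complex.Im R \o z) n ^+ 2.
  rewrite -big_split/=; apply: eq_bigr => n _.
  by rewrite powR_mulrn ?rnorm_ge0// rnorm_sqr.
set A := \sum_(n < N) _ in hRe *; set B := \sum_(n < N) (_ \o z) n ^+ 2 in hIm *.
have A0 : 0 <= A by apply: sumr_ge0 => n _; exact: sqr_ge0.
have B0 : 0 <= B by apply: sumr_ge0 => n _; exact: sqr_ge0.
have : (A + B) `^ 2^-1 <= A `^ 2^-1 + B `^ 2^-1.
  rewrite !powR12_sqrt ?addr_ge0//.
  rewrite -[leRHS]ger0_norm ?addr_ge0 ?sqrtr_ge0// -sqrtr_sqr ler_wsqrtr//.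
  rewrite sqrrD !sqr_sqrtr// lerD2r lerDl.
  by rewrite mulrn_wge0// mulr_ge0// sqrtr_ge0.
lra.
Qed.

(** For p >= 2 the l^2 norm dominates the l^p norm, and the power of d is 1; for p < 2 [power_mean]
    costs 2 d^(1/p - 1/2). *)
Lemma lp_le_sign_avg (z : nat -> R[i]) N (p d : R) :
    1 < p -> N%:R <= d -> 1 <= d ->
  (\sum_(n < N) rnorm (z n) `^ p) `^ p^-1 <=
  9 * d `^ Num.max 0 (p^-1 - 2^-1) *
  sign_avg N (fun s => rnorm (signed_sum z N s)).
Proof.
move=> p1 Nd d1; have p0 : 0 < p by apply: lt_trans p1.
have d0 : 0 < d by apply: lt_le_trans d1.
have hk := khintchine z N; set E := sign_avg _ _ in hk *.
have E0 : 0 <= E.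
  rewrite /E -[X in X <= _](sign_avg_cst N); apply: ler_sign_avg => s.
  exact: rnorm_ge0.
have dm : 1 <= d `^ Num.max 0 (p^-1 - 2^-1).
  by rewrite -[leLHS](powRr0 d) ler_powR// le_max lexx.
have z0 n : 0 <= rnorm (z n) by exact: rnorm_ge0.
have [p2|p2] := leP 2 p.
  apply: (le_trans (lp_le_l2 N p2 z0)); apply: (le_trans hk).
  rewrite ler_wpM2r//; lra.
apply: (le_trans (power_mean (ltW p1) (ltW p2) Nd d0 z0)).
rewrite max_r; last by rewrite subr_ge0 lef_pV2 ?posrE// ltW.
apply: (@le_trans _ _ (2 * d `^ (p^-1 - 2^-1) * (9 / 2 * E))).
  by rewrite ler_wpM2l// mulr_ge0// powR_ge0.
by rewrite le_eqVlt; apply/orP; left; apply/eqP; field.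
Qed.

End Khintchine.

(** * Total boundedness *)

Section TotallyBounded.
Context {R : realType} {X : normedModType R[i]}.

Definition totally_bounded (S : set X) := forall e : R, 0 < e ->
  exists ys : seq X, forall x, S x -> exists2 y, y \in ys & rnorm (x - y) < e.

(** Completeness in terms of absolutely convergent series: the form that the Riesz-Fischer argument
    yields and that the construction of K consumes. *)
Definition abs_complete := forall g : nat -> X,
  (exists B : R, forall N, \sum_(n < N) rnorm (g n) <= B) ->
  exists l : X, (fun N => \sum_(n < N) g n) @ \oo --> l.

Lemma totally_boundedD (S T : set X) : totally_bounded S -> totally_bounded T ->
  totally_bounded [set x | exists a b, [/\ S a, T b & x = a + b]].
Proof.
move=> tS tT e e0; have e2 : 0 < e / 2 by rewrite divr_gt0.
have [ys hys] := tS _ e2; have [zs hzs] := tT _ e2.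
exists [seq y + z | y <- ys, z <- zs] => _ [a [b [Sa Tb ->]]].
have [y yys ay] := hys a Sa; have [z zzs bz] := hzs b Tb.
exists (y + z); first by apply/allpairsP; exists (y, z).
rewrite opprD addrACA; apply: le_lt_trans (ler_rnormD _ _) _.
by rewrite (_ : e = e / 2 + e / 2); [exact: ltrD|field].
Qed.

Lemma totally_bounded_sum (I : Type) (r : seq I) (S : I -> set X) :
  (forall i, totally_bounded (S i)) ->
  totally_bounded [set x | exists2 f : I -> X, (forall i, S i (f i)) &
    x = \sum_(i <- r) f i].
Proof.
move=> tS; elim: r => [|i r IH].
  move=> e e0; exists [:: 0] => _ [f _ ->]; exists 0; first by rewrite inE.
  by rewrite big_nil subrr rnorm0.
move=> e e0; have [ys hys] := totally_boundedD (tS i) IH e0.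
exists ys => _ [f Sf ->]; apply: hys.
by exists (f i), (\sum_(j <- r) f j); rewrite big_cons; split => //; exists f.
Qed.

Lemma totally_bounded_segment (c : R) (u : X) :
  totally_bounded [set t%:C *: u | t in [set t : R | `|t| <= c]].
Proof.
move=> e e0; pose d := e / (rnorm u + 1).
have u1 : 0 < rnorm u + 1 by rewrite ltr_wpDl ?rnorm_ge0.
have d0 : 0 < d by rewrite divr_gt0.
exists [seq (k%:R * d - c)%:C *: u | k <- iota 0 (Num.truncn (2 * c / d)).+1].
move=> _ [t tc <-].
have /andP[ct tc'] : - c <= t <= c by rewrite -ler_norml.
pose k := Num.truncn ((t + c) / d).
have tcd0 : 0 <= (t + c) / d by rewrite divr_ge0 ?(ltW d0)//; lra.
have /andP[k1 k2] := truncn_itv tcd0.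
exists ((k%:R * d - c)%:C *: u).
  apply/mapP; exists k => //; rewrite mem_iota add0n ltnS /=.
  apply: le_truncn; rewrite ler_pM2r ?invr_gt0//; lra.
rewrite -scalerBl -rmorphB rnormZ rnorm_real.
have h : `|t - (k%:R * d - c)| <= d.
  rewrite ler_pdivlMr// in k1; rewrite ltr_pdivrMr// -natr1 mulrDl mul1r in k2.
  rewrite -/k in k1 k2; rewrite ler_norml; apply/andP; split; lra.
apply: (@le_lt_trans _ _ (d * rnorm u)); first by rewrite ler_wpM2r ?rnorm_ge0.
rewrite /d mulrAC ltr_pdivrMr// ltr_pM2l//; lra.
Qed.

Lemma totally_bounded_disc (c : R) (u : X) :
  totally_bounded [set z *: u | z in [set z : R[i] | rnorm z <= c]].
Proof.
move=> e e0.
have [ys hys] := totally_boundedD (totally_bounded_segment c u)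
  (totally_bounded_segment c ('i%C *: u)) e0.
exists ys => _ [z zc <-]; apply: hys.
exists ((complex.Re z)%:C *: u), ((complex.Im z)%:C *: ('i%C *: u)); split.
- by exists (complex.Re z) => //; apply: le_trans (normr_Re_le _) zc.
- by exists (complex.Im z) => //; apply: le_trans (normr_Im_le _) zc.
- by rewrite scalerA -scalerDl {1}(complexE z) mulrC.
Qed.

Lemma totally_bounded_approx (S : set X) :
  (forall e : R, 0 < e -> exists2 T, totally_bounded T &
    forall x, S x -> exists2 y, T y & rnorm (x - y) < e) -> totally_bounded S.
Proof.
move=> hS e e0; have e2 : 0 < e / 2 by rewrite divr_gt0.
have [T tT hT] := hS _ e2; have [ys hys] := tT _ e2.
exists ys => x /hT[y Ty xy]; have [z zys yz] := hys y Ty; exists z => //.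
rewrite -(subrKA y); apply: le_lt_trans (ler_rnormD _ _) _.
by rewrite (_ : e = e / 2 + e / 2); [exact: ltrD|field].
Qed.

Lemma nbhs_rnorm (x : X) (A : set X) :
  nbhs x A <-> exists2 e : R, 0 < e & forall y, rnorm (x - y) < e -> A y.
Proof.
split.
- move=> /nbhs_ballP[e /= e0 eA].
  have eR : e = (complex.Re e)%:C by rewrite RRe_real// gtr0_real.
  exists (complex.Re e); first by rewrite -ltcR -eR.
  by move=> y xy; apply: eA; rewrite -ball_normE/= eR -rnormE ltcR.
- move=> [e e0 eA]; apply/nbhs_ballP; exists e%:C; first by rewrite /= ltcR.
  by move=> y; rewrite -ball_normE/= -rnormE ltcR => /eA.
Qed.

Lemma totally_bounded_closure (S : set X) :
  totally_bounded S -> totally_bounded (closure S).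
Proof.
move=> tS; apply: totally_bounded_approx => e e0; exists S => // x Sx.
have [|y [Sy xy]] := Sx [set y | rnorm (x - y) < e]; last by exists y.
by apply/nbhs_rnorm; exists e.
Qed.

(** An ultrafilter on the closure contains one ball of each finite net. Balls of radius 2^-k in it
    meet pairwise, so their centers form a fast Cauchy sequence, whose limit is the limit of the
    ultrafilter. *)
Lemma totally_bounded_precompact (S : set X) : abs_complete ->
  totally_bounded S -> precompact S.
Proof.
move=> cX /totally_bounded_closure tS; rewrite precompactE compact_ultra => F FU FS.
have FF : ProperFilter F by exact: ultra_proper.
have Fball (e : R) : 0 < e -> exists y, F [set x | rnorm (x - y) < e].
  move=> e0; have [ys hys] := tS e e0.
  apply: contrapT => /forallNP nF.
  have : F [set x | forall y, y \in ys -> ~ rnorm (x - y) < e].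
    elim: ys {hys} => [|y ys IH]; first by apply: filterS filterT => x _ y.
    have [/nF//|Fy] := in_ultra_setVsetC [set x | rnorm (x - y) < e] FU.
    apply: filterS2 IH Fy => x h xy z; rewrite inE => /predU1P[->//|]; exact: h.
  move=> /(filterI FS) /filter_ex[x [Sx hx]].
  by have [y /hx] := hys x Sx.
have /choice[y hy] : forall k : nat, exists y, F [set x | rnorm (x - y) < (1 / 2 : R) ^+ k].
  by move=> k; apply: Fball; rewrite exprn_gt0// divr_gt0.
have yy k l : rnorm (y k - y l) <= (1 / 2 : R) ^+ k + (1 / 2) ^+ l.
  have [x [xk xl]] := filter_ex (filterI (hy k) (hy l)).
  rewrite -(subrKA x); apply: le_trans (ler_rnormD _ _) _.
  by rewrite rnormB; apply: lerD; exact: ltW.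
have [|l hl] := cX (fun k => y k.+1 - y k).
  (* Successive centers differ by at most twice 2^-n, and these bounds sum to less than 4. *)
  exists 4 => N.
  apply: (@le_trans _ _ (\sum_(n < N) 2 * (1 / 2 : R) ^+ n)).
    apply: ler_sum => n _; apply: le_trans (yy _ _) _.
    rewrite exprS; have : 0 < (1 / 2 : R) ^+ n by rewrite exprn_gt0// divr_gt0.
    lra.
  rewrite -mulr_sumr.
  suff -> : \sum_(n < N) (1 / 2 : R) ^+ n = 2 - 2 * (1 / 2) ^+ N.
    have : 0 < (1 / 2 : R) ^+ N by rewrite exprn_gt0// divr_gt0.
    lra.
  elim: N => [|N IH]; first by rewrite big_ord0 expr0; field.
  by rewrite big_ord_recr/= IH exprS; field.
have telE N : \sum_(n < N) (y n.+1 - y n) = y N - y 0.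
  elim: N => [|N IH]; first by rewrite big_ord0 subrr.
  by rewrite big_ord_recr/= IH addrC subrKA.
exists (l + y 0).
have Fl : F --> l + y 0.
  move=> A /nbhs_rnorm[e e0 eA].
  have e2 : 0 < e / 2 by rewrite divr_gt0.
  have /cvg_rnormP /(_ _ e2) [N hN] := hl.
  have [n Nn hn] : exists2 n, (N <= n)%N & (1 / 2 : R) ^+ n < e / 2.
    have : (fun n => (1 / 2 : R) ^+ n) @ \oo --> 0.
      by apply: cvg_expr; rewrite ger0_norm ?divr_ge0//; lra.
    move=> /cvgrPdist_lt /(_ _ e2) [n0 _ h].
    exists (maxn N n0); first exact: leq_maxl.
    have := h (maxn N n0) (leq_maxr _ _).
    by rewrite /= sub0r normrN ger0_norm// exprn_ge0// divr_ge0.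
  apply: filterS (hy n) => x xy; apply: eA.
  rewrite -(subrKA (y n)); apply: le_lt_trans (ler_rnormD _ _) _.
  rewrite (_ : e = e / 2 + e / 2); last by field.
  apply: ltrD; last by rewrite rnormB; exact: lt_trans hn.
  have := hN n Nn; rewrite telE opprB addrA.
  by rewrite addrAC.
split => //.
apply: (@closed_cvg _ _ F _ id (closure S)) => //.
exact: closed_closure.
Qed.

End TotallyBounded.

(** * Bounded and summing operators *)

Section OperatorBounds.
Context {R : realType} {X : normedModType R[i]}.

Lemma unit_ballP (x : X) : unit_ball x <-> rnorm x <= 1.
Proof. by rewrite /unit_ball/= -rnormE -lecR. Qed.

Lemma bounded_operator_rnorm (T : {linear X -> X}) (c : R) :
  (forall x, rnorm (T x) <= c * rnorm x) -> bounded_operator T.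
Proof.
move=> Tc; exists (`|c|)%:C; split; first by rewrite complex_real.
move=> M cM x /unit_ballP x1 /=; apply: le_trans (ltW cM).
rewrite -rnormE lecR; apply: le_trans (Tc x) _.
apply: (@le_trans _ _ (`|c| * rnorm x)).
  by rewrite ler_wpM2r ?rnorm_ge0// ler_norm.
by rewrite ler_piMr.
Qed.

Lemma weak_l1_norm_ge0 m (x : 'I_m -> X) : (0 <= weak_l1_norm x)%E.
Proof.
apply: (@le_trans _ _ (\sum_(k < m) rnorm ((\0 : {scalar X}) (x k)))%:E).
  by rewrite lee_fin sumr_ge0// => k _; exact: rnorm_ge0.
apply: ereal_sup_ubound; exists (\0 : {scalar X}) => //=.
apply: ge_ereal_sup => _ [y _ <-]; rewrite lee_fin.
by rewrite rnorm0.
Qed.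

(** Dividing phi by B puts it in the dual unit ball, over which the weak norm is a supremum. *)
Lemma weak_l1_norm_functional m (x : 'I_m -> X) (phi : X -> R[i]) (B W : R) :
    (forall (a : R[i]) y z, phi (a *: y + z) = a * phi y + phi z) ->
    0 < B -> (forall y, rnorm (phi y) <= B * rnorm y) ->
    weak_l1_norm x = W%:E ->
  \sum_(k < m) rnorm (phi (x k)) <= B * W.
Proof.
move=> phi_lin B0 phiB xW.
pose psi y : R[i] := B^-1%:C * phi y.
have psi_lin : linear_for *%R psi.
  by move=> a y z; rewrite /psi phi_lin mulrDr mulrCA.
pose Psi : {scalar X} := HB.pack psi (GRing.isLinear.Build _ _ _ _ psi psi_lin).
have psiE y : rnorm (Psi y) = B^-1 * rnorm (phi y).
  by rewrite [LHS]rnormM rnorm_real ger0_norm// invr_ge0 ltW.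
have : ((\sum_(k < m) rnorm (Psi (x k)))%:E <= weak_l1_norm x)%E.
  apply: ereal_sup_ubound; exists Psi => //=.
  apply: ge_ereal_sup => _ [y /unit_ballP y1 <-]; rewrite lee_fin psiE.
  rewrite mulrC ler_pdivrMr// mul1r; apply: le_trans (phiB y) _.
  by rewrite ler_piMr// ltW.
rewrite xW lee_fin; under eq_bigr do rewrite psiE.
by rewrite -mulr_sumr mulrC ler_pdivrMr// mulrC.
Qed.

Lemma one_summing_norm_le (T : {linear X -> X}) (c : R) : 0 < c ->
  (forall m (x : 'I_m -> X) (W : R), weak_l1_norm x = W%:E ->
    \sum_(k < m) rnorm (T (x k)) <= c * W) ->
  (one_summing_norm T <= c%:E)%E.
Proof.
move=> c0 Tc; apply: ereal_inf_lbound; split; first by rewrite lee_fin ltW.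
move=> m x; have := weak_l1_norm_ge0 x.
case E : (weak_l1_norm x) => [W| |] // _.
  by rewrite -EFinM lee_fin; exact: Tc.
by rewrite gt0_muley ?leey.
Qed.

Lemma cvg_rnorm (u : nat -> X) (l : X) : u @ \oo --> l ->
  (fun n => rnorm (u n)) @ \oo --> rnorm l.
Proof.
move=> /cvg_rnormP ul; apply/cvgrPdist_lt => e e0.
have [N hN] := ul e e0; exists N => // n Nn /=.
apply: le_lt_trans (hN n Nn).
rewrite ler_norml; apply/andP; split.
  rewrite lerNl opprB lerBlDr rnormB; apply: le_trans (ler_rnormD _ _).
  by rewrite subrK.
by rewrite lerBlDr; apply: le_trans (ler_rnormD _ _); rewrite subrK.
Qed.

End OperatorBounds.

(** * The block operator *)

Section BlockOperator.
Context {R : realType} {X : normedModType R[i]}.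
Variables (v : nat -> X) (C rho p : R) (M : nat) (T : {linear X -> X}) (c : nat -> R[i]).
Variable coef : X -> nat -> R[i].
Hypothesis C0 : 0 < C.
Hypothesis rho0 : 0 < rho.
Hypothesis p1 : 1 < p.
Hypothesis M0 : (0 < M)%N.
Hypothesis coef0 : forall x n, v n = 0 -> coef x n = 0.
Hypothesis coef_lin : forall n (a : R[i]) x y,
  coef (a *: x + y) n = a * coef x n + coef y n.
Hypothesis coef_bound : forall x (P : pred nat) m,
  rnorm (\sum_(n < m | P n) coef x n *: v n) <= C * rnorm x.
Hypothesis coef_v : forall i n, v i != 0 -> coef (v i) n = (n == i)%:R.
Hypothesis X_complete : @abs_complete R X.

(** Block 0 consists of the M indicators, block j + 1 of the Haar functions with index in [2^j M,
    2^(j+1) M). [block_scale j] bounds the size of block j, with equality only for j = 0; it is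
    exactly geometric from the start. *)
Definition block_start j := if j is k.+1 then (2 ^ k * M)%N else 0%N.
Definition block_size j := (block_start j.+1 - block_start j)%N.
Definition block_scale j : R := (2 ^ j * M)%:R.
Local Notation s := block_start.
Local Notation N := block_size.
Local Notation d := block_scale.

Definition defect n : X := T (v n) - c n *: v n.
Local Notation e := defect.

Hypothesis block_norm : forall j (z : nat -> R[i]),
  rnorm (\sum_(i < N j) z i *: v (s j + i)) `^ p =
  \sum_(i < N j) (rnorm (z i) * rnorm (v (s j + i))) `^ p.
Hypothesis block_defect : forall j (z : nat -> R[i]),
  rnorm (\sum_(i < N j) z i *: e (s j + i)) <=
  rho / d j * rnorm (\sum_(i < N j) z i *: v (s j + i)).

Definition block x j : X := \sum_(i < N j) coef x (s j + i) *: v (s j + i).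
Definition Kblock x j : X := \sum_(i < N j) coef x (s j + i) *: e (s j + i).

Let p0 : 0 < p. Proof. by apply: lt_trans p1. Qed.

Lemma block_scale_ge1 j : 1 <= d j.
Proof. by rewrite ler1n muln_gt0 expn_gt0. Qed.

Lemma block_scale_gt0 j : 0 < d j.
Proof. exact: lt_le_trans (block_scale_ge1 j). Qed.

Lemma block_size_le j : (N j)%:R <= d j.
Proof. by rewrite ler_nat /block_size /= leq_subr. Qed.

Lemma block_startS j : (s j <= s j.+1)%N.
Proof. by case: j => [|j] //=; rewrite expnS -mulnA leq_pmull. Qed.

Lemma block_le x j : rnorm (block x j) <= C * rnorm x.
Proof.
have := coef_bound x (fun n => (s j <= n)%N) (s j + N j).
rewrite big_split_ord big_pred0/= ?add0r => [|i]; last first.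
  by rewrite leqNgt ltn_ord.
by rewrite (eq_bigl xpredT)// => i; rewrite leq_addr.
Qed.

Lemma Kblock_le_block x j : rnorm (Kblock x j) <= rho / d j * rnorm (block x j).
Proof. exact: (block_defect j (fun i => coef x (s j + i))). Qed.

Lemma Kblock_lin j (a : R[i]) x y :
  Kblock (a *: x + y) j = a *: Kblock x j + Kblock y j.
Proof.
rewrite /Kblock scaler_sumr -big_split/=; apply: eq_bigr => i _.
by rewrite coef_lin scalerDl scalerA.
Qed.

Lemma sum_inv_scale J k :
  \sum_(j < k) (d (J + j))^-1 = 2 / d J - 2 / d (J + k).
Proof.
elim: k => [|k IH]; first by rewrite big_ord0 addn0 subrr.
rewrite big_ord_recr/= IH addnS.
have -> : d (J + k).+1 = 2 * d (J + k) by rewrite /block_scale expnS -mulnA natrM.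
have := block_scale_gt0 (J + k); move: (d (J + k)) (2 / d J) => y a y0.
by field; rewrite gt_eqF.
Qed.

Lemma Kblock_tail x J k :
  \sum_(j < k) rnorm (Kblock x (J + j)) <= 2 * rho * C / d J * rnorm x.
Proof.
apply: (@le_trans _ _ (\sum_(j < k) rho * C * rnorm x * (d (J + j))^-1)).
  apply: ler_sum => j _; apply: le_trans (Kblock_le_block _ _) _.
  rewrite (_ : rho * C * _ * _ = rho / d (J + j) * (C * rnorm x)); last by ring.
  by rewrite ler_wpM2l ?block_le// divr_ge0 ?ltW ?block_scale_gt0.
rewrite -mulr_sumr sum_inv_scale.
rewrite (_ : 2 * rho * C / d J * rnorm x = rho * C * rnorm x * (2 / d J)); last by ring.
rewrite ler_wpM2l ?mulr_ge0 ?rnorm_ge0 ?(ltW rho0) ?(ltW C0)//.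
by rewrite lerBlDr lerDl divr_ge0// ltW ?block_scale_gt0.
Qed.

(** The blocks are bounded by a multiple of 1 / d j, which is summable, so completeness gives the
    sum. *)
Lemma Kfun_exists : exists K : {linear X -> X},
  forall x, (fun J => \sum_(j < J) Kblock x j) @ \oo --> K x.
Proof.
have /choice[K hK] : forall x, exists y,
    (fun J => \sum_(j < J) Kblock x j) @ \oo --> (y : X).
  move=> x; apply: X_complete; exists (2 * rho * C / d 0 * rnorm x) => J.
  exact: (Kblock_tail x 0).
have Klin : linear K.
  move=> a x y; apply: (@cvg_unique _ (@norm_hausdorff _ X) _ _ _ _ (hK _)).
  rewrite (_ : (fun J => _) = (fun J => a *: (\sum_(j < J) Kblock x j) +
      \sum_(j < J) Kblock y j)).
    by apply: cvgD => //; apply: cvgZl_tmp.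
  apply/funext => J; rewrite scaler_sumr -big_split/=; apply: eq_bigr => j _.
  exact: Kblock_lin.
pose L : {linear X -> X} := HB.pack K (GRing.isLinear.Build _ _ _ _ K Klin).
by exists L.
Qed.

Section Limit.
Variable K : {linear X -> X}.
Hypothesis K_lim : forall x, (fun J => \sum_(j < J) Kblock x j) @ \oo --> K x.

Lemma K_tail x J :
  rnorm (K x - \sum_(j < J) Kblock x j) <= 2 * rho * C / d J * rnorm x.
Proof.
apply/ler_addgt0Pr => eps eps0.
have /cvg_rnormP /(_ _ eps0) [k hk] := @K_lim x.
rewrite -(subrKA (\sum_(j < J + k) Kblock x j)).
apply: le_trans (ler_rnormD _ _) _; rewrite addrC; apply: lerD.
  rewrite big_split_ord/= [_ + _ - _]addrAC subrr add0r; apply: le_trans (ler_rnorm_sum _ _ _) _.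
  exact: Kblock_tail.
by apply/ltW/hk; rewrite leq_addl.
Qed.

Lemma K_bound x : rnorm (K x) <= 2 * rho * C / d 0 * rnorm x.
Proof. by have := K_tail x 0; rewrite big_ord0 subr0. Qed.

Lemma Kblock_v i j : v i != 0 ->
  Kblock (v i) j = if (s j <= i < s j.+1)%N then e i else 0.
Proof.
move=> vi; rewrite /Kblock; case: ifPn => [/andP[si sj]|si].
  have iN : (i - s j < N j)%N by rewrite /block_size; lia.
  rewrite (bigD1 (Ordinal iN))//= subnKC// coef_v// eqxx scale1r.
  rewrite big1 ?addr0// => k; rewrite -val_eqE/= => ki.
  by rewrite coef_v// (_ : (_ == _) = false) ?scale0r//; lia.
rewrite big1// => k _; rewrite coef_v// (_ : (_ == _) = false) ?scale0r//.
have := ltn_ord k; move: si; rewrite /block_size; have := block_startS j; lia.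
Qed.

Lemma block_exists i : exists j, (s j <= i < s j.+1)%N.
Proof.
have [n] : exists n, (i < s n.+1)%N.
  by exists i => /=; apply: leq_trans (ltn_expl i (ltnSn 1)) _; rewrite leq_pmulr.
elim: n => [|n IH] hn; first by exists 0; rewrite hn.
by have [/IH//|sn] := ltnP i (s n.+1); exists n.+1; rewrite sn hn.
Qed.

Lemma block_start_le j k : (j <= k)%N -> (s j <= s k)%N.
Proof.
move=> /subnKC <-; elim: (k - j)%N => [|m IH]; first by rewrite addn0.
by rewrite addnS; apply: leq_trans IH (block_startS _).
Qed.

Lemma K_v i : v i != 0 -> K (v i) = e i.
Proof.
move=> vi; apply: (@cvg_unique _ (@norm_hausdorff _ X) _ _ _ _ (@K_lim _)).
have [j sj] := block_exists i.
apply/cvg_rnormP => eps eps0; exists j.+1 => J jJ.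
rewrite (bigD1 (Ordinal jJ))//= Kblock_v// sj big1 ?addr0 ?subrr ?rnorm0// => k.
rewrite -val_eqE/= Kblock_v// => kj; rewrite ifF//.
have [jk|jk|/eqP] := ltngtP j k; last by rewrite eq_sym (negbTE kj).
  by have := block_start_le jk; lia.
by have := block_start_le jk; lia.
Qed.

Lemma K_compact : compact_operator K.
Proof.
apply: totally_bounded_precompact => //; apply: totally_bounded_approx => eps eps0.
have [J hJ] : exists J, 2 * rho * C / d J < eps.
  exists (Num.truncn (2 * rho * C / eps)).
  rewrite ltr_pdivrMr ?block_scale_gt0// [ltRHS]mulrC -ltr_pdivrMr//.
  apply: lt_le_trans (truncnS_gt _) _; rewrite ler_nat.
  apply: leq_trans (ltn_expl _ (ltnSn 1)) _; rewrite leq_pmulr//.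
(* Bounds on the coefficients confine the terms of a finite partial sum to discs. If v n = 0, the
   radius C / 0 is 0, and the coefficient is 0 as well. *)
pose D n : set X := [set z *: e n | z in [set z : R[i] | rnorm z <= C / rnorm (v n)]].
pose S (j : 'I_J) : set X := [set x | exists2 f : 'I_(N j) -> X,
  (forall i : 'I_(N j), D (s j + i)%N (f i)) & x = \sum_(i < N j) f i].
exists [set x | exists2 f : 'I_J -> X, (forall j, S j (f j)) & x = \sum_(j < J) f j].
  apply: totally_bounded_sum => j.
  apply: (@totally_bounded_sum _ _ _ _ (fun i : 'I_(N j) => D (s j + i)%N)) => i.
  exact: totally_bounded_disc.
move=> _ [x /unit_ballP x1 <-]; exists (\sum_(j < J) Kblock x j).
  exists (fun j : 'I_J => Kblock x j) => // j.
  exists (fun i : 'I_(N j) => coef x (s j + i) *: e (s j + i)) => // i.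
  exists (coef x (s j + i)) => //=.
  have [v0|v0] := eqVneq (v (s j + i)) 0.
    by rewrite coef0// rnorm0 divr_ge0 ?rnorm_ge0 ?ltW.
  have vp : 0 < rnorm (v (s j + i)).
    by rewrite lt_neqAle rnorm_ge0 andbT eq_sym; apply: contra_neq v0 => /rnorm_eq0.
  rewrite ler_pdivlMr//.
  have := coef_bound x (pred1 (s j + i)%N) (s j + i).+1.
  rewrite big_mkcond big_ord_recr/= eqxx big1 ?add0r => [|k _]; last first.
    by rewrite ltn_eqF.
  rewrite rnormZ => /le_trans; apply; rewrite ler_piMr// ltW//.
apply: le_lt_trans (K_tail x J) _; apply: le_lt_trans hJ.
rewrite ler_piMr// divr_ge0 ?mulr_ge0 ?ltW ?block_scale_gt0//.
Qed.


(** The sign functionals of the block in the scaled coordinates, in which [rnorm_block] identifies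
    its norm with an l^p norm. *)
Definition signed_coef j sg x : R[i] :=
  signed_sum (fun i => (rnorm (v (s j + i)))%:C * coef x (s j + i)) (N j) sg.

Lemma signed_coef_lin j sg (a : R[i]) x y :
  signed_coef j sg (a *: x + y) = a * signed_coef j sg x + signed_coef j sg y.
Proof.
rewrite /signed_coef /signed_sum mulr_sumr -big_split/=; apply: eq_bigr => i _.
rewrite coef_lin; ring.
Qed.

Lemma rnorm_block x j : rnorm (block x j) =
  (\sum_(i < N j) rnorm ((rnorm (v (s j + i)))%:C * coef x (s j + i)) `^ p) `^ p^-1.
Proof.
transitivity ((rnorm (block x j) `^ p) `^ p^-1).
  by rewrite -powRrM mulfV ?gt_eqF// powRr1 ?rnorm_ge0.
congr (_ `^ _); rewrite (block_norm j (fun i => coef x (s j + i))).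
apply: eq_bigr => i _; congr (_ `^ _).
by rewrite rnormM rnorm_real ger0_norm ?rnorm_ge0// mulrC.
Qed.

(** The triangle inequality leaves an l^1 norm, and [power_mean] from l^1 to l^p costs 2 d^(1 -
    1/p). *)
Lemma signed_coef_bound j sg x :
  rnorm (signed_coef j sg x) <= 2 * C * d j `^ (1 - p^-1) * rnorm x.
Proof.
pose z i := rnorm ((rnorm (v (s j + i)))%:C * coef x (s j + i)).
have z0 i : 0 <= z i by exact: rnorm_ge0.
have := power_mean (lexx 1) (ltW p1) (block_size_le j) (block_scale_gt0 j) z0.
rewrite invr1 powRr1; last by apply: sumr_ge0 => i _; exact: powR_ge0.
rewrite -/(z _) -rnorm_block => h.
apply: (@le_trans _ _ (\sum_(i < N j) z i `^ 1)).
  apply: le_trans (ler_rnorm_sum _ _ _) _; apply: ler_sum => i _.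
  rewrite powRr1// rnormM; case: (sg i); rewrite ?expr0 ?expr1 ?rnormN.
    by rewrite -[1]/(1%:C) rnorm_real normr1 mul1r.
  by rewrite -[1]/(1%:C) rnorm_real normr1 mul1r.
apply: (le_trans h).
rewrite (_ : 2 * C * _ * _ = 2 * d j `^ (1 - p^-1) * (C * rnorm x)); last by ring.
by rewrite ler_wpM2l ?block_le// mulr_ge0// powR_ge0.
Qed.

Let theta := Num.min 2^-1 p^-1.

(** For fixed signs the sum over k is tested against the weak norm, and the bound survives
    averaging. The powers of d add up to -1 + max(0, 1/p - 1/2) + 1 - 1/p = - theta, and 18 = 9 *
    2. *)
Lemma Kblock_summing j m (x : 'I_m -> X) (W : R) : weak_l1_norm x = W%:E ->
  \sum_(k < m) rnorm (Kblock (x k) j) <= 18 * rho * C * d j `^ (- theta) * W.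
Proof.
move=> xW.
have d0 := block_scale_gt0 j.
have h k : rnorm (Kblock (x k) j) <= rho / d j * (9 * d j `^ Num.max 0 (p^-1 - 2^-1) *
    sign_avg (N j) (fun sg => rnorm (signed_coef j sg (x k)))).
  apply: (le_trans (Kblock_le_block _ _)).
  rewrite ler_wpM2l ?divr_ge0 ?(ltW rho0) ?(ltW d0)// rnorm_block.
  exact: lp_le_sign_avg p1 (block_size_le j) (block_scale_ge1 j).
apply: (le_trans (ler_sum _ (fun k _ => h k))).
rewrite -!mulr_sumr.
have avg_sum : \sum_(k < m) sign_avg (N j) (fun sg => rnorm (signed_coef j sg (x k))) <=
    2 * C * d j `^ (1 - p^-1) * W.
  rewrite (_ : \sum_(k < m) _ =
      sign_avg (N j) (fun sg => \sum_(k < m) rnorm (signed_coef j sg (x k)))).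
    rewrite -[leRHS](sign_avg_cst (N j)); apply: ler_sign_avg => sg.
    apply: weak_l1_norm_functional xW; [exact: signed_coef_lin| |exact: signed_coef_bound].
    by rewrite mulr_gt0 ?powR_gt0// mulr_gt0.
  (* [sign_avg_sum] is indexed by natural numbers; [inord] translates to ordinals and needs a
     nonempty index type. *)
  case: m x xW h => [|m] x _ _.
    rewrite big_ord0 -[LHS](sign_avg_cst (N j) 0); congr sign_avg.
    by apply/funext => sg; rewrite big_ord0.
  have := sign_avg_sum (N j) m.+1 (fun k sg => rnorm (signed_coef j sg (x (inord k)))).
  under eq_bigr do under eq_fun do rewrite inord_val.
  move=> <-; congr sign_avg; apply/funext => sg.
  by apply: eq_bigr => k _; rewrite inord_val.
apply: (@le_trans _ _ (rho / d j * (9 * d j `^ Num.max 0 (p^-1 - 2^-1) *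
    (2 * C * d j `^ (1 - p^-1) * W)))).
  by rewrite ler_wpM2l ?divr_ge0 ?(ltW rho0) ?(ltW d0)// ler_wpM2l// mulr_ge0// powR_ge0.
rewrite le_eqVlt; apply/orP; left; apply/eqP.
have -> : d j `^ (- theta) = (d j)^-1 * d j `^ Num.max 0 (p^-1 - 2^-1) * d j `^ (1 - p^-1).
  rewrite -powR_inv1 ?(ltW d0)// -!powRD_gt0//; congr (_ `^ _).
  rewrite /theta; case: (leP 2^-1 p^-1) => h2.
    by rewrite max_r ?subr_ge0//; ring.
  by rewrite max_l ?subr_le0 ?ltW//; ring.
by move: (d j) d0 (_ `^ _) (_ `^ (1 - _)) => y y0 a b; field; rewrite gt_eqF.
Qed.

Lemma block_scale_powR j : d j `^ (- theta) = M%:R `^ (- theta) * (2 `^ (- theta)) ^+ j.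
Proof.
rewrite /block_scale natrM natrX mulrC powRM ?exprn_ge0//; congr (_ * _).
by rewrite -!powR_mulrn ?powR_ge0// -!powRrM mulrC.
Qed.

Lemma K_summing :
  (one_summing_norm K <=
    (18 * rho * C * M%:R `^ (- theta) / (1 - 2 `^ (- theta)))%:E)%E.
Proof.
have theta0 : 0 < theta by rewrite lt_min !invr_gt0 p0 ltr0n.
have r0 : 0 < 2 `^ (- theta) :> R by rewrite powR_gt0.
have r1 : 2 `^ (- theta) < 1 :> R by exact: powR2N_lt1.
apply: one_summing_norm_le.
  rewrite divr_gt0 ?subr_gt0// mulr_gt0 ?powR_gt0 ?ltr0n// mulr_gt0// mulr_gt0//.
move=> m x W xW.
have W0 : 0 <= W by rewrite -lee_fin -xW weak_l1_norm_ge0.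
have lim : (fun J => \sum_(k < m) rnorm (\sum_(j < J) Kblock (x k) j)) @ \oo -->
    \sum_(k < m) rnorm (K (x k)).
  apply: cvg_big => [|k _]; last by apply: cvg_rnorm; exact: K_lim.
  exact: add_continuous.
apply: (ler_cvg_to lim (@cvg_cst _ _ _ _ _)); apply: nearW => J.
apply: (@le_trans _ _ (\sum_(j < J) \sum_(k < m) rnorm (Kblock (x k) j))).
  rewrite exchange_big/=; apply: ler_sum => k _; exact: ler_rnorm_sum.
apply: (le_trans (ler_sum _ (fun (j : 'I_J) _ => Kblock_summing j xW))).
set r := 2 `^ (- theta) in r0 r1 *.
rewrite (eq_bigr (fun j : 'I_J => 18 * rho * C * M%:R `^ (- theta) * W * r ^+ j));
  last by move=> j _; rewrite block_scale_powR -/r; ring.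
rewrite -mulr_sumr.
have -> : \sum_(j < J) r ^+ j = (1 - r ^+ J) / (1 - r).
  elim: J => [|J IH]; first by rewrite big_ord0 expr0 subrr mul0r.
  by rewrite big_ord_recr/= IH exprS; field; rewrite gt_eqF// subr_gt0.
rewrite [leRHS](_ : _ = 18 * rho * C * M%:R `^ (- theta) * W * (1 - r)^-1); last first.
  by ring.
rewrite ler_wpM2l ?mulr_ge0 ?powR_ge0 ?(ltW rho0) ?(ltW C0)//.
by rewrite ler_piMl ?invr_ge0 ?subr_ge0 ?(ltW r1)// gerBl exprn_ge0// ltW.
Qed.

End Limit.

End BlockOperator.

(** * Lebesgue spaces *)

Section LpBasics.
Context d (T : measurableType d) (R : realType).
Variables (mu : {finite_measure set T -> \bar R}) (p : R) (p1 : 1 <= p).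
Local Notation X := (Lp mu p1).
Local Notation LpF := (LpFun mu p1).

Let p0 : 0 < p. Proof. exact: lt_le_trans ltr01 p1. Qed.

Lemma measurable_rnorm_powR (f : T -> R[i]) : cmeasurable f ->
  measurable_fun [set: T] (fun t => (rnorm (f t) `^ p)%:E).
Proof.
move=> mf; apply/measurable_EFinP.
apply: (@measurableT_comp _ _ _ _ _ _ (@powR R ^~ p)) => //.
exact: measurable_rnorm.
Qed.

Lemma cLnorm_powR (f : T -> R[i]) :
  (cLnorm mu p f `^ p = \int[mu]_t (rnorm (f t) `^ p)%:E)%E.
Proof.
rewrite cLnormE// -poweRrM mulVf ?gt_eqF// poweRe1//.
by apply: integral_ge0 => t _; rewrite lee_fin powR_ge0.
Qed.

Lemma rnorm_toLp_powR (f : LpF) :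
  ((rnorm (toLp f) `^ p)%:E = \int[mu]_t (rnorm (f t) `^ p)%:E)%E.
Proof.
rewrite -cLnorm_powR /rnorm normr_toLp/= -poweR_EFin fineK//.
by rewrite ge0_fin_numE ?cLnorm_ge0// cLnorm_lty.
Qed.

Lemma cLfun_integral (f : T -> R[i]) : cmeasurable f ->
  (\int[mu]_t (rnorm (f t) `^ p)%:E < +oo)%E -> f \in cLfun mu p.
Proof.
move=> mf fi; apply/cLfunP; split => //.
by rewrite cLnormE; apply: poweR_lty.
Qed.

Lemma rnorm_toLp_le_ae (f g : LpF) :
  (\forall t \ae mu, rnorm (f t) <= rnorm (g t)) -> rnorm (toLp f) <= rnorm (toLp g).
Proof.
move=> fg; rewrite /rnorm !normr_toLp/=; apply: fine_le.
- by rewrite ge0_fin_numE ?cLnorm_ge0// cLnorm_lty.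
- by rewrite ge0_fin_numE ?cLnorm_ge0// cLnorm_lty.
- by apply: ler_cLnorm => //; exact: lpfun_measurable.
Qed.

Lemma rnorm_toLp_le (f g : LpF) :
  (forall t, rnorm (f t) <= rnorm (g t)) -> rnorm (toLp f) <= rnorm (toLp g).
Proof. by move=> fg; apply: rnorm_toLp_le_ae; exact: aeW. Qed.

Lemma toLpB (f g : LpF) : toLp (f - g) = toLp f - toLp g.
Proof. by rewrite -scaleN1r toLpD toLpZ scaleN1r. Qed.

Lemma toLp_sum (I : Type) (r : seq I) (P : pred I) (f : I -> LpF) :
  toLp (\sum_(i <- r | P i) f i) = \sum_(i <- r | P i) toLp (f i).
Proof. by elim/big_rec2: _ => [|i y x _ <-]; rewrite ?toLp0 ?toLpD. Qed.

Lemma lpfunD (f g : LpF) t : (f + g) t = f t + g t. Proof. by []. Qed.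
Lemma lpfunB (f g : LpF) t : (f - g) t = f t - g t. Proof. by []. Qed.
Lemma lpfunZ (c : R[i]) (f : LpF) t : (c *: f) t = c * f t. Proof. by []. Qed.

Lemma lpfun_sum (I : Type) (r : seq I) (P : pred I) (f : I -> LpF) t :
  (\sum_(i <- r | P i) f i) t = \sum_(i <- r | P i) f i t.
Proof. by elim/big_rec2: _ => [|i y x _ <-]. Qed.

Lemma rnorm_disjointD (f g : LpF) : (forall t, f t = 0 \/ g t = 0) ->
  rnorm (toLp (f + g)) `^ p = rnorm (toLp f) `^ p + rnorm (toLp g) `^ p.
Proof.
move=> fg; apply: EFin_inj; rewrite EFinD !rnorm_toLp_powR -ge0_integralD//.
- apply: eq_integral => t _; rewrite lpfunD -EFinD; congr EFin.
  have r0 : rnorm (0 : R[i]) `^ p = 0 by rewrite rnorm0 powR0 ?gt_eqF.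
  by have [->|->] := fg t; rewrite ?add0r ?addr0 r0 ?add0r ?addr0.
- by move=> t _; rewrite lee_fin powR_ge0.
- by apply: measurable_rnorm_powR; exact: lpfun_measurable.
- by move=> t _; rewrite lee_fin powR_ge0.
- by apply: measurable_rnorm_powR; exact: lpfun_measurable.
Qed.

Lemma rnorm_disjoint_sum n (f : nat -> LpF) :
    (forall i j t, (i < j < n)%N -> f i t = 0 \/ f j t = 0) ->
  rnorm (\sum_(i < n) toLp (f i)) `^ p = \sum_(i < n) rnorm (toLp (f i)) `^ p.
Proof.
elim: n => [|n IH] fd; first by rewrite !big_ord0 rnorm0 powR0 ?gt_eqF.
rewrite big_ord_recr [RHS]big_ord_recr/= -IH; last first.
  by move=> i j t /andP[ij jn]; apply: fd; rewrite ij ltnW.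
rewrite -toLp_sum -toLpD rnorm_disjointD// => t; rewrite lpfun_sum.
have [fn|fn] := eqVneq (f n t) 0; [by right|left].
rewrite big1// => i _; have [|//|f0] := fd i n t; first by rewrite ltn_ord ltnSn.
by rewrite f0 eqxx in fn.
Qed.

Section Indicator.
Variable A : set T.
Hypothesis mA : measurable A.

Definition cindic (t : T) : R[i] := (\1_A t : R)%:C.

Lemma cindic_in : cindic \in cLfun mu p.
Proof.
apply: cLfun_integral.
  by split; [exact: measurable_indic|exact: measurable_cst].
apply: (@le_lt_trans _ _ (\int[mu]_(t in setT) (cst 1%:E) t)%E); last first.
  by rewrite integral_cst// mul1e -ge0_fin_numE// fin_num_measure.
apply: ge0_le_integral => //.
- by move=> t _; rewrite lee_fin powR_ge0.
- apply: measurable_rnorm_powR.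
  by split; [exact: measurable_indic|exact: measurable_cst].
- move=> t _; rewrite lee_fin rnorm_real ger0_norm// indicE.
  by case: (t \in A); rewrite ?powR1 ?powR0// gt_eqF.
Qed.

Definition lpindic : LpF := MkLpFun p1 cindic_in.

Lemma rnorm_lpindic : rnorm (toLp lpindic) `^ p = fine (mu A).
Proof.
apply: EFin_inj; rewrite rnorm_toLp_powR fineK ?fin_num_measure//.
have := integral_indic mu measurableT mA; rewrite setIT => <-.
apply: eq_integral => t _.
rewrite rnorm_real ger0_norm// indicE.
by case: (t \in A); rewrite ?powR1 ?powR0// gt_eqF.
Qed.

End Indicator.

End LpBasics.

(** * Completeness of Lp *)

Section LpComplete.
Context d (T : measurableType d) (R : realType).
Variables (mu : {finite_measure set T -> \bar R}) (p : R) (p1 : 1 <= p).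
Local Notation X := (Lp mu p1).
Local Notation LpF := (LpFun mu p1).

Let p0 : 0 < p. Proof. exact: lt_le_trans ltr01 p1. Qed.

Lemma lpfun_abs_in (f : LpF) : (fun t => (rnorm (f t))%:C) \in cLfun mu p.
Proof.
have mf := lpfun_measurable f.
have mf' : cmeasurable (fun t => (rnorm (f t))%:C).
  by split; [exact: measurable_rnorm|exact: measurable_cst].
apply/cLfunP; split => //.
apply: le_lt_trans (cLnorm_lty f); apply: ler_cLnorm => //.
by apply: aeW => t; rewrite rnorm_real ger0_norm ?rnorm_ge0.
Qed.

Definition lpfun_abs (f : LpF) : LpF := MkLpFun p1 (lpfun_abs_in f).

Lemma rnorm_lpfun_abs (f : LpF) : rnorm (toLp (lpfun_abs f)) = rnorm (toLp f).
Proof.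
by apply/eqP; rewrite eq_le; apply/andP; split; apply: rnorm_toLp_le => t;
  rewrite /= rnorm_real ger0_norm ?rnorm_ge0.
Qed.

Section Series.
Variable f : nat -> LpF.

Definition abs_sum N M t : R := \sum_(i < M) rnorm (f (N + i) t).

Lemma abs_sum_ge0 N M t : 0 <= abs_sum N M t.
Proof. by apply: sumr_ge0 => i _; exact: rnorm_ge0. Qed.

Lemma abs_sum_nd N t : nondecreasing_seq (fun M => abs_sum N M t).
Proof.
apply/nondecreasing_seqP => M; rewrite /abs_sum big_ord_recr/= lerDl.
exact: rnorm_ge0.
Qed.

Lemma abs_sum_add N M t : abs_sum 0 (N + M) t = abs_sum 0 N t + abs_sum N M t.
Proof. by rewrite /abs_sum big_split_ord/=. Qed.

Lemma measurable_abs_sum N M : measurable_fun setT (abs_sum N M).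
Proof.
apply: measurable_sum => i; apply: measurable_rnorm; exact: lpfun_measurable.
Qed.

(** Minkowski's inequality, read off from the norm of [Lp] applied to the moduli of the
    functions. *)
Lemma integral_abs_sum N M :
  (\int[mu]_t (abs_sum N M t `^ p)%:E <=
    ((\sum_(i < M) rnorm (toLp (f (N + i)))) `^ p)%:E)%E.
Proof.
pose g : LpF := \sum_(i < M) lpfun_abs (f (N + i)).
have gE t : g t = (abs_sum N M t)%:C.
  by rewrite /g lpfun_sum /abs_sum rmorph_sum.
have -> : (\int[mu]_t (abs_sum N M t `^ p)%:E = (rnorm (toLp g) `^ p)%:E)%E.
  rewrite rnorm_toLp_powR; apply: eq_integral => t _.
  by rewrite gE rnorm_real ger0_norm// abs_sum_ge0.
rewrite lee_fin; apply: ge0_ler_powR; rewrite ?nnegrE ?rnorm_ge0 ?(ltW p0)//.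
  by apply: sumr_ge0 => i _; exact: rnorm_ge0.
rewrite /g toLp_sum; apply: le_trans (ler_rnorm_sum _ _ _) _.
by apply: ler_sum => i _; rewrite rnorm_lpfun_abs.
Qed.

(** The p-th power of the tail of the series of moduli. As an extended real it exists everywhere, is
    monotone in M and suits monotone convergence. *)
Definition abs_tail N t : \bar R := limn (fun M => (abs_sum N M t `^ p)%:E).

Let powR_abs_sum_nd N t : nondecreasing_seq (fun M => (abs_sum N M t `^ p)%:E).
Proof.
move=> m n mn; rewrite lee_fin; apply: ge0_ler_powR;
  rewrite ?nnegrE ?abs_sum_ge0 ?(ltW p0)//.
exact: abs_sum_nd.
Qed.

Let measurable_powR_abs_sum N M :
  measurable_fun setT (fun t => (abs_sum N M t `^ p)%:E).
Proof.
apply/measurable_EFinP.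
apply: (@measurableT_comp _ _ _ _ _ _ (@powR R ^~ p)) => //.
exact: measurable_abs_sum.
Qed.

Lemma integral_abs_tail N (tau : R) :
  (forall M, \sum_(i < M) rnorm (toLp (f (N + i))) <= tau) ->
  (\int[mu]_t abs_tail N t <= (tau `^ p)%:E)%E.
Proof.
move=> ht; rewrite /abs_tail monotone_convergence//; last first.
  by move=> n t _; rewrite lee_fin powR_ge0.
apply: lime_le.
  apply: ereal_nondecreasing_is_cvgn => m n mn.
  apply: ge0_le_integral => //; first by move=> t _; rewrite lee_fin powR_ge0.
  by move=> t _; exact: powR_abs_sum_nd.
apply: nearW => M; apply: le_trans (integral_abs_sum N M) _.
rewrite lee_fin; apply: ge0_ler_powR; rewrite ?nnegrE ?(ltW p0)//.
- by apply: sumr_ge0 => i _; exact: rnorm_ge0.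
- by apply: le_trans (ht 0%N); rewrite big_ord0.
Qed.

Lemma measurable_abs_tail N : measurable_fun setT (abs_tail N).
Proof.
apply: (emeasurable_fun_cvg (fun M t => (abs_sum N M t `^ p)%:E)) => // t _.
exact: ereal_nondecreasing_is_cvgn.
Qed.

Lemma abs_sum_le_tail N M t : ((abs_sum N M t `^ p)%:E <= abs_tail N t)%E.
Proof.
rewrite /abs_tail (cvg_lim _ (ereal_nondecreasing_cvgn (powR_abs_sum_nd N t)))//.
by apply: ereal_sup_ubound; exists M.
Qed.

Definition summable_set : set T := \bigcup_k \bigcap_M
  (abs_sum 0 M @^-1` [set x | x <= k%:R]).

Lemma measurable_summable_set : measurable summable_set.
Proof.
apply: bigcup_measurable => k _; apply: bigcapT_measurable => M.
rewrite -[X in measurable X]setTI; apply: measurable_abs_sum => //.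
rewrite (_ : [set x | x <= k%:R] = `]-oo, k%:R]%classic); first exact: measurable_itv.
by apply/seteqP; split => x /=; rewrite in_itv.
Qed.

Lemma abs_sum_bounded N t (l : R) : abs_tail N t = l%:E ->
  forall M, abs_sum N M t <= l `^ p^-1.
Proof.
move=> tl M; have := abs_sum_le_tail N M t; rewrite tl lee_fin => h.
have -> : abs_sum N M t = (abs_sum N M t `^ p) `^ p^-1.
  by rewrite -powRrM mulfV ?gt_eqF// powRr1// abs_sum_ge0.
by apply: ge0_ler_powR; rewrite ?nnegrE ?invr_ge0 ?powR_ge0 ?(ltW p0)//;
  apply: le_trans h; rewrite powR_ge0.
Qed.

Lemma summable_setP N t (l : R) : abs_tail N t = l%:E -> summable_set t.
Proof.
move=> /abs_sum_bounded h.
pose B := abs_sum 0 N t + l `^ p^-1.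
exists (Num.truncn B).+1 => // M _ /=.
apply: le_trans (ltW (truncnS_gt B)).
apply: (@le_trans _ _ (abs_sum 0 (N + M) t)); first by apply: abs_sum_nd; rewrite leq_addl.
by rewrite abs_sum_add lerD2l.
Qed.

Definition psumf N t : R[i] := \sum_(n < N) f n t.

Lemma psumf_diff N M t : rnorm (psumf (N + M) t - psumf N t) <= abs_sum N M t.
Proof.
rewrite /psumf big_split_ord/= [_ + _ - _]addrAC subrr add0r.
exact: ler_rnorm_sum.
Qed.

Lemma psumf_cvg t : summable_set t -> exists l : R[i], forall e : R, 0 < e ->
  exists N, forall k, (N <= k)%N -> rnorm (l - psumf k t) < e.
Proof.
move=> [k _ hk]; apply: complex_cauchy_cvg => e e0.
have : cvgn (fun M => abs_sum 0 M t).
  apply: nondecreasing_is_cvgn; first exact: abs_sum_nd.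
  by exists k%:R => _ [M _ <-]; exact: (hk M I).
move=> /cvg_ex[l] /cvgrPdist_lt /(_ (e / 4)) [|N _ hN]; first by rewrite divr_gt0.
have tail M : abs_sum N M t < e / 2.
  have := hN N (leqnn N); have := hN (N + M)%N (leq_addr _ _) => /=.
  rewrite abs_sum_add; set a := abs_sum 0 N t; set b := abs_sum N M t.
  by rewrite !ltr_norml => /andP[h1 h2] /andP[h3 h4]; lra.
exists N => j i Nj Ni.
have h m : (N <= m)%N -> rnorm (psumf m t - psumf N t) < e / 2.
  by move=> /subnKC <-; apply: le_lt_trans (psumf_diff _ _ _) _.
rewrite -(subrKA (psumf N t)); apply: le_lt_trans (ler_rnormD _ _) _.
rewrite (_ : e = e / 2 + e / 2); last by field.
by apply: ltrD; [exact: h|rewrite rnormB; exact: h].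
Qed.

(** F is the pointwise sum on the measurable set of absolute convergence and 0 elsewhere. The bound
    holds at every point, since the tail is infinite off that set. *)
Lemma sumf_exists : exists F : T -> R[i], cmeasurable F /\
  forall N t, ((rnorm (F t - psumf N t) `^ p)%:E <= abs_tail N t)%E.
Proof.
have /choice[F hF] : forall t, exists l : R[i],
    (summable_set t -> forall e : R, 0 < e ->
      exists N, forall k, (N <= k)%N -> rnorm (l - psumf k t) < e) /\
    (~ summable_set t -> l = 0).
  move=> t; have [St|St] := pselect (summable_set t); last by exists 0.
  by have [l hl] := psumf_cvg St; exists l.
have meas (g : R[i] -> R) : (forall z, `|g z| <= rnorm z) ->
    (forall z w, g (z - w) = g z - g w) -> g 0 = 0 ->
    (forall N, measurable_fun setT (fun t => g (psumf N t))) ->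
    measurable_fun setT (g \o F).
  move=> g1 g2 g3 mg.
  apply: (measurable_fun_cvg
    (h := fun N t => g (psumf N t) * (\1_summable_set t : R))) => [N|t _].
    apply: measurable_funM => //; exact: measurable_indic measurable_summable_set.
  have [h1 h2] := hF t; rewrite indicE; have [St|St] := boolP (t \in summable_set).
    rewrite inE in St; under eq_fun do rewrite mulr1.
    apply/cvgrPdist_lt => e e0; have [N hN] := h1 St e e0.
    exists N => // k Nk /=; rewrite -g2; apply: le_lt_trans (g1 _) _; exact: hN.
  under eq_fun do rewrite mulr0.
  rewrite /= h2 ?g3; first exact: cvg_cst.
  by move=> St'; move: St; rewrite notin_setE.
exists F; split.
  split; apply: meas; rewrite ?raddf0//.
  - exact: normr_Re_le.
  - by move=> z w; rewrite raddfB.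
  - move=> N; rewrite (_ : (fun t => _) = (fun t => \sum_(n < N) complex.Re (f n t))).
      by apply: measurable_sum => n; have [] := lpfun_measurable (f n).
    by apply/funext => t; rewrite /psumf raddf_sum.
  - exact: normr_Im_le.
  - by move=> z w; rewrite raddfB.
  - move=> N; rewrite (_ : (fun t => _) = (fun t => \sum_(n < N) complex.Im (f n t))).
      by apply: measurable_sum => n; have [] := lpfun_measurable (f n).
    by apply/funext => t; rewrite /psumf raddf_sum.
move=> N t; case E : (abs_tail N t) => [l| |].
- have St := summable_setP E; have [/(_ St) h _] := hF t.
  have l0 : 0 <= l.
    have := abs_sum_le_tail N 0 t; rewrite E lee_fin; apply: le_trans.
    exact: powR_ge0.
  rewrite lee_fin.
  have -> : l = (l `^ p^-1) `^ p by rewrite -powRrM mulVf ?gt_eqF// powRr1.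
  apply: ge0_ler_powR; rewrite ?nnegrE ?rnorm_ge0 ?powR_ge0 ?(ltW p0)//.
  apply/ler_addgt0Pr => e e0; have [M hM] := h e e0.
  rewrite -(subrKA (psumf (N + M) t)); apply: le_trans (ler_rnormD _ _) _.
  rewrite addrC; apply: lerD; last by apply/ltW/hM; rewrite leq_addl.
  by apply: le_trans (psumf_diff _ _ _) _; exact: abs_sum_bounded.
- by rewrite leey.
- by have := abs_sum_le_tail N 0 t; rewrite E.
Qed.

End Series.

(** Riesz-Fischer: the p-norm of the remainder is bounded by the tail [tau] of the series of norms,
    which tends to 0. *)
Lemma Lp_abs_complete : @abs_complete R X.
Proof.
move=> g [B gB]; pose f n : LpF := ofLp (g n).
have fg n : toLp (f n) = g n by exact: ofLpK.
have [F [mF hF]] := sumf_exists f.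
pose P N := \sum_(n < N) rnorm (g n).
have Pnd : nondecreasing_seq P.
  apply/nondecreasing_seqP => N; rewrite /P big_ord_recr/= lerDl; exact: rnorm_ge0.
have Pcvg : cvgn P.
  by apply: nondecreasing_is_cvgn => //; exists B => _ [N _ <-]; exact: gB.
pose tau (N : nat) : R := limn P - P N.
have htau (N M : nat) : \sum_(i < M) rnorm (toLp (f (N + i))) <= tau N.
  rewrite /tau lerBrDl; apply: le_trans (nondecreasing_cvgn_le Pnd Pcvg (N + M)).
  by rewrite /P big_split_ord/= lerD2l; apply: ler_sum => i _; rewrite fg.
have tau0 N : 0 <= tau N by apply: le_trans (htau N 0%N); rewrite big_ord0.
have int_le (G : T -> R[i]) N : cmeasurable G ->
    (forall t, G t = F t - psumf f N t) ->
    (\int[mu]_t (rnorm (G t) `^ p)%:E <= (tau N `^ p)%:E)%E.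
  move=> mG GE; apply: le_trans (integral_abs_tail (htau N)).
  apply: ge0_le_integral => //.
  - by move=> t _; rewrite lee_fin powR_ge0.
  - exact: measurable_rnorm_powR.
  - exact: measurable_abs_tail.
  - by move=> t _; rewrite GE.
have Fin : F \in cLfun mu p.
  apply: cLfun_integral => //; apply: le_lt_trans (int_le F 0%N mF _) _.
    by move=> t; rewrite /psumf big_ord0 subr0.
  by rewrite ltry.
pose Ff : LpF := MkLpFun p1 Fin.
exists (toLp Ff); apply/cvg_rnormP => e e0.
have /cvgrPdist_lt /(_ e e0) [N _ hN] := Pcvg.
exists N => n Nn.
have -> : toLp Ff - \sum_(i < n) g i = toLp (Ff - \sum_(i < n) f i).
  by rewrite toLpB toLp_sum; congr (_ - _); apply: eq_bigr => i _; rewrite fg.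
apply: (@le_lt_trans _ _ (tau n)).
  set h := toLp _.
  have : rnorm h `^ p <= tau n `^ p.
    rewrite -lee_fin /h rnorm_toLp_powR; apply: int_le; first exact: lpfun_measurable.
    by move=> t; rewrite lpfunB lpfun_sum.
  have rootK (x : R) : 0 <= x -> x = (x `^ p) `^ p^-1.
    by move=> x0; rewrite -powRrM mulfV ?gt_eqF// powRr1.
  move=> hp; rewrite (rootK (rnorm h)) ?rnorm_ge0// (rootK (tau n))//.
  by apply: ge0_ler_powR; rewrite ?nnegrE ?powR_ge0 ?invr_ge0 ?(ltW p0).
have := hN n Nn; rewrite /= ger0_norm// -/(tau n); exact: tau0.
Qed.

End LpComplete.

Section SubspaceClosure.
Context {R : realType} {X : normedModType R[i]}.
Variable S : set X.
Hypothesis S0 : S 0.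
Hypothesis S_lin : forall (c : R[i]) x y, S x -> S y -> S (c *: x + y).

Definition approx_by (x : X) := forall e : R, 0 < e ->
  exists y, S y /\ rnorm (x - y) < e.

Lemma approx_by_sub x : S x -> approx_by x.
Proof. by move=> Sx e e0; exists x; rewrite subrr rnorm0. Qed.

Lemma approx_by_limit x :
  (forall e : R, 0 < e -> exists y, approx_by y /\ rnorm (x - y) < e) -> approx_by x.
Proof.
move=> h e e0; have e2 : 0 < e / 2 by rewrite divr_gt0.
have [y [Sy xy]] := h _ e2; have [z [Sz yz]] := Sy _ e2; exists z; split => //.
rewrite -(subrKA y); apply: le_lt_trans (ler_rnormD _ _) _.
by rewrite (_ : e = e / 2 + e / 2); [exact: ltrD|field].
Qed.

Lemma approx_by_lin (c : R[i]) x y :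
  approx_by x -> approx_by y -> approx_by (c *: x + y).
Proof.
move=> hx hy e e0.
have c1 : 0 < rnorm c + 1 by rewrite ltr_wpDl ?rnorm_ge0.
have [|x' [Sx' xx']] := hx (e / 2 / (rnorm c + 1)); first by rewrite !divr_gt0.
have [|y' [Sy' yy']] := hy (e / 2); first by rewrite divr_gt0.
exists (c *: x' + y'); split; first exact: S_lin.
rewrite opprD addrACA -scalerBr; apply: le_lt_trans (ler_rnormD _ _) _.
rewrite (_ : e = e / 2 + e / 2); last by field.
apply: ler_ltD => //; rewrite rnormZ.
apply: (@le_trans _ _ ((rnorm c + 1) * rnorm (x - x'))).
  by rewrite ler_wpM2r ?rnorm_ge0// lerDl.
by rewrite mulrC -ler_pdivlMr// ltW.
Qed.

Lemma approx_by0 : approx_by 0. Proof. exact: approx_by_sub. Qed.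

Lemma approx_byD x y : approx_by x -> approx_by y -> approx_by (x + y).
Proof. by move=> hx hy; have := approx_by_lin 1 hx hy; rewrite scale1r. Qed.

Lemma approx_byZ (c : R[i]) x : approx_by x -> approx_by (c *: x).
Proof. by move=> hx; have := approx_by_lin c hx approx_by0; rewrite addr0. Qed.

Lemma approx_byB x y : approx_by x -> approx_by y -> approx_by (x - y).
Proof.
by move=> hx hy; rewrite -scaleN1r; apply: approx_byD => //; exact: approx_byZ.
Qed.

Lemma approx_by_sum (I : Type) (r : seq I) (P : pred I) (F : I -> X) :
  (forall i, P i -> approx_by (F i)) -> approx_by (\sum_(i <- r | P i) F i).
Proof.
by move=> hF; elim/big_ind: _ => //; [exact: approx_by0|exact: approx_byD].
Qed.

End SubspaceClosure.

(** * Density in Lp from a generating pi-system *)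

Section LpDensity.
Context d (T : measurableType d) (R : realType).
Variables (mu : {finite_measure set T -> \bar R}) (p : R) (p1 : 1 <= p).
Local Notation X := (Lp mu p1).
Local Notation LpF := (LpFun mu p1).
Local Notation ind mA := (toLp (lpindic mu p1 mA)).

Let p0 : 0 < p. Proof. exact: lt_le_trans ltr01 p1. Qed.

Lemma rnorm_lt_of_powR (x : X) (e : R) : 0 < e -> rnorm x `^ p < e `^ p -> rnorm x < e.
Proof.
move=> e0; apply: contraTT; rewrite -!leNgt => ex.
by apply: ge0_ler_powR; rewrite ?nnegrE ?(ltW p0) ?(ltW e0) ?rnorm_ge0.
Qed.

Lemma toLp_ext (f g : LpF) : (forall t, f t = g t) -> toLp f = toLp g.
Proof. by move=> fg; apply/toLpE; apply: aeW => t _. Qed.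

Lemma rnorm_indB A B (mA : measurable A) (mB : measurable B) : B `<=` A ->
  rnorm (ind mA - ind mB) `^ p = fine (mu A) - fine (mu B).
Proof.
move=> BA.
have mAB : measurable (A `\` B) by exact: measurableD.
have -> : ind mA - ind mB = ind mAB.
  rewrite -toLpB; apply: toLp_ext => t; rewrite lpfunB /= /cindic -rmorphB; congr (_%:C).
  rewrite !indicE; have [Bt|Bt] := boolP (t \in B).
    have At : t \in A by move: Bt; rewrite !inE => /BA.
    rewrite At (_ : (t \in A `\` B) = false) ?subrr//.
    by apply/negbTE; rewrite notin_setE => -[_]; rewrite inE in Bt.
  rewrite subr0; congr (_%:R); congr nat_of_bool; apply/idP/idP; rewrite !inE.
    by move=> At; split => //; rewrite notin_setE in Bt.
  by case.
rewrite rnorm_lpindic measureD// ?ltey_eq ?fin_num_measure//.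
rewrite setIidr// fineB ?fin_num_measure//.
Qed.

Section PiSystem.
Variables (G : set_system T) (S : set X).
Hypothesis GE : @measurable _ T = <<s G >>.
Hypothesis GI : setI_closed G.
Hypothesis S0 : S 0.
Hypothesis S_lin : forall (c : R[i]) x y, S x -> S y -> S (c *: x + y).
Hypothesis S_setT : approx_by S (ind (@measurableT _ T)).
Hypothesis S_G : forall A (mA : measurable A), G A -> approx_by S (ind mA).

(** Dynkin's theorem: complements are differences from the indicator of the whole space, and a
    countable disjoint union is the Lp limit of its finite subunions by continuity of the finite
    measure. *)
Lemma approx_indic A (mA : measurable A) : approx_by S (ind mA).
Proof.
(* The indicator carries a measurability proof, so the Dynkin property quantifies over such
   proofs. *)
pose P (A : set T) := forall mA : measurable A, approx_by S (ind mA).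
suff : P A by exact.
apply: (@dynkin_induction _ _ G P GE GI) => [|B GB|B mB PB|F mF tF PF|].
- move=> mT; rewrite (_ : ind mT = ind (@measurableT _ T))//.
  exact: toLp_ext.
- by move=> mB; exact: S_G.
- move=> mCB.
  have -> : ind mCB = ind (@measurableT _ T) - ind mB.
    rewrite -toLpB; apply: toLp_ext => t; rewrite lpfunB /= /cindic -rmorphB.
    rewrite !indicE in_setT in_setC; case: (t \in B) => /=.
      by rewrite subrr.
    by rewrite subr0.
  by apply: approx_byB.
- move=> mUF; apply: approx_by_limit => e e0.
  pose U n := \bigcup_(i < n) F i.
  have mU n : measurable (U n) by exact: bigcup_measurable.
  have SU n : approx_by S (ind (mU n)).
    elim: n => [|n IH].
      rewrite (_ : ind (mU 0%N) = 0); first exact: approx_by0.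
      rewrite -toLp0; apply: toLp_ext => t; rewrite /= /cindic indicE.
      by rewrite (_ : t \in U 0%N = false)//; apply/negbTE; rewrite notin_setE => -[].
    rewrite (_ : ind (mU n.+1) = ind (mU n) + ind (mF n)).
      by apply: approx_byD => //; exact: PF.
    rewrite -toLpD; apply: toLp_ext => t; rewrite lpfunD /= /cindic -rmorphD; congr (_%:C).
    rewrite !indicE -natrD; congr (_%:R).
    have [Ft|Ft] := boolP (t \in F n).
      rewrite inE in Ft.
      rewrite (_ : t \in U n = false); last first.
        apply/negbTE; rewrite notin_setE => -[i /= iN Fi].
        have in_ : i = n by apply: (tF i n I I); exists t.
        by rewrite in_ ltnn in iN.
      by rewrite (_ : t \in U n.+1)// inE; exists n => //=.
    rewrite addn0; congr nat_of_bool; apply/idP/idP; rewrite !inE.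
      move=> [i /=]; rewrite ltnS leq_eqVlt => /predU1P[->|iN] Fi; last by exists i.
      by rewrite notin_setE in Ft.
    by move=> [i /= iN Fi]; exists i => //=; exact: ltnW.
  have UE : \bigcup_n U n = \bigcup_k F k.
    apply/seteqP; split => [t [n _ [i _ Fi]]|t [i _ Fi]]; first by exists i.
    by exists i.+1 => //; exists i => /=.
  have Und : nondecreasing_seq U.
    by move=> m n mn; apply/subsetPset => t [i /= im Fi]; exists i => //=; exact: leq_trans mn.
  have : mu \o U @ \oo --> (fine (mu (\bigcup_k F k)))%:E.
    rewrite fineK ?fin_num_measure// -UE; apply: nondecreasing_cvg_mu => //.
    by rewrite UE.
  move=> /fine_cvgP[_].
  move=> /cvgrPdist_lt /(_ (e `^ p)) [|N _ hN]; first by rewrite powR_gt0.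
  exists (ind (mU N)); split => //; apply: rnorm_lt_of_powR => //.
  rewrite rnorm_indB; last by move=> t [i _ Fi]; exists i.
  exact: le_lt_trans (ler_norm _) (hN N (leqnn N)).
- by rewrite -GE.
Qed.

(** After division by a, x^p <= x on [0, 1]. It bounds the norm of a difference by a difference of
    norms for functions 0 <= h <= f. *)
Lemma powR_superadd (a b : R) : 0 <= b -> b <= a -> (a - b) `^ p + b `^ p <= a `^ p.
Proof.
move=> b0 ba; have a0 : 0 <= a by apply: le_trans ba.
have [a00|an0] := eqVneq a 0.
  have b00 : b = 0 by apply/eqP; rewrite eq_le b0 andbT -a00.
  by rewrite a00 b00 subrr powR0 ?gt_eqF// addr0.
have ap : 0 < a by rewrite lt_neqAle eq_sym an0.
have scale x : 0 <= x -> x <= a -> x `^ p <= a `^ p * (x / a).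
  move=> x0 xa; rewrite -[in leLHS](divfK an0 x) powRM ?divr_ge0// mulrC.
  rewrite ler_wpM2l ?powR_ge0//.
  have [->|xn0] := eqVneq (x / a) 0; first by rewrite powR0 ?gt_eqF.
  apply: ge1r_powR; rewrite ?p1// lt_neqAle eq_sym xn0 divr_ge0//=.
  by rewrite ler_pdivrMr// mul1r.
have h1 : a - b <= a by rewrite gerBl.
have h0 : 0 <= a - b by rewrite subr_ge0.
apply: (le_trans (lerD (scale _ h0 h1) (scale _ b0 ba))).
by rewrite -mulrDr -mulrDl subrK divff// mulr1.
Qed.

Import HBNNSimple.

Lemma approx_nnsfun (h : {nnsfun T >-> R}) (g : LpF) : (forall t, g t = (h t)%:C) ->
  approx_by S (toLp g).
Proof.
move=> gh.
pose s := finmap.enum_fset (fset_set (range h)).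
have mh y : measurable (h @^-1` [set y]).
  exact: measurable_sfunP.
have -> : toLp g = \sum_(y <- s) y%:C *: ind (mh y).
  pose F y := y%:C *: lpindic mu p1 (mh y).
  have -> : \sum_(y <- s) y%:C *: ind (mh y) = \sum_(y <- s) toLp (F y).
    by apply: eq_bigr => y _; rewrite /F toLpZ.
  rewrite -toLp_sum; apply: toLp_ext => t; rewrite gh lpfun_sum fimfunE.
  rewrite fsbig_finite//= rmorph_sum; apply: eq_bigr => y _.
  by rewrite /F rmorphM.
apply: (approx_by_sum S0 S_lin) => y _; apply: (approx_byZ S0 S_lin).
exact: (approx_indic (mh y)).
Qed.

(** For simple functions h n increasing to f, monotone convergence gives convergence of the p-th
    powers of the norms, and [powR_superadd] upgrades it to convergence in norm. *)
Lemma approx_nonneg (f : T -> R) (g : LpF) : (forall t, 0 <= f t) ->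
  (forall t, g t = (f t)%:C) -> approx_by S (toLp g).
Proof.
move=> f0 gf.
have mf : measurable_fun setT f.
  have [+ _] := lpfun_measurable g; congr measurable_fun.
  by apply/funext => t /=; rewrite gf.
have mEf : measurable_fun setT (EFin \o f) by exact/measurable_EFinP.
pose h n : T -> R := nnsfun_approx measurableT mEf n.
have h0 n t : 0 <= h n t by [].
have hnd t : nondecreasing_seq (fun n => h n t).
  by move=> m n mn; exact/lefP/nd_nnsfun_approx.
have hcvg t : (fun n => (h n t)%:E) @ \oo --> (f t)%:E.
  exact: (@cvg_nnsfun_approx _ _ _ _ measurableT _ mEf (fun x _ => f0 x) t I).
have hle n t : h n t <= f t.
  have nd : nondecreasing_seq (fun n => (h n t)%:E).
    by move=> m k mk; rewrite lee_fin; exact: hnd.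
  have supE : ereal_sup (range (fun n => (h n t)%:E)) = (f t)%:E.
    exact: (cvg_unique _ (ereal_nondecreasing_cvgn nd) (hcvg t)).
  by rewrite -lee_fin -supE; apply: ereal_sup_ubound; exists n.
have mh n : measurable_fun setT (h n) by exact: measurable_funP.
have mhC n : cmeasurable (fun t => (h n t)%:C).
  by split; [exact: mh|exact: measurable_cst].
have hin n : (fun t => (h n t)%:C) \in cLfun mu p.
  apply/cLfunP; split => //; apply: le_lt_trans (cLnorm_lty g).
  apply: ler_cLnorm => //; first exact: lpfun_measurable.
  by apply: aeW => t; rewrite gf !rnorm_real !ger0_norm.
pose H n : LpF := MkLpFun p1 (hin n).
have conv : (fun n => rnorm (toLp (H n)) `^ p) @ \oo --> rnorm (toLp g) `^ p.
  have : (fun n => (\int[mu]_t (h n t `^ p)%:E)%E) @ \oo --> (\int[mu]_t (f t `^ p)%:E)%E.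
    rewrite (_ : (\int[mu]_t (f t `^ p)%:E)%E =
        (\int[mu]_t limn (fun n => (h n t `^ p)%:E))%E); last first.
      apply: eq_integral => t _; apply/esym/cvg_lim => //.
      apply/fine_cvgP; split; first exact: nearW.
      (* Continuity of the power comes from its derivative, available at positive points; where f
         vanishes, so does every h n. *)
      have [ft0|ft0] := eqVneq (f t) 0.
        rewrite (_ : fine \o _ = fun=> f t `^ p); first exact: cvg_cst.
        apply/funext => n /=; congr (_ `^ _); apply/eqP.
        by rewrite eq_le hle ft0 h0.
      have ftp : 0 < f t by rewrite lt_neqAle eq_sym ft0 f0.
      have cp : {for f t, continuous (fun u : R => u `^ p)}.
        apply: differentiable_continuous; apply/derivable1_diffP.
        by have [] := is_derive1_powR p ftp.
      apply: (@continuous_cvg _ _ _ _ _ (fun n => h n t) (fun u : R => u `^ p)) => //.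
      by have /fine_cvgP[] := hcvg t.
    apply: cvg_monotone_convergence => //.
    - move=> n; apply/measurable_EFinP.
      exact: (@measurableT_comp _ _ _ _ _ _ (@powR R ^~ p)).
    - by move=> n t _; rewrite lee_fin powR_ge0.
    - move=> t _ m n mn; rewrite lee_fin; apply: ge0_ler_powR;
        rewrite ?nnegrE ?(ltW p0)//; exact: hnd.
  rewrite (_ : (\int[mu]_t (f t `^ p)%:E)%E = (rnorm (toLp g) `^ p)%:E); last first.
    rewrite rnorm_toLp_powR; apply: eq_integral => t _.
    by rewrite gf rnorm_real ger0_norm.
  rewrite (_ : (fun n => _) = (fun n => (rnorm (toLp (H n)) `^ p)%:E)); last first.
    apply/funext => n; rewrite rnorm_toLp_powR; apply: eq_integral => t _.
    by rewrite rnorm_real ger0_norm.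
  by move=> /fine_cvgP[].
apply: approx_by_limit => e e0.
have /cvgrPdist_lt /(_ (e `^ p)) [|N _ hN] := conv; first by rewrite powR_gt0.
exists (toLp (H N)); split; first exact: (@approx_nnsfun (nnsfun_approx measurableT mEf N)).
apply: rnorm_lt_of_powR => //; apply: le_lt_trans (hN N (leqnn N)).
rewrite -toLpB; apply: le_trans (ler_norm _); rewrite lerBrDr -lee_fin EFinD.
rewrite !rnorm_toLp_powR -ge0_integralD//.
- apply: ge0_le_integral => //.
  + by move=> t _; rewrite -EFinD lee_fin addr_ge0// powR_ge0.
  + apply: emeasurable_funD.
      exact: (measurable_rnorm_powR p (lpfun_measurable (g - H N))).
    exact: (measurable_rnorm_powR p (lpfun_measurable (H N))).
  + exact: (measurable_rnorm_powR p (lpfun_measurable g)).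
  + move=> t _; rewrite -EFinD lee_fin lpfunB /= gf -rmorphB !rnorm_real.
    by rewrite !ger0_norm ?subr_ge0//; exact: powR_superadd.
- by move=> t _; rewrite lee_fin powR_ge0.
- exact: (measurable_rnorm_powR p (lpfun_measurable (g - H N))).
- by move=> t _; rewrite lee_fin powR_ge0.
- exact: (measurable_rnorm_powR p (lpfun_measurable (H N))).
Qed.

Lemma approx_lp (x : X) : approx_by S x.
Proof.
rewrite -[x]ofLpK; set f := ofLp x.
have [mRe mIm] := lpfun_measurable f.
have part (g : T -> R) : measurable_fun setT g ->
    (forall t, `|g t| <= rnorm (f t)) -> (fun t => (g t)%:C) \in cLfun mu p.
  move=> mg gf; have mgC : cmeasurable (fun t => (g t)%:C).
    by split; [exact: mg|exact: measurable_cst].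
  apply/cLfunP; split => //; apply: le_lt_trans (cLnorm_lty f).
  apply: ler_cLnorm => //.
  by apply: aeW => t; rewrite rnorm_real.
have real_part (g : T -> R) (mg : measurable_fun setT g)
    (gf : forall t, `|g t| <= rnorm (f t)) :
    approx_by S (toLp (MkLpFun p1 (part g mg gf))).
  have gp t : `|Num.max (g t) 0| <= rnorm (f t).
    apply: le_trans (gf t); rewrite ger0_norm ?le_max ?lexx ?orbT//.
    by rewrite ge_max ler_norm normr_ge0.
  have gn t : `|Num.max (- g t) 0| <= rnorm (f t).
    apply: le_trans (gf t); rewrite ger0_norm ?le_max ?lexx ?orbT//.
    by rewrite ge_max -normrN ler_norm normr_ge0.
  have mgp : measurable_fun setT (fun t => Num.max (g t) 0).
    exact: measurable_funrpos.
  have mgn : measurable_fun setT (fun t => Num.max (- g t) 0).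
    exact: measurable_funrneg.
  have -> : toLp (MkLpFun p1 (part g mg gf)) =
      toLp (MkLpFun p1 (part _ mgp gp)) - toLp (MkLpFun p1 (part _ mgn gn)).
    rewrite -toLpB; apply: toLp_ext => t; rewrite lpfunB /= -rmorphB; congr (_%:C).
    by rewrite /Num.max; case: ifP; case: ifP; lra.
  apply: (approx_byB S0 S_lin).
    apply: (@approx_nonneg (fun t => Num.max (g t) 0)) => // t.
    by rewrite le_max lexx orbT.
  apply: (@approx_nonneg (fun t => Num.max (- g t) 0)) => // t.
  by rewrite le_max lexx orbT.
have -> : toLp f = toLp (MkLpFun p1 (part _ mRe (fun t => normr_Re_le (f t)))) +
    'i%C *: toLp (MkLpFun p1 (part _ mIm (fun t => normr_Im_le (f t)))).
  rewrite -toLpZ -toLpD; apply: toLp_ext => t.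
  by rewrite lpfunD lpfunZ /= -complexE.
by apply: (approx_byD S_lin); [|apply: (approx_byZ S0 S_lin)]; exact: real_part.
Qed.

End PiSystem.
End LpDensity.

(** * The dyadic tree *)

Section Heap.
Context {A : Type} (root : A) (left right : A -> A).

(** Halving is not structural, hence the fuel, for which [m] suffices. Index 0 returns the root by
    default. *)
Fixpoint heap_rec (fuel m : nat) : A :=
  if fuel is k.+1 then
    if (m <= 1)%N then root
    else if odd m then right (heap_rec k m./2) else left (heap_rec k m./2)
  else root.

Definition heap m := heap_rec m m.

Lemma heap_rec_fuel k l m : (m <= k)%N -> (m <= l)%N -> heap_rec k m = heap_rec l m.
Proof.
elim: k l m => [|k IH] [|l] m //=.
- by rewrite leqn0 => /eqP ->.
- by rewrite leqn0 => _ /eqP ->.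
- move=> mk ml; case: ifP => // m1; rewrite (IH l); [by []|lia|lia].
Qed.

Lemma heapE m : (1 < m)%N ->
  heap m = if odd m then right (heap m./2) else left (heap m./2).
Proof.
move=> m1; rewrite /heap (heap_rec_fuel (leqnn m) (leqnSn m)).
have -> : heap_rec m.+1 m = if odd m then right (heap_rec m m./2)
    else left (heap_rec m m./2) by rewrite /= leqNgt m1.
by rewrite (@heap_rec_fuel m m./2 m./2)//; lia.
Qed.

Lemma heap_double m : (0 < m)%N -> heap m.*2 = left (heap m).
Proof. by move=> m0; rewrite heapE ?odd_double ?doubleK//; lia. Qed.

Lemma heap_doubleS m : (0 < m)%N -> heap m.*2.+1 = right (heap m).
Proof.
move=> m0; rewrite heapE; last by lia.
by rewrite /= odd_double /= uphalf_double.
Qed.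

End Heap.

Lemma heap_ind (P : nat -> Prop) : P 1%N ->
  (forall m, (0 < m)%N -> P m -> P m.*2 /\ P m.*2.+1) -> forall m, (0 < m)%N -> P m.
Proof.
move=> P1 PS; elim/ltn_ind => m IH m0.
have [->//|m1] := eqVneq m 1%N.
have m20 : (0 < m./2)%N by lia.
have m2m : (m./2 < m)%N by lia.
have [h1 h2] := PS _ m20 (IH _ m2m m20).
by have [->//|->//] : m = m./2.*2 \/ m = m./2.*2.+1 by lia.
Qed.

Section Nodes.
Context {R : realType} (L : R).
Hypothesis L0 : 0 < L.

(* A node is a set together with the center and the radius of an interval that
   contains its part in [-L, L]. *)
Definition dyadic : nat -> set R * R * R :=
  heap (setT, 0, L)
    (fun x => (x.1.1 `&` [set t | t < x.1.2], x.1.2 - x.2 / 2, x.2 / 2))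
    (fun x => (x.1.1 `&` [set t | x.1.2 <= t], x.1.2 + x.2 / 2, x.2 / 2)).

Definition node m := (dyadic m).1.1.
Definition center m := (dyadic m).1.2.
Definition radius m := (dyadic m).2.

Lemma node1 : node 1 = setT. Proof. by []. Qed.

Lemma node_left m : (0 < m)%N -> node m.*2 = node m `&` [set t | t < center m].
Proof. by move=> m0; rewrite /node /dyadic heap_double. Qed.

Lemma node_right m : (0 < m)%N -> node m.*2.+1 = node m `&` [set t | center m <= t].
Proof. by move=> m0; rewrite /node /dyadic heap_doubleS. Qed.

Lemma measurable_node m : measurable (node m).
Proof.
have [->|] := posnP m; first exact: measurableT.
move: m; apply: heap_ind => [|m m0 mm]; first exact: measurableT.
rewrite node_left// node_right//; split; apply: measurableI => //.
  rewrite (_ : [set t | t < center m] = `]-oo, center m[%classic);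
    first exact: measurable_itv.
  by apply/seteqP; split => t /=; rewrite in_itv.
rewrite (_ : [set t | center m <= t] = `[center m, +oo[%classic);
  first exact: measurable_itv.
by apply/seteqP; split => t /=; rewrite in_itv/= andbT.
Qed.

Lemma node_split m t : (0 < m)%N ->
  (node m t <-> node m.*2 t \/ node m.*2.+1 t) /\ ~ (node m.*2 t /\ node m.*2.+1 t).
Proof.
move=> m0; rewrite node_left// node_right//; split.
  split=> [nt|[[]|[]]//]; have [h|h] := ltP t (center m); [by left|by right].
by move=> [[_ /= h1] [_ /= h2]]; move: h1; rewrite ltNge h2.
Qed.

Lemma radius_gt0 m : (0 < m)%N -> 0 < radius m.
Proof.
move: m; apply: heap_ind => [//|m m0 r0].
by rewrite /radius /dyadic heap_double// heap_doubleS//= divr_gt0.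
Qed.

Lemma radius_le m : (0 < m)%N -> radius m <= 2 * L / m%:R.
Proof.
move=> m0; rewrite ler_pdivlMr ?ltr0n//.
(* The product of the radius and m + 1 is the inductive quantity: it is preserved at right children
   and decreases at left ones. *)
apply: (@le_trans _ _ (radius m * m.+1%:R)).
  by rewrite ler_wpM2l ?ler_nat// ltW// radius_gt0.
move: m m0; apply: heap_ind => [|m m0 rm]; first by rewrite /radius/= mulrC.
have r0 := radius_gt0 m0.
have e1 : radius m.*2 = radius m / 2 by rewrite /radius /dyadic heap_double.
have e2 : radius m.*2.+1 = radius m / 2 by rewrite /radius /dyadic heap_doubleS.
have e : radius m.*2.+1 * m.*2.+2%:R = radius m * m.+1%:R.
  by rewrite e2 -doubleS -muln2 natrM; field.
split; last by rewrite e.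
apply: le_trans rm; rewrite -e e1 e2 ler_wpM2l ?ler_nat// divr_ge0// ltW//.
Qed.

Lemma node_radius m t : (0 < m)%N -> `|t| <= L -> node m t -> `|t - center m| <= radius m.
Proof.
move=> m0 tL; move: m m0; apply: heap_ind => [_|m m0 h]; first by rewrite /center/= subr0.
have e1 : radius m.*2 = radius m / 2 by rewrite /radius /dyadic heap_double.
have e2 : radius m.*2.+1 = radius m / 2 by rewrite /radius /dyadic heap_doubleS.
have c1 : center m.*2 = center m - radius m / 2.
  by rewrite /center /radius /dyadic heap_double.
have c2 : center m.*2.+1 = center m + radius m / 2.
  by rewrite /center /radius /dyadic heap_doubleS.
rewrite node_left// node_right// e1 e2 c1 c2.
split=> -[/h + /= tc]; rewrite !ler_norml => /andP[h1 h2]; apply/andP; split; lra.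
Qed.

(** Induction on m, one split at a time, because the leaves [m, 2m) may belong to two
    generations. *)
Lemma node_disjoint m i j t : (0 < m)%N -> (m <= i < m.*2)%N -> (m <= j < m.*2)%N ->
  node i t -> node j t -> i = j.
Proof.
elim: m i j => // m IH i j _.
have [->|m0] := posnP m; first by lia.
have [sp dis] := node_split t m0.
have leaf i' : (m.+1 <= i' < m.+1.*2)%N -> node i' t ->
    [\/ (m.+1 <= i' < m.*2)%N, i' = m.*2 | i' = m.*2.+1].
  move=> hi _; have [h|h] := ltnP i' m.*2; first by constructor 1; lia.
  by have [h'|h'] := eqVneq i' m.*2; [constructor 2|constructor 3; lia].
move=> hi hj ni nj.
have [hi'|hi'|hi'] := leaf i hi ni; have [hj'|hj'|hj'] := leaf j hj nj.
- by apply: (IH i j) => //; lia.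
- have : i = m by apply: (IH i m) => //; [lia|lia|apply/sp; left; rewrite -hj'].
  by lia.
- have : i = m by apply: (IH i m) => //; [lia|lia|apply/sp; right; rewrite -hj'].
  by lia.
- have : j = m by apply: (IH j m) => //; [lia|lia|apply/sp; left; rewrite -hi'].
  by lia.
- by rewrite hi' hj'.
- by exfalso; apply: dis; split; [rewrite -hi'|rewrite -hj'].
- have : j = m by apply: (IH j m) => //; [lia|lia|apply/sp; right; rewrite -hi'].
  by lia.
- by exfalso; apply: dis; split; [rewrite -hj'|rewrite -hi'].
- by rewrite hi' hj'.
Qed.

(** * Density of the span of the node indicators *)

Section Rays.
Variables (mu : {finite_measure set R -> \bar R}) (p : R) (p1 : 1 <= p).
Hypothesis mu_L : \forall t \ae mu, `|t| < L.
Local Notation X := (Lp mu p1).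
Local Notation ind mA := (toLp (lpindic mu p1 mA)).
Variable S : set X.
Hypothesis S0 : S 0.
Hypothesis S_lin : forall (c : R[i]) x y, S x -> S y -> S (c *: x + y).
Hypothesis S_node : forall m, (0 < m)%N -> approx_by S (ind (measurable_node m)).

Let p0 : 0 < p. Proof. exact: lt_le_trans ltr01 p1. Qed.

Lemma mu_outside (A : set R) : measurable A -> (forall t, A t -> L <= `|t|) -> mu A = 0%E.
Proof.
move=> mA AL; apply/negligibleP => //.
apply: negligibleS mu_L => t At /=; apply/negP; rewrite -leNgt; exact: AL.
Qed.

Section Path.
Variable c : R.

Fixpoint path_node k : nat :=
  if k is k'.+1 then
    if c < center (path_node k') then (path_node k').*2 else (path_node k').*2.+1
  else 1%N.

Lemma path_node_ge k : (k < path_node k)%N.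
Proof. by elim: k => //= k IH; case: ifP => _; lia. Qed.

Lemma path_node_gt0 k : (0 < path_node k)%N.
Proof. exact: leq_ltn_trans (path_node_ge k). Qed.

Lemma path_node_in k : node (path_node k) c.
Proof.
elim: k => //= k IH; have k0 := path_node_gt0 k.
by case: ltP => h; rewrite ?node_left ?node_right.
Qed.

(** The part of the ray not yet exhausted by nodes: whenever the path to c turns right, the left
    sibling lies inside the ray and is split off. *)
Definition path_ray k := `]-oo, c[%classic `&` node (path_node k).

Lemma measurable_path_ray k : measurable (path_ray k).
Proof. by apply: measurableI; [exact: measurable_itv|exact: measurable_node]. Qed.

Lemma approx_path_ray k (mc : measurable `]-oo, c[%classic) :
  approx_by S (ind mc - ind (measurable_path_ray k)).
Proof.
elim: k => [|k IH].
  rewrite (_ : ind (measurable_path_ray 0) = ind mc).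
    by rewrite subrr; exact: approx_by0.
  by apply: toLp_ext => t; rewrite /= /cindic /path_ray setIT.
have k0 := path_node_gt0 k.
have [ck|ck] := ltP c (center (path_node k)).
  rewrite (_ : ind (measurable_path_ray k.+1) = ind (measurable_path_ray k))//.
  apply: toLp_ext => t; rewrite /= /cindic; congr ((\1_ _ _)%:C).
  rewrite /path_ray /= ck node_left//; apply/seteqP; split => u /=.
    by move=> [? []].
  by rewrite in_itv/= => -[uc nu]; split => //; split => //; exact: lt_trans ck.
have -> : ind mc - ind (measurable_path_ray k.+1) =
    (ind mc - ind (measurable_path_ray k)) + ind (measurable_node (path_node k).*2).
  rewrite -!toLpB -toLpD; apply: toLp_ext => t; rewrite !(lpfunB, lpfunD) /= /cindic.
  rewrite -!rmorphB -rmorphD; congr (_%:C).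
  have [sp dis] := node_split t k0.
  have E : (\1_(path_ray k) t : R) =
      \1_(path_ray k.+1) t + \1_(node (path_node k).*2) t.
    rewrite !indicE -natrD; congr (_%:R).
    have PS : path_ray k.+1 t <-> t < c /\ node (path_node k).*2.+1 t.
      by rewrite /path_ray /= (ltNge c) ck /= in_itv.
    have P0 : path_ray k t <-> t < c /\ node (path_node k) t.
      by rewrite /path_ray /= in_itv.
    have lc : node (path_node k).*2 t -> t < c.
      by rewrite node_left// => -[_ /= h]; exact: lt_le_trans ck.
    have [nl|nl] := pselect (node (path_node k).*2 t).
      rewrite (_ : t \in path_ray k); last first.
        by rewrite inE; apply/P0; split; [exact: lc|apply/sp; left].
      rewrite (_ : (t \in path_ray k.+1) = false); last first.
        by apply/negbTE; rewrite notin_setE => /PS[_ nr]; apply: dis.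
      have nl' : t \in node (path_node k).*2 by rewrite inE.
      by rewrite nl'.
    have -> : (t \in node (path_node k).*2) = false.
      by apply/negbTE; rewrite notin_setE.
    rewrite addn0; congr nat_of_bool; apply/idP/idP; rewrite !inE.
      by move=> /P0[tc /sp[//|nr]]; apply/PS.
    by move=> /PS[tc nr]; apply/P0; split => //; apply/sp; right.
  by rewrite E; ring.
by apply: (approx_byD S_lin) => //; apply: S_node; lia.
Qed.

(** A point t < c of (-L, L) in all the path rays would share nodes of arbitrarily small radius with
    c. The ray is open at c, so an atom there does no harm. *)
Lemma path_ray_cvg : `|c| < L -> (fun k => fine (mu (path_ray k))) @ \oo --> 0.
Proof.
move=> cL.
have mI : measurable (\bigcap_k path_ray k).
  by apply: bigcapT_measurable => k; exact: measurable_path_ray.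
have I0 : mu (\bigcap_k path_ray k) = 0%E.
  apply: mu_outside => // t It; rewrite leNgt; apply/negP => tL.
  have tc : t < c by have [] := It 0%N I; rewrite /= in_itv.
  have h k : c - t <= 2 * (2 * L / k.+1%:R).
    have [_ nt] := It k I; have k0 := path_node_gt0 k.
    have h1 := node_radius k0 (ltW tL) nt.
    have h2 := node_radius k0 (ltW cL) (path_node_in k).
    have h3 := radius_le k0.
    have h4 : 2 * L / (path_node k)%:R <= 2 * L / k.+1%:R.
      rewrite ler_wpM2l ?mulr_ge0 ?(ltW L0)// lef_pV2 ?posrE ?ltr0n//.
      by rewrite ler_nat path_node_ge.
    move: (2 * L / k.+1%:R) (le_trans h3 h4) => B h5.
    move: h1 h2; rewrite !ler_norml => /andP[? ?] /andP[? ?]; lra.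
  have := h (Num.truncn (4 * L / (c - t))).
  rewrite leNgt => /negP; apply.
  have ct : 0 < c - t by rewrite subr_gt0.
  set n := Num.truncn _; have an : 4 * L / (c - t) < n.+1%:R by exact: truncnS_gt.
  rewrite mulrA ltr_pdivrMr ?ltr0n//; rewrite ltr_pdivrMr// in an.
  by rewrite [ltRHS]mulrC mulrA -natrM.
have nd : nonincreasing_seq path_ray.
  apply/nonincreasing_seqP => k; apply/subsetPset => t [tc /=].
  by case: ifP => _; [rewrite node_left|rewrite node_right]; rewrite ?path_node_gt0// => -[].
have : mu \o path_ray @ \oo --> 0%:E.
  rewrite (_ : 0%:E = mu (\bigcap_k path_ray k)); last exact/esym.
  apply: nonincreasing_cvg_mu => //; last exact: measurable_path_ray.
  by rewrite -ge0_fin_numE// fin_num_measure//; exact: measurable_path_ray.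
by move=> /fine_cvgP[].
Qed.

Lemma approx_ray (mc : measurable `]-oo, c[%classic) : approx_by S (ind mc).
Proof.
have [cL|cL] := ltP `|c| L.
  apply: approx_by_limit => e e0.
  have /cvgrPdist_lt /(_ (e `^ p)) [|k _ hk] := path_ray_cvg cL; first by rewrite powR_gt0.
  exists (ind mc - ind (measurable_path_ray k)); split; first exact: approx_path_ray.
  rewrite opprB addrC subrK; apply: rnorm_lt_of_powR => //.
  rewrite rnorm_lpindic; have := hk k (leqnn k); rewrite /= sub0r normrN.
  exact/le_lt_trans/ler_norm.
have [c0|c0] := leP 0 c.
  rewrite ger0_norm// in cL.
  rewrite (_ : ind mc = ind (measurable_node 1)); first exact: S_node.
  apply/toLpE; apply: filterS mu_L => t tL _ /=.
  have tc : t \in `]-oo, c[%classic.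
    by rewrite inE /= in_itv/=; apply: le_lt_trans (ler_norm t) (lt_le_trans tL cL).
  by rewrite /cindic !indicE node1 in_setT tc.
rewrite ltr0_norm// in cL.
rewrite (_ : ind mc = 0); first exact: approx_by0.
rewrite -toLp0; apply/toLpE; apply: filterS mu_L => t tL _ /=.
have tc : (t \in `]-oo, c[%classic) = false.
  apply/negbTE; rewrite notin_setE /= in_itv/=; apply/negP; rewrite -leNgt.
  by move: tL; rewrite ltr_norml => /andP[tL _]; lra.
by rewrite /cindic !indicE tc.
Qed.

End Path.

Lemma node_dense (x : X) : approx_by S x.
Proof.
apply: (@approx_lp _ _ _ _ _ _ (@RGenInftyO.G R)) => //.
- exact: RGenInftyO.measurableE.
- move=> A B [a ->] [b ->]; exists (Num.min a b).
  by apply/seteqP; split => t /=; rewrite !in_itv/= lt_min => /andP.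
- rewrite (_ : ind _ = ind (measurable_node 1)); first exact: S_node.
  exact: toLp_ext.
- by move=> A mA [c Ac]; subst A; exact: approx_ray.
Qed.

End Rays.
End Nodes.

(** * The Haar system in Lp *)

Section LpHaar.
Context (R : realType) (mu : {finite_measure set R -> \bar R}) (p : R).
Context (p_gt1 : 1 < p) (L : R).
Local Notation p1 := (ltW p_gt1).
Local Notation X := (Lp mu p1).
Local Notation LpF := (LpFun mu p1).
Hypothesis L0 : 0 < L.

Let p0 : 0 < p. Proof. exact: lt_trans p_gt1. Qed.

Definition node_fun m : LpF := lpindic mu p1 (measurable_node L m).
Definition node_chi m : X := toLp (node_fun m).
Definition node_weight m : R := fine (mu (node L m)).
Local Notation chi := node_chi.
Local Notation w := node_weight.

Lemma node_weight_ge0 m : 0 <= w m.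
Proof. exact: fine_ge0. Qed.

Lemma node_fun_split m t : (0 < m)%N ->
  node_fun m t = node_fun m.*2 t + node_fun m.*2.+1 t.
Proof.
move=> m0; have [sp dis] := node_split L t m0.
rewrite /= /cindic -rmorphD; congr (_%:C); rewrite !indicE -natrD; congr (_%:R).
have [nl|nl] := pselect (node L m.*2 t).
  rewrite (_ : t \in node L m); last by rewrite inE; apply/sp; left.
  rewrite (_ : t \in node L m.*2); last by rewrite inE.
  rewrite (_ : (t \in node L m.*2.+1) = false)//.
  by apply/negbTE; rewrite notin_setE => nr; apply: dis.
have -> : (t \in node L m.*2) = false by apply/negbTE; rewrite notin_setE.
rewrite add0n; congr nat_of_bool; apply/idP/idP; rewrite !inE.
  by move=> /sp[].
by move=> nr; apply/sp; right.
Qed.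

Lemma node_chi_split m : (0 < m)%N -> chi m = chi m.*2 + chi m.*2.+1.
Proof.
move=> m0; rewrite /node_chi -toLpD; apply: toLp_ext => t.
by rewrite lpfunD; exact: node_fun_split.
Qed.

Lemma node_weight_split m : (0 < m)%N -> w m = w m.*2 + w m.*2.+1.
Proof.
move=> m0; rewrite /node_weight -!(rnorm_lpindic mu p1 (measurable_node L _)).
rewrite -rnorm_disjointD; last first.
  move=> t; have [sp dis] := node_split L t m0.
  have [nl|nl] := pselect (node L m.*2 t); [right|left]; rewrite /= /cindic indicE.
    rewrite (_ : (t \in node L m.*2.+1) = false)//.
    by apply/negbTE; rewrite notin_setE => nr; apply: dis.
  by rewrite (_ : (t \in node L m.*2) = false)//; apply/negbTE; rewrite notin_setE.
congr (rnorm _ `^ p); apply: toLp_ext => t; rewrite lpfunD; exact: node_fun_split.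
Qed.

Lemma node_fun_neq0 m t : node_fun m t != 0 -> node L m t.
Proof.
apply: contra_neqP => nt; rewrite /= /cindic indicE.
by rewrite (_ : (t \in node L m) = false)//; apply/negbTE; rewrite notin_setE.
Qed.

(** Functions living on distinct leaves have disjoint supports. The family is arbitrary so that
    indicators, Haar functions and defects are all covered. *)
Lemma rnorm_leaf_sum m n0 k (f : nat -> LpF) (z : nat -> R[i]) (nd : nat -> nat) :
    (0 < m)%N -> (forall i, (i < k)%N -> (m <= nd (n0 + i) < m.*2)%N) ->
    (forall i j, (i < k)%N -> (j < k)%N -> nd (n0 + i)%N = nd (n0 + j)%N -> i = j) ->
    (forall n t, f n t != 0 -> node L (nd n) t) ->
  rnorm (\sum_(i < k) z i *: toLp (f (n0 + i)%N)) `^ p =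
  \sum_(i < k) (rnorm (z i) * rnorm (toLp (f (n0 + i)%N))) `^ p.
Proof.
move=> m0 nd_leaf nd_inj f_nd.
pose F i : LpF := z i *: f (n0 + i)%N.
have FE i : toLp (F i) = z i *: toLp (f (n0 + i)%N) by rewrite /F toLpZ.
rewrite (eq_bigr (fun i : 'I_k => toLp (F i))); last by move=> i _; rewrite FE.
rewrite rnorm_disjoint_sum.
  by apply: eq_bigr => i _; rewrite FE rnormZ.
move=> i j t /andP[ij jk]; have ik := ltn_trans ij jk.
have [fi|fi] := eqVneq (f (n0 + i)%N t) 0.
  by left; rewrite /F lpfunZ fi mulr0.
have [fj|fj] := eqVneq (f (n0 + j)%N t) 0.
  by right; rewrite /F lpfunZ fj mulr0.
have := node_disjoint L0 m0 (nd_leaf i ik) (nd_leaf j jk) (f_nd _ _ fi) (f_nd _ _ fj).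
by move=> /(nd_inj i j ik jk) ij'; rewrite ij' ltnn in ij.
Qed.

Lemma norm_leaves (z : nat -> R[i]) m : (0 < m)%N ->
  rnorm (\sum_(m <= l < m.*2) z l *: chi l) `^ p =
  \sum_(m <= l < m.*2) w l * rnorm (z l) `^ p.
Proof.
move=> m0.
have shift (V : nmodType) (F : nat -> V) :
    \sum_(m <= l < m.*2) F l = \sum_(i < m) F (m + i)%N.
  rewrite -{1}[m]add0n big_addn -addnn addnK big_mkord.
  by apply: eq_bigr => i _; rewrite addnC.
rewrite !shift (@rnorm_leaf_sum m m m node_fun (fun i => z (m + i)%N) id)//.
- apply: eq_bigr => i _; rewrite powRM ?rnorm_ge0// mulrC.
  by rewrite /node_weight -(rnorm_lpindic mu p1 (measurable_node L _)).
- by move=> i im; lia.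
- by move=> i j _ _; lia.
- exact: node_fun_neq0.
Qed.

Variable M : nat.
Hypothesis M0 : (0 < M)%N.

Definition haar_fun n : LpF :=
  if (n < M)%N then node_fun (M + n)
  else (w n.*2.+1)%:C *: node_fun n.*2 - (w n.*2)%:C *: node_fun n.*2.+1.

Local Notation v := (haar chi w M).

Lemma haar_funE n : v n = toLp (haar_fun n).
Proof. by rewrite /haar /haar_fun; case: ifP => // _; rewrite toLpB !toLpZ. Qed.

(** Each of the nodes M, ..., 2M - 1 serves twice: once for its indicator, once for its Haar
    function. *)
Definition haar_node n := if (n < M)%N then (M + n)%N else n.

Lemma haar_node_gt0 n : (0 < haar_node n)%N.
Proof. by rewrite /haar_node; case: ifP; lia. Qed.

Lemma haar_fun_neq0 n t : haar_fun n t != 0 -> node L (haar_node n) t.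
Proof.
rewrite /haar_fun /haar_node; case: ltnP => [nM|Mn]; first exact: node_fun_neq0.
apply: contra_neqP => nt; rewrite lpfunB !lpfunZ.
have n0 : (0 < n)%N by lia.
have [sp _] := node_split L t n0.
have -> : node_fun n.*2 t = 0.
  by apply: contra_notP nt => /eqP/node_fun_neq0 nl; apply/sp; left.
have -> : node_fun n.*2.+1 t = 0.
  by apply: contra_notP nt => /eqP/node_fun_neq0 nl; apply/sp; right.
by rewrite !mulr0 subr0.
Qed.

Definition haar_center n : R[i] := (center L (haar_node n))%:C.

Hypothesis supp_mu : compact (measure_support mu).
Hypothesis mu_L : \forall t \ae mu, `|t| < L.

Definition defect_fun n : LpF :=
  mul_id supp_mu (haar_fun n) - haar_center n *: haar_fun n.

Lemma defect_funE n : defect v (mul_op supp_mu) haar_center n = toLp (defect_fun n).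
Proof. by rewrite /defect haar_funE /= mul_opE toLpB toLpZ. Qed.

Lemma defect_fun_val n t : defect_fun n t = (t%:C - haar_center n) * haar_fun n t.
Proof. by rewrite lpfunB lpfunZ /= mulrBl. Qed.

Lemma defect_fun_neq0 n t : defect_fun n t != 0 -> node L (haar_node n) t.
Proof.
rewrite defect_fun_val mulf_eq0 negb_or => /andP[_]; exact: haar_fun_neq0.
Qed.

(** Outermost nodes are unbounded, so |t - center| <= radius holds on the node only where |t| <= L,
    that is, almost everywhere. *)
Lemma rnorm_defect n :
  rnorm (toLp (defect_fun n)) <= radius L (haar_node n) * rnorm (v n).
Proof.
have r0 := ltW (radius_gt0 L0 (haar_node_gt0 n)).
rewrite haar_funE -{1}(ger0_norm r0) -rnorm_real -rnormZ -toLpZ.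
apply: rnorm_toLp_le_ae; apply: filterS mu_L => t tL; rewrite defect_fun_val lpfunZ !rnormM.
have [->|ft] := eqVneq (haar_fun n t) 0; first by rewrite !rnorm0 !mulr0.
rewrite ler_wpM2r ?rnorm_ge0// /haar_center -rmorphB !rnorm_real (ger0_norm r0).
exact: node_radius (haar_node_gt0 n) (ltW tL) (haar_fun_neq0 ft).
Qed.

Local Notation s := (block_start M).
Local Notation N := (block_size M).

Lemma haar_block j (f : nat -> LpF) (z : nat -> R[i]) :
    (forall n t, f n t != 0 -> node L (haar_node n) t) ->
  rnorm (\sum_(i < N j) z i *: toLp (f (s j + i)%N)) `^ p =
  \sum_(i < N j) (rnorm (z i) * rnorm (toLp (f (s j + i)%N))) `^ p.
Proof.
move=> fn; case: j => [|j].
  apply: (@rnorm_leaf_sum M 0 _ f z haar_node) => // i.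
  - rewrite /block_size /= expn0 mul1n subn0 add0n /haar_node => iM.
    by rewrite iM; lia.
  - rewrite /block_size /= expn0 mul1n subn0 /haar_node !add0n => k iM kM.
    by rewrite iM kM => /addnI.
have jM : (M <= s j.+1)%N by rewrite /= leq_pmull// expn_gt0.
have jN : N j.+1 = s j.+1.
  by rewrite /block_size /= expnS -mulnA mul2n -addnn addnK.
have hn i : haar_node (s j.+1 + i)%N = (s j.+1 + i)%N.
  by rewrite /haar_node ifF//; lia.
apply: (@rnorm_leaf_sum (s j.+1) (s j.+1) _ f z haar_node) => //.
- by lia.
- by move=> i; rewrite jN hn => iN; lia.
- by move=> i k _ _; rewrite !hn => /addnI.
Qed.

Lemma haar_block_norm j (z : nat -> R[i]) :
  rnorm (\sum_(i < N j) z i *: v (s j + i)%N) `^ p =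
  \sum_(i < N j) (rnorm (z i) * rnorm (v (s j + i)%N)) `^ p.
Proof.
rewrite (eq_bigr (fun i : 'I_(N j) => z i *: toLp (haar_fun (s j + i)%N))); last first.
  by move=> i _; rewrite haar_funE.
rewrite (haar_block _ _ haar_fun_neq0).
by apply: eq_bigr => i _; rewrite haar_funE.
Qed.

(** The node number is at least half of [block_scale M j], which turns the 2 L of [radius_le] into 4
    L. *)
Lemma haar_radius_le j i : (i < N j)%N ->
  radius L (haar_node (s j + i)%N) <= 4 * L / block_scale M j.
Proof.
move=> iN; apply: le_trans (radius_le L0 (haar_node_gt0 _)) _.
have h0 : 0 < (haar_node (s j + i)%N)%:R :> R by rewrite ltr0n haar_node_gt0.
have d0 : 0 < block_scale M j :> R by exact: block_scale_gt0.
rewrite ler_pdivrMr// mulrAC ler_pdivlMr//.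
have : block_scale M j <= 2 * (haar_node (s j + i)%N)%:R :> R.
  rewrite /block_scale -natrM ler_nat; case: j iN {h0 d0} => [|j] iN.
    rewrite /= add0n expn0 mul1n /haar_node ifT; first by lia.
    by move: iN; rewrite /block_size /= expn0; lia.
  rewrite expnS -mulnA leq_pmul2l// /haar_node /=.
  have jM : (M <= 2 ^ j * M)%N by rewrite leq_pmull// expn_gt0.
  by rewrite ifF; lia.
move=> /(ler_wpM2l (mulr_ge0 (ler0n R 2) (ltW L0))); lra.
Qed.

(** Defects live on the same leaves as their Haar functions, so both sides are l^p sums and compare
    term by term. *)
Lemma haar_block_defect j (z : nat -> R[i]) :
  rnorm (\sum_(i < N j) z i *: defect v (mul_op supp_mu) haar_center (s j + i)%N) <=
  4 * L / block_scale M j * rnorm (\sum_(i < N j) z i *: v (s j + i)%N).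
Proof.
have rootK (x : R) : 0 <= x -> x = (x `^ p) `^ p^-1.
  by move=> x0; rewrite -powRrM mulfV ?gt_eqF// powRr1.
have d0 : 0 <= 4 * L / block_scale M j.
  by rewrite divr_ge0 ?mulr_ge0 ?(ltW L0)// ltW// block_scale_gt0.
rewrite (eq_bigr (fun i : 'I_(N j) => z i *: toLp (defect_fun (s j + i)%N))); last first.
  by move=> i _; rewrite defect_funE.
set x := \sum_(i < _) _; set y := \sum_(i < _) _.
have kle i : (i < N j)%N -> radius L (haar_node (s j + i)%N) <= 4 * L / block_scale M j.
  exact: haar_radius_le.
move: (4 * L / _) d0 kle => k k0 kle.
have ky0 : 0 <= k * rnorm y by rewrite mulr_ge0 ?rnorm_ge0.
rewrite (rootK (rnorm x)) ?rnorm_ge0// (rootK (k * rnorm y))//.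
apply: ge0_ler_powR; rewrite ?nnegrE ?invr_ge0 ?powR_ge0 ?(ltW p0)//.
rewrite powRM ?rnorm_ge0// /x /y (haar_block _ _ defect_fun_neq0) haar_block_norm.
rewrite mulr_sumr; apply: ler_sum => i _.
rewrite -powRM ?mulr_ge0 ?rnorm_ge0//.
apply: ge0_ler_powR; rewrite ?nnegrE ?mulr_ge0 ?mulr_ge0 ?rnorm_ge0 ?(ltW p0)//.
rewrite mulrCA ler_wpM2l ?rnorm_ge0//; apply: le_trans (rnorm_defect _) _.
by rewrite ler_wpM2r ?rnorm_ge0// kle.
Qed.

(** Nodes above level M are sums of their children, which reduces them to [haar_span_chi]. *)
Lemma haar_span_node m : (0 < m)%N -> haar_span chi w M (chi m).
Proof.
have big k : (M <= k)%N -> haar_span chi w M (chi k).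
  apply: (haar_span_chi M0 p0 node_weight_ge0 node_weight_split node_chi_split).
  exact: norm_leaves.
move kE : (M - m)%N => k; elim/ltn_ind: k m kE => k IH m kE m0.
have [/big//|mM] := leqP M m.
rewrite (node_chi_split m0) -[chi m.*2]scale1r.
apply: haar_span_lin; apply: (IH (M - _)%N) => //; lia.
Qed.

Lemma haar_dense (x : X) (e : R) : 0 < e ->
  exists m (a : nat -> R[i]), rnorm (x - psum v a m) < e.
Proof.
move=> e0; have [||m m0|y [[m [a ->]] xy]] :=
  @node_dense _ _ L0 _ _ _ mu_L (haar_span chi w M) _ _ _ x e e0.
- exact: haar_span0.
- by move=> c y z; exact: haar_span_lin.
- by apply: approx_by_sub; exact: haar_span_node.
- by exists m, a.
Qed.

End LpHaar.

(** * Choice of the parameters and assembly *)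

Lemma rnorm_mul_op (R : realType) (mu : {finite_measure set R -> \bar R}) (p : R)
    (p1 : 1 <= p) (supp_mu : compact (measure_support mu)) (L : R) :
  0 < L -> (\forall t \ae mu, `|t| < L) ->
  forall f : Lp mu p1, rnorm (mul_op supp_mu f) <= L * rnorm f.
Proof.
move=> L0 mu_L f; rewrite -[f]ofLpK mul_opE.
rewrite -{1}(ger0_norm (ltW L0)) -rnorm_real -rnormZ -toLpZ.
apply: rnorm_toLp_le_ae; apply: filterS mu_L => t tL.
rewrite lpfunZ /= !rnormM !rnorm_real (ger0_norm (ltW L0)).
by rewrite ler_wpM2r ?rnorm_ge0// ltW.
Qed.

Lemma decay_constant (R : realType) (a theta eps : R) :
  0 <= a -> 0 < theta -> 0 < eps ->
  exists2 M : nat, (0 < M)%N & a * M%:R `^ (- theta) < eps.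
Proof.
move=> a0 theta0 eps0; pose z := (a / eps) `^ theta^-1.
exists (Num.truncn z).+1 => //.
have z0 : 0 <= z by exact: powR_ge0.
have zM : z < (Num.truncn z).+1%:R by exact: truncnS_gt.
rewrite powRN ltr_pdivrMr ?powR_gt0 ?ltr0n// mulrC -ltr_pdivrMr//.
have -> : a / eps = z `^ theta.
  by rewrite /z -powRrM mulVf ?gt_eqF// powRr1// divr_ge0// ltW.
by apply: gt0_ltr_powR; rewrite ?nnegrE ?ler0n.
Qed.

Theorem theorem2p3 (R : realType) (p : R) (p_gt1 : 1 < p) :
  exists C : R, 0 < C /\
  forall (mu : {finite_measure set R -> \bar R})
    (supp_mu : compact (measure_support mu)) (eps : R), 0 < eps ->
  exists K D : {linear Lp mu (ltW p_gt1) -> Lp mu (ltW p_gt1)},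
    [/\ bounded_operator K, compact_operator K, (one_summing_norm K < eps%:E)%E,
        bounded_operator D /\
        (exists (N : option nat) (u : nat -> Lp mu (ltW p_gt1)),
           unconditional_basis C N u /\ diagonal_wrt N u D) &
        forall f : Lp mu (ltW p_gt1),
          mul_op supp_mu f = D f + K f].
Proof.
have p0 : 0 < p by apply: lt_trans p_gt1.
have [C1 C10 hC1] := haar_transform p_gt1.
pose C := C1 `^ p^-1; have C0 : 0 < C by rewrite powR_gt0.
exists C; split => // mu supp_mu eps eps0.
have [B B0 suppB] := pinfty_ex_gt0 (compact_bounded supp_mu).
(* The margin 1 makes |t| < L strict, so that a ray ]-oo, c[ with c >= L has full measure. *)
pose L := B + 1; have L0 : 0 < L by rewrite addr_gt0.
have mu_L : \forall t \ae mu, `|t| < L.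
  apply: filterS (@ae_measure_support _ mu) => t /suppB tB.
  by apply: le_lt_trans tB _; rewrite ltrDl.
pose theta := Num.min 2^-1 p^-1.
have theta0 : 0 < theta by rewrite lt_min !invr_gt0 p0 ltr0n.
have r1 : 0 < 1 - 2 `^ (- theta) :> R by rewrite subr_gt0 powR2N_lt1.
have rho0 : 0 < 4 * L by rewrite mulr_gt0.
(* M depends on eps and on the support of mu; C was fixed before both. *)
have [|//|//|M M0 hM] := @decay_constant _ (18 * (4 * L) * C / (1 - 2 `^ (- theta))) theta eps.
  by rewrite divr_ge0 ?(ltW r1)// mulr_ge0 ?(ltW C0)// mulr_ge0// ltW.
pose v := haar (node_chi mu p_gt1 L) (node_weight mu L) M.
have uncond (a b : nat -> R[i]) m : (forall n, (n < m)%N -> rnorm (a n) <= rnorm (b n)) ->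
    rnorm (psum v a m) <= C * rnorm (psum v b m).
  move=> ab.
  have hw := hC1 _ _ M0 (node_weight_ge0 mu L) (node_weight_split mu p_gt1 L).
  exact: (haar_unconditional M0 p0 (node_chi_split mu p_gt1 L)
    (norm_leaves mu p_gt1 L0) C10 hw ab).
have [coef [[coef_cvg coef0 coef_lin coef_bound coef_v] coef_uniq]] :=
  coef_exists C0 uncond (haar_dense L0 M0 mu_L).
have defect_le := haar_block_defect p_gt1 L0 M0 supp_mu mu_L.
have [K hK] := Kfun_exists C0 rho0 M0 coef_lin coef_bound (@Lp_abs_complete _ _ _ _ _ _) defect_le.
pose D : {linear Lp mu (ltW p_gt1) -> Lp mu (ltW p_gt1)} := mul_op supp_mu \- K.
exists K, D.
have K_le := K_bound C0 rho0 M0 coef_bound defect_le hK.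
split.
- exact: bounded_operator_rnorm K_le.
- exact: (K_compact C0 rho0 M0 coef0 coef_bound (@Lp_abs_complete _ _ _ _ _ _) defect_le hK).
- apply: le_lt_trans (K_summing C0 rho0 p_gt1 M0 coef_lin coef_bound
    (haar_block_norm mu p_gt1 L0 M0) defect_le hK) _.
  by rewrite lte_fin mulrAC.
- split.
    apply: (@bounded_operator_rnorm _ _ D (L + 2 * (4 * L) * C / block_scale M 0)) => f.
    apply: le_trans (ler_rnormD _ _) _; rewrite rnormN mulrDl.
    by apply: lerD; [exact: rnorm_mul_op|exact: K_le].
  have [N [u [u_basis u_v]]] := nonzero_subsequence_basis C0 uncond coef_cvg coef_uniq.
  exists N, u; split => // n /u_v[i vi ->]; exists (haar_center L M i).
  by rewrite /D /= (K_v C0 rho0 p_gt1 M0 coef_v hK vi) /defect opprB addrC subrK.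
- by move=> f; rewrite /D /= subrK.
Qed.
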